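(* There is a one-sided error randomized algorithm that, given an instance $\mathcal{I}$ of Target Weighted Gerrymandering in which the input graph is a path (with a fixed tie-breaking rule), runs in time $2^{k-k^\star}|\mathcal{I}|^{\mathcal{O}(1)}$, outputs ``yes'' with probability at least $2/3$ if $\mathcal{I}$ is a yes-instance, and always outputs ``no'' if $\mathcal{I}$ is a no-instance.
   Context: A district is a nonempty $U\subseteq V(G)$ with $G[U]$ connected. A tie-breaking rule $\eta$ assigns to every district $U$ a single winner $\eta(U)\in\arg\max_{q\in\mathcal{C}}\sum_{v\in U}w_v(q)$, where each voter $v$ has weight function $w_v\colon\mathcal{C}\to\mathbb{Z}^+$ over the candidate set $\mathcal{C}$. Target Weighted Gerrymandering: given a graph $G$, $\mathcal{C}$, $\{w_v\}_{v\in V(G)}$, a distinguished candidate $p\in\mathcal{C}$, and positive integers $k,k^\star$, decide whether $V(G)$ can be partitioned into $k$ pairwise disjoint districts such that $p$ wins in exactly $k^\star$ districts and no other candidate wins in more than $k^\star-1$ districts. $|\mathcal{I}|$ denotes the size of the instance. *)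

(* Defs.v *)
From mathcomp Require Import all_boot all_order all_algebra.
From mathcomp Require Import boolp.

Set Implicit Arguments.
Unset Strict Implicit.
Unset Printing Implicit Defensive.

(** * Target Weighted Gerrymandering *)

Record instance := Instance {
  nvoters : nat;
  ncands : nat;
  adj : rel 'I_nvoters;
  weight : 'I_nvoters -> 'I_ncands -> nat;
  target : 'I_ncands;
  ndistr : nat;
  nwins : nat;
  adj_sym : symmetric adj;
  adj_irr : irreflexive adj;
  weight_gt0 : forall v q, 0 < weight v q;
  ndistr_gt0 : 0 < ndistr;
  nwins_gt0 : 0 < nwins }.

Section Problem.

Variable I : instance.
Let V : finType := 'I_(nvoters I).
Let C : finType := 'I_(ncands I).

Definition is_path : Prop :=
  0 < nvoters I /\
  exists2 f : V -> V, bijective f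
    & forall i j : V, adj (f i) (f j) = (i.+1 == j :> nat) || (j.+1 == i :> nat).

Definition induced (U : {set V}) : rel V :=
  [rel u v | [&& u \in U, v \in U & adj u v]].

Definition district (U : {set V}) : bool :=
  (U != set0) && [forall u in U, forall v in U, connect (induced U) u v].

(** The values of [eta] on sets that are not districts are irrelevant. *)
Definition tie_breaking (eta : {set V} -> C) : Prop :=
  forall U, district U ->
  forall q, \sum_(v in U) weight v q <= \sum_(v in U) weight v (eta U).

Definition yes_instance (eta : {set V} -> C) : Prop :=
  exists P : {set {set V}},
    [/\ partition P [set: V] && [forall U in P, district U],
        #|P| = ndistr I,
        #|[set U in P | eta U == target I]| = nwins I
      & forall q, q != target I ->
          #|[set U in P | eta U == q]| <= nwins I - 1].

End Problem.

(** * Probabilistic oracle RAM with the logarithmic cost criterion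

    Programs are structured; they use variables [x0, x1, ...] (finitely many
    in each program) and a memory of natural numbers, both of unbounded word
    size, every access being charged the bit lengths of the numbers involved. *)

Definition bitlen (x : nat) : nat := (trunc_log 2 x).+1.

Inductive arith := Add | Sub | Mul | Div.

Definition arith_fun (o : arith) : nat -> nat -> nat :=
  match o with Add => addn | Sub => subn | Mul => muln | Div => divn end.

Inductive cmd :=
| Skip
| Const of nat & nat                (* x := constant *)
| Arith of arith & nat & nat & nat  (* x := y op z *)
| Fetch of nat & nat                 (* x := mem[y] *)
| Put of nat & nat                (* mem[x] := y *)
| Flip of nat                       (* x := fair coin *)
| Query of nat & nat & nat          (* x := oracle (mem[y], ..., mem[y+z-1]) *)
| Seq of cmd & cmd
| If of nat & cmd & cmd
| While of nat & cmd.

Record state := State {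
  vars : nat -> nat;
  mem : nat -> nat;
  coins : seq bool }.

Definition set_var (s : state) (x a : nat) : state :=
  State [eta vars s with x |-> a] (mem s) (coins s).

Definition set_mem (s : state) (i a : nat) : state :=
  State (vars s) [eta mem s with i |-> a] (coins s).

(** [exec O c s t s']: from [s], [c] halts in [s'] after time [t], using the
    oracle [O].  A [Flip] consumes the next coin; it is stuck if none is left.
    As it costs one unit, a computation of time [T] uses at most [T] coins. *)
Inductive exec (O : seq nat -> nat) : cmd -> state -> nat -> state -> Prop :=
| ESkip s : exec O Skip s 1 s
| EConst s x a : exec O (Const x a) s (bitlen a) (set_var s x a)
| EArith s o x y z :
    exec O (Arith o x y z) s (bitlen (vars s y) + bitlen (vars s z))
      (set_var s x (arith_fun o (vars s y) (vars s z)))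
| EFetch s x y :
    exec O (Fetch x y) s (bitlen (vars s y) + bitlen (mem s (vars s y)))
      (set_var s x (mem s (vars s y)))
| EPut s x y :
    exec O (Put x y) s (bitlen (vars s x) + bitlen (vars s y))
      (set_mem s (vars s x) (vars s y))
| EFlip s x b r : coins s = b :: r ->
    exec O (Flip x) s 1 (set_var (State (vars s) (mem s) r) x b)
| EQuery s x y z :
    let idx := iota (vars s y) (vars s z) in
    let ans := O [seq mem s i | i <- idx] in
    exec O (Query x y z) s
      (bitlen (vars s y) + bitlen (vars s z) + bitlen ans
        + \sum_(i <- idx) (bitlen i + bitlen (mem s i)))
      (set_var s x ans)
| ESeq c1 c2 s1 s2 s3 t1 t2 :
    exec O c1 s1 t1 s2 -> exec O c2 s2 t2 s3 ->
    exec O (Seq c1 c2) s1 (t1 + t2) s3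
| EIf x c1 c2 s t s' :
    exec O (if vars s x != 0 then c1 else c2) s t s' ->
    exec O (If x c1 c2) s (bitlen (vars s x) + t) s'
| EWhileEnd x c s : vars s x = 0 ->
    exec O (While x c) s (bitlen (vars s x)) s
| EWhileStep x c s1 s2 s3 t1 t2 : vars s1 x != 0 ->
    exec O c s1 t1 s2 -> exec O (While x c) s2 t2 s3 ->
    exec O (While x c) s1 (bitlen (vars s1 x) + t1 + t2) s3.

Lemma exec_det O c s t1 s1 t2 s2 :
  exec O c s t1 s1 -> exec O c s t2 s2 -> t1 = t2 /\ s1 = s2.
Proof.
move=> e1; elim: e1 t2 s2 => {c s t1 s1}
  [s|s x a|s o x y z|s x y|s x y|s x b r E|s x y z idx ans
  |c1 c2 s1 s2 s3 t1 t2 _ IH1 _ IH2|x c1 c2 s t s' _ IH|x c s E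
  |x c s1 s2 s3 t1 t2 E _ IH1 _ IH2] t' s'' e; inversion e; subst=> //.
- by match goal with H : coins s = _ |- _ => move: H; rewrite E => -[-> ->] end.
- match goal with H : exec _ c1 _ _ ?m, H' : exec _ c2 ?m _ _ |- _ =>
    have [-> Em] := IH1 _ _ H; rewrite -Em in H';
    by have [-> ->] := IH2 _ _ H' end.
- by match goal with H : exec _ _ _ _ _ |- _ => have [-> ->] := IH _ _ H end.
- by match goal with H : is_true (vars _ _ != 0) |- _ => rewrite E in H end.
- by match goal with H : vars _ _ = 0 |- _ => rewrite H in E end.
- match goal with H : exec _ c _ _ ?m, H' : exec _ (While x c) ?m _ _ |- _ =>
    have [-> Em] := IH1 _ _ H; rewrite -Em in H';
    by have [-> ->] := IH2 _ _ H' end.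
Qed.

Definition init (input : seq nat) (r : seq bool) : state :=
  State (fun=> 0) (fun i => nth 0 input i) r.

Definition halts_within (O : seq nat -> nat) (A : cmd) (input : seq nat)
    (T : nat) (r : seq bool) : Prop :=
  exists t s, exec O A (init input r) t s /\ t <= T.

Definition outputs (O : seq nat -> nat) (A : cmd) (input : seq nat)
    (r : seq bool) (answer : bool) : Prop :=
  exists t s, exec O A (init input r) t s /\ (vars s 0 != 0) = answer.

(** Probability over [T] independent fair coins. *)
Definition prob_yes (O : seq nat -> nat) (A : cmd) (input : seq nat)
    (T : nat) : rat :=
  (#|[set r : T.-tuple bool | `[< outputs O A input r true >]]|%:R
    / (2 ^ T)%:R)%R.

(** * Instances as inputs *)

Definition encode (I : instance) : seq nat :=
  [:: nvoters I; ncands I; nat_of_ord (target I); ndistr I; nwins I]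
  ++ [seq nat_of_bool (adj u v) | u <- enum 'I_(nvoters I),
                                  v <- enum 'I_(nvoters I)]
  ++ [seq weight v q | v <- enum 'I_(nvoters I), q <- enum 'I_(ncands I)].

Definition instance_size (I : instance) : nat :=
  \sum_(x <- encode I) bitlen x.

(** The tie-breaking rule is accessed by listing the voters of a set. *)
Definition oracle (I : instance)
    (eta : {set 'I_(nvoters I)} -> 'I_(ncands I)) (q : seq nat) : nat :=
  eta [set v : 'I_(nvoters I) | nat_of_ord v \in q].

(* Main.v *)
From Pilot Require Import Defs.
From mathcomp Require Import all_boot all_order all_algebra.
From mathcomp Require Import boolp perm zify ring.
Import Pilot.Defs.
Import GRing.Theory.

(* A division of the path v_0 ... v_(n-1) into k districts is a path from 0 to  *)
(* n in the graph of the arcs (i, j), i < j, standing for the district           *)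
(* {v_i, ..., v_(j-1)}.  Give every rival of p k* - 1 copies, and let every arc  *)
(* won by a rival choose a copy: the instance is positive iff some path with k   *)
(* arcs, l = k - k* of which are lost by p, chooses distinct copies.             *)
(*   Over F_2[X], weigh a path by the product of random polynomials x_(i,j,c),   *)
(* one for each arc and copy, times the determinant of the l x l matrix with     *)
(* rows (X^(t u))_(u < l) for the numbers t of the copies chosen.  It is a       *)
(* Vandermonde determinant, nonzero iff the copies are distinct; the monomials   *)
(* of the paths are pairwise distinct, so by Schwartz-Zippel the total weight    *)
(* is zero in a positive instance with small probability only.                   *)
(*   In characteristic 2, det Y is the sum over the subsets L of the columns of  *)
(* the product over the rows t of sum_(u in L) Y_(t,u), since the terms of the   *)
(* expansion that do not use all the columns occur an even number of times.      *)
(* For a fixed L the sum over the paths is computed by dynamic programming;      *)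
(* there are 2^l sets L.  Polynomials over F_2 are replaced by integers, namely  *)
(* the values at 2^b of polynomials with coefficients in N less than 2^b, whose  *)
(* coefficients modulo 2 are the parities of the digits in base 2^b.             *)

Set Implicit Arguments.
Unset Strict Implicit.
Unset Printing Implicit Defensive.

(** * Compiling expressions to the RAM *)

(** Combinatorics. In a path graph the districts are the segments ([district_segment]), so
    partitions into districts are tilings, that is, paths of arcs. Giving each rival [nwins I - 1]
    copies turns the bound on its wins into distinctness of copies, so a positive instance is an arc
    path of fixed size whose rival arcs use pairwise distinct copies ([yes_solvable]). The order of
    the voters along the path is recovered from the adjacency matrix ([traversal_labelling]).

    Algebra. Over F_2[X], [path_sum_det] shows that the sum of the path sums over all masks is a sum
    over arc paths: a product of random words, one per arc, times a Vandermonde determinant, which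
    vanishes exactly when a copy is repeated ([path_det_neq0]). In a negative instance every term is
    zero whatever the coins are ([fingerprint_sound]), whence the one-sided error. In a positive one
    some term survives, and no other path has the same arcs ([arc_index_paths_inj]), so the
    polynomial in the words is nonzero; with S^3 words of d coins each, [schwartz_zippel] and
    [bernoulli] bound the probability of a zero value by S^3 / 2^d, at most 1/3
    ([fingerprint_complete]).

    Time. For one mask the recurrence [path_sum] has polynomially many entries, and there are 2^l
    masks, where l is the number of districts that the target does not win. The program evaluates
    the same expression in the natural numbers at X = 2^b. Since it commutes with semiring
    morphisms, and b exceeds the length of every coefficient, the coefficients modulo 2 are read off
    the digits ([fingerprint_digits]); all the numbers have polynomial length ([fingerprint_le]).

    Machine. The program is a list of array definitions over a small expression language.
    [compile_exec] compiles expressions at polynomial cost, and [prog_exec] bounds the total time by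
    the length of the longest array times a polynomial, so that 2^l enters only once. [verdictE]
    links the output to the polynomial. *)

Lemma leq_bitlen x k : 0 < k -> (bitlen x <= k) = (x < 2 ^ k).
Proof.
case: k => // k _; rewrite /bitlen ltnS.
apply/idP/idP => [le_xk|lt_xk].
  by apply: leq_trans (trunc_log_ltn x (isT : 1 < 2)) _; rewrite leq_exp2l.
case: x lt_xk => [|x] lt_xk; first by rewrite trunc_log0.
rewrite leqNgt; apply/negP => lt_k.
have := trunc_logP (isT : 1 < 2) (isT : 0 < x.+1).
by rewrite leqNgt (leq_trans lt_xk) // leq_exp2l.
Qed.

Lemma bitlen_gt0 x : 0 < bitlen x. Proof. by []. Qed.

Lemma ltn_bitlen x : x < 2 ^ bitlen x.
Proof. by rewrite -leq_bitlen. Qed.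

Lemma bitlen_mono x y : x <= y -> bitlen x <= bitlen y.
Proof. by move=> le_xy; rewrite leq_bitlen // (leq_ltn_trans le_xy) ?ltn_bitlen. Qed.

Lemma bitlenD x y : bitlen (x + y) <= bitlen x + bitlen y.
Proof.
rewrite leq_bitlen ?addn_gt0 // expnD.
have := ltn_bitlen x; have := ltn_bitlen y.
have ? : 2 <= 2 ^ bitlen x by rewrite -{1}(expn1 2) leq_exp2l.
have ? : 2 <= 2 ^ bitlen y by rewrite -{1}(expn1 2) leq_exp2l.
nia.
Qed.

Lemma bitlenM x y : bitlen (x * y) <= bitlen x + bitlen y.
Proof.
rewrite leq_bitlen ?addn_gt0 // expnD.
by apply: ltn_mul; exact: ltn_bitlen.
Qed.

Lemma bitlen_arith o x y : bitlen (arith_fun o x y) <= bitlen x + bitlen y.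
Proof.
case: o => /=; [exact: bitlenD| |exact: bitlenM|].
- by rewrite (leq_trans _ (leq_addr _ _)) // bitlen_mono ?leq_subr.
- by rewrite (leq_trans _ (leq_addr _ _)) // bitlen_mono ?leq_div.
Qed.

Lemma bitlen_le_self x : bitlen x <= x.+1.
Proof. rewrite leq_bitlen //; apply: ltn_trans (ltnSn x) _; exact: ltn_expl. Qed.

Lemma bitlen_leq x k : 0 < k -> x <= k -> bitlen x <= k.
Proof. by move=> k0 xk; rewrite leq_bitlen // (leq_ltn_trans xk) // ltn_expl. Qed.

Lemma bitlen_sum n (F : nat -> nat) b : (forall i, i < n -> bitlen (F i) <= b) ->
  bitlen (\sum_(i < n) F i) <= n + b.+1.
Proof.
move=> Fb; rewrite leq_bitlen ?addnS // expnS expnD.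
have le_n : n < 2 ^ n by exact: ltn_expl.
have: \sum_(i < n) F i <= n * 2 ^ b.
  rewrite -[X in X * _]card_ord -sum_nat_const; apply: leq_sum => i _.
  case: b Fb => [|b] Fb; first by have := Fb _ (ltn_ord i).
  by apply: ltnW; rewrite -leq_bitlen // Fb.
have : 0 < 2 ^ b by rewrite expn_gt0.
nia.
Qed.

Inductive expr :=
| ECst of nat
| EVar of nat
| EOp of arith & expr & expr
| EMem of expr
| EAsk of expr & expr
| ESum of expr & expr.

Section Language.

Variable O : seq nat -> nat.

Definition update (v : nat -> nat) x a : nat -> nat := [eta v with x |-> a].

(* [x] is the register of the next bound variable: the index of [ESum n e] is   *)
(* [EVar x] in [e], where the next one is [EVar x.+1].                           *)
Fixpoint eval (m v : nat -> nat) (x : nat) (e : expr) : nat :=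
  match e with
  | ECst c => c
  | EVar r => v r
  | EOp o a b => arith_fun o (eval m v x a) (eval m v x b)
  | EMem a => m (eval m v x a)
  | EAsk a b => O [seq m i | i <- iota (eval m v x a) (eval m v x b)]
  | ESum n e => \sum_(i < eval m v x n) eval m (update v x i) x.+1 e
  end.

(** Live variables occupy the registers below [x], the indices of nested sums take [x], [x.+1], ...
    below [K], and scratch registers start at [K]: compiled code cannot overwrite a variable still
    in use. *)
Fixpoint wf (K x : nat) (e : expr) : bool :=
  match e with
  | ECst _ => true
  | EVar r => r < x
  | EOp _ a b => wf K x a && wf K x b
  | EMem a => wf K x a
  | EAsk a b => wf K x a && wf K x b
  | ESum n e => [&& wf K x n, x < K & wf K x.+1 e]
  end.

Fixpoint tame (X : nat) (m v : nat -> nat) (x : nat) (e : expr) : Prop :=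
  match e with
  | ECst c => bitlen c <= X
  | EVar r => True
  | EOp o a b => tame X m v x a /\ tame X m v x b
  | EMem a => tame X m v x a
  | EAsk a b => [/\ tame X m v x a, tame X m v x b & eval m v x b <= X]
  | ESum n e => [/\ tame X m v x n, eval m v x n <= X
      & forall i, i < eval m v x n -> tame X m (update v x i) x.+1 e]
  end.

(* When the registers, the memory cells and the answers of the oracle have at   *)
(* most [X] bits, and the sums at most [X] terms, [X ^ rank e] bounds both the   *)
(* length of the value of [e] and the time to compute it.                        *)
Fixpoint rank (e : expr) : nat :=
  match e with
  | ECst _ => 1
  | EVar _ => 2
  | EOp _ a b => (rank a + rank b).+1
  | EMem a => (rank a).+1
  | EAsk a b => (rank a + rank b).+3
  | ESum n e => (rank n + rank e).+4
  end.

(** A register can only be compared with 0, so [c] holds the number [b - x] of iterations left;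
    between two tests it also supplies the constant 1 of the increment. *)
Definition for_loop (x b c : nat) (body : cmd) : cmd :=
  Seq (Arith Sub c b x)
    (While c (Seq body (Seq (Const c 1)
      (Seq (Arith Add x x c) (Arith Sub c b x))))).

(* The result goes to register [d]; the registers above [d] are clobbered. *)
Fixpoint compile (x d : nat) (e : expr) : cmd :=
  match e with
  | ECst c => Const d c
  | EVar r => Seq (Const d 0) (Arith Add d d r)
  | EOp o a b => Seq (compile x d a) (Seq (compile x d.+1 b) (Arith o d d d.+1))
  | EMem a => Seq (compile x d a) (Fetch d d)
  | EAsk a b => Seq (compile x d a) (Seq (compile x d.+1 b) (Query d d d.+1))
  | ESum n e => Seq (compile x d.+1 n) (Seq (Const d 0) (Seq (Const x 0)
      (for_loop x d.+1 d.+2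
         (Seq (compile x.+1 d.+3 e) (Arith Add d d d.+3)))))
  end.

Lemma eval_ext K m m' v v' x e : wf K x e -> (forall a, m a = m' a) ->
  (forall r, r < x -> v r = v' r) -> eval m v x e = eval m' v' x e.
Proof.
move=> + Em; elim: e x v v' => [c|r|o a IHa b IHb|a IHa|a IHa b IHb|n IHn e IHe] x v v' /=.
- by [].
- by move=> lt_rx ->.
- by case/andP=> wa wb Ev; rewrite (IHa _ v v') // (IHb _ v v').
- by move=> wa Ev; rewrite (IHa _ v v') // Em.
- case/andP=> wa wb Ev; rewrite (IHa _ v v') // (IHb _ v v') //.
  by congr O; apply: eq_map.
- case/and3P=> wn _ we Ev; rewrite (IHn _ v v') //.
  apply: eq_bigr => i _; apply: IHe => // r; rewrite ltnS leq_eqVlt /update /=.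
  by case: eqP => //= _; exact: Ev.
Qed.

(** A Hoare rule. The invariant must survive writes to the counter and to the test register, and the
    body must leave the counter and the bound with their values; [6 * B + 1] generously covers the
    test and the update of the counter. *)
Lemma loop_exec (x b c : nat) (body : cmd) (Inv : nat -> state -> Prop) n Tb B s :
  c != x -> c != b -> x != b -> bitlen n <= B ->
  (forall i s y a, (y == x) || (y == c) -> Inv i s -> Inv i (set_var s y a)) ->
  (forall i s, i < n -> Inv i s -> vars s x = i -> vars s b = n ->
     exists t s', [/\ exec O body s t s', t <= Tb, vars s' x = i,
       vars s' b = n & Inv i.+1 s']) ->
  Inv 0 s -> vars s x = 0 -> vars s b = n ->
  exists t s', [/\ exec O (for_loop x b c body) s t s',
     t <= n.+1 * (Tb + 6 * B + 1), vars s' x = n, vars s' b = n & Inv n s'].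
Proof.
move=> cx cb xb nB Inv_set body_ok I0 x0 bn.
have neqE := (eqxx, negbTE cx, negbTE cb, negbTE xb).
have {}neqE := (neqE, eq_sym x c, eq_sym b c, eq_sym b x, negbTE cx, negbTE cb, negbTE xb).
have B0 : 0 < B by exact: leq_trans nB.
have loop_ok : forall i s, i <= n -> Inv i s -> vars s x = i -> vars s b = n ->
    vars s c = n - i ->
    exists t s', [/\ exec O (While c (Seq body (Seq (Const c 1)
       (Seq (Arith Add x x c) (Arith Sub c b x))))) s t s',
       t <= (n - i) * (Tb + 6 * B + 1) + B, vars s' x = n, vars s' b = n & Inv n s'].
  move=> {s I0 x0 bn} i s; move Ek: (n - i) => k.
  elim: k i s Ek => [|k IHk] i s Ek le_in Ii xi bn ci.
    have Ein : i = n by apply/eqP; rewrite eqn_leq le_in -subn_eq0 Ek.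
    rewrite {i}Ein in xi Ii ci le_in Ek *; exists (bitlen (vars s c)), s; split=> //; first exact: EWhileEnd.
    by rewrite ci (leq_trans _ (leq_addl _ _)) // (leq_trans _ nB) // bitlen_mono.
  have lt_in : i < n by rewrite -subn_gt0 Ek.
  have [t1 [s1 [e1 t1b x1 b1 I1]]] := body_ok i s lt_in Ii xi bn.
  set s2 := set_var s1 c 1.
  set s3 := set_var s2 x (vars s2 x + vars s2 c).
  set s4 := set_var s3 c (vars s3 b - vars s3 x).
  have x2 : vars s2 x = i by rewrite /s2 /= !neqE.
  have c2 : vars s2 c = 1 by rewrite /s2 /= !neqE.
  have x3 : vars s3 x = i.+1 by rewrite /s3 x2 c2 /= !neqE addn1.
  have b3 : vars s3 b = n by rewrite /s3 /= !neqE.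
  have x4 : vars s4 x = i.+1 by rewrite /s4 /= !neqE x1 addn1.
  have b4 : vars s4 b = n by rewrite /s4 /= !neqE.
  have c4 : vars s4 c = n - i.+1 by rewrite /s4 b3 x3 /= !neqE.
  have I4 : Inv i.+1 s4.
    by do 3!(apply: (Inv_set); first by rewrite eqxx ?orbT).
  have [t5 [s5 [e5 t5b x5 b5 I5]]] := IHk i.+1 s4 (ltac:(lia)) lt_in I4 x4 b4
    (ltac:(by rewrite c4; lia)).
  have B2 : bitlen (vars s2 x) <= B by rewrite x2 (leq_trans _ nB) // bitlen_mono // ltnW.
  have B3 : bitlen (vars s3 x) <= B by rewrite x3 (leq_trans _ nB) // bitlen_mono.
  have Bc : bitlen (vars s c) <= B.
    by rewrite ci (leq_trans _ nB) // bitlen_mono // -Ek leq_subr.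
  have Bb : bitlen (vars s3 b) <= B by rewrite b3.
  have c1 : bitlen (vars s2 c) = 1 by rewrite c2.
  exists (bitlen (vars s c) + (t1 + (bitlen 1 + (bitlen (vars s2 x) + bitlen (vars s2 c)
     + (bitlen (vars s3 b) + bitlen (vars s3 x))))) + t5), s5; split=> //.
    apply: EWhileStep e5; first by rewrite ci.
    apply: ESeq e1 _; apply: ESeq; first exact: EConst.
    by apply: ESeq; exact: EArith.
  rewrite c1 mulSn; have -> : bitlen 1 = 1 by []. lia.
set s1 := set_var s c (vars s b - vars s x).
have [] := loop_ok 0 s1 => //; rewrite ?/s1 /=.
- by apply: Inv_set => //; rewrite eqxx orbT.
- by rewrite !neqE.
- by rewrite !neqE.
- by rewrite !neqE x0 bn.
move=> t [s' [e' tb x' b' I']]; exists (bitlen (vars s b) + bitlen (vars s x) + t), s'.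
split=> //; first by apply: ESeq e'; exact: EArith.
have : bitlen (vars s b) <= B by rewrite bn.
have : bitlen (vars s x) <= B by rewrite x0 (leq_trans _ nB) // bitlen_mono.
rewrite subn0 in tb. nia.
Qed.

Section Cost.

Variable X : nat.
Hypothesis X8 : 8 <= X.
Hypothesis O_bound : forall l, bitlen (O l) <= X.

(** The reason why [rank] adds the ranks of subterms: the cost of a node is about the sum of the
    bounds of its subterms, and one more factor [X] lets the product absorb it. *)
Lemma leq_add_mul3 p q : X <= p -> X <= q -> p + q < X * (p * q).
Proof.
move=> Xp Xq; have ? : 2 * p <= p * q by rewrite mulnC leq_mul2l; lia.
have ? : 2 * q <= p * q by rewrite leq_mul2r; lia.
have ? : 2 * (p * q) <= X * (p * q) by rewrite leq_mul2r; lia.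
lia.
Qed.

Lemma rank_gt0 e : 0 < rank e. Proof. by case: e. Qed.

Lemma expn_rank_ge e : X <= X ^ rank e.
Proof. by rewrite -{1}(expn1 X) leq_pexp2l ?rank_gt0 //; lia. Qed.

Lemma bitlen_eval K m v x e : wf K x e -> tame X m v x e ->
  (forall a, bitlen (m a) <= X) -> (forall r, r < x -> bitlen (v r) <= X) ->
  bitlen (eval m v x e) <= X ^ rank e.
Proof.
move=> + + mb; elim: e x v => [c|r|o a IHa b IHb|a IHa|a IHa b IHb|n IHn e IHe] x v /=.
- by rewrite expn1.
- by move=> lt_rx _ /(_ _ lt_rx) /leq_trans; apply; rewrite expnS; nia.
- case/andP=> wa wb [ta tb] vb.
  apply: leq_trans (bitlen_arith _ _ _) _.
  rewrite expnS expnD (leq_trans _ (ltnW (leq_add_mul3 _ _))) ?expn_rank_ge //.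
  by rewrite leq_add ?IHa ?IHb.
- move=> _ _ _; apply: leq_trans (mb _) _; rewrite expnS.
  have := expn_rank_ge a; nia.
- move=> _ _ _; apply: leq_trans (O_bound _) _.
  by rewrite -{1}(expn1 X) leq_pexp2l //; lia.
- case/and3P=> wn xK we [tn nX te] vb.
  have Fb i : i < eval m v x n -> bitlen (eval m (update v x i) x.+1 e) <= X ^ rank e.
    move=> lt_i; apply: IHe => // [|r]; first exact: te.
    rewrite ltnS leq_eqVlt /update /=; case: eqP => //= [_|_]; last exact: vb.
    move=> _; apply: leq_trans (bitlen_le_self _) _; exact: leq_trans nX.
  apply: leq_trans (bitlen_sum (F := fun i => eval m (update v x i) x.+1 e) Fb) _.
  apply: leq_trans (_ : X * (X ^ rank n * X ^ rank e) <= _).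
    apply: leq_trans (leq_add_mul3 (expn_rank_ge n) (expn_rank_ge e)).
    rewrite addnS ltnS leq_add2r; exact: leq_trans (expn_rank_ge n).
  by rewrite -expnD -expnS leq_pexp2l //; lia.
Qed.

Lemma tame_ext K m m' v v' x e : wf K x e -> (forall a, m a = m' a) ->
  (forall r, r < x -> v r = v' r) -> tame X m v x e -> tame X m' v' x e.
Proof.
move=> + Em; elim: e x v v' => [c|r|o a IHa b IHb|a IHa|a IHa b IHb|n IHn e IHe] x v v' //=.
- by case/andP=> wa wb Ev [ta tb]; split; [exact: (IHa _ v)|exact: (IHb _ v)].
- by move=> wa Ev ta; exact: (IHa _ v).
- case/andP=> wa wb Ev [ta tb le_bX].
  by split; [exact: (IHa _ v)|exact: (IHb _ v)|rewrite -(eval_ext wb Em Ev)].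
- case/and3P=> wn _ we Ev [tn le_nX te]; rewrite -(eval_ext wn Em Ev).
  split=> // [|i lt_i]; first exact: (IHn _ v).
  apply: IHe (te i lt_i) => // r; rewrite ltnS leq_eqVlt /update /=.
  by case: eqP => //= _; exact: Ev.
Qed.

Definition bounded (x : nat) (s : state) : Prop :=
  (forall a, bitlen (mem s a) <= X) /\ forall r, r < x -> bitlen (vars s r) <= X.

Definition keeps (K x d : nat) (s s' : state) : Prop :=
  [/\ mem s' = mem s, coins s' = coins s
    & forall r, (r < x) || (K <= r < d) -> vars s' r = vars s r].

Lemma sum_time n q : n <= X -> X <= q ->
  n.+1 * (q + (n + q.+1 + q) + 6 * X + 1) <= X * X * X * q.
Proof.
move=> nX Xq.
have le_T : q + (n + q.+1 + q) + 6 * X + 1 <= 2 * X * q.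
  by rewrite (leq_trans (_ : _ <= 11 * q)) ?leq_mul2r; lia.
apply: leq_trans (leq_mul (_ : _ <= 2 * X) le_T) _; first lia.
rewrite mulnA leq_mul2r; apply/orP; right.
rewrite (_ : 2 * X * (2 * X) = 4 * (X * X)); last by ring.
by rewrite -[X * X * X]mulnA leq_mul2r; lia.
Qed.

Lemma loop_time p q : X <= p -> X <= q ->
  p + 2 + X * X * X * q <= X * (X * (X * (X * (p * q)))).
Proof.
move=> Xp Xq; have -> : X * (X * (X * (X * (p * q)))) = X * (X * X * X * (p * q)) by ring.
have le_pw : p <= p * q by rewrite leq_pmulr; lia.
have le_qw : q <= p * q by rewrite leq_pmull; lia.
have : 8 <= X * X * X by rewrite (leq_trans X8) // leq_pmull ?muln_gt0; lia.
move: (X * X * X) (p * q) le_pw le_qw => c w le_pw le_qw c8.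
have ? : c * q <= c * w by rewrite leq_mul2l le_qw orbT.
have ? : 8 * w <= c * w by rewrite leq_mul2r c8 orbT.
have ? : 8 * (c * w) <= X * (c * w) by rewrite leq_mul2r X8 orbT.
lia.
Qed.

Lemma ask_time p q t1 t2 a b c S : X <= p -> X <= q -> t1 <= p -> t2 <= q ->
  a <= p -> b <= q -> c <= X -> S <= X * (p + q + X) ->
  t1 + (t2 + (a + b + c + S)) <= X * (X * (X * (p * q))).
Proof.
move=> Xp Xq; have := leq_add_mul3 Xp Xq; move: (X * (p * q)) => u pq.
have ? : X * (p + q + X) <= X * (2 * u) by rewrite leq_mul2l; lia.
have ? : 8 * u <= X * u by rewrite leq_mul2r; lia.
have ? : 8 * (X * u) <= X * (X * u) by rewrite leq_mul2r; lia.
have ? : X * (2 * u) = 2 * (X * u) by rewrite mulnCA.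
lia.
Qed.

(** Induction on the expression. Later subterms get higher targets, so [keeps] protects both the
    variables and the results already computed, and the induction hypothesis applies again after
    each subterm. *)
Lemma compile_exec K x d e s : wf K x e -> x <= K <= d ->
  tame X (mem s) (vars s) x e -> bounded x s ->
  exists t s', [/\ exec O (compile x d e) s t s', t <= X ^ rank e,
    keeps K x d s s' & vars s' d = eval (mem s) (vars s) x e].
Proof.
elim: e x d s => [c|r|o a IHa b IHb|a IHa|a IHa b IHb|n IHn e IHe] x d s /=.
- move=> _ /andP[xK Kd] tc _; exists (bitlen c), (set_var s d c).
  split; rewrite ?expn1 //=; [exact: EConst| |by rewrite eqxx].
  by split=> // r /=; case: eqP => // ->; lia.
- move=> lt_rx /andP[xK Kd] _ [_ vb].
  set s1 := set_var s d 0; set s2 := set_var s1 d (vars s1 d + vars s1 r).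
  have rd : (r == d) = false by apply/negbTE; lia.
  exists (bitlen 0 + (bitlen (vars s1 d) + bitlen (vars s1 r))), s2; split.
  + by apply: ESeq; [exact: EConst|exact: EArith].
  + rewrite /s1 /= eqxx rd !expnS expn0 muln1.
    have -> : bitlen 0 = 1 by []. have := vb _ lt_rx => vr.
    by rewrite (leq_trans (_ : _ <= X + X)) ?addnn -?mul2n ?leq_mul2r; lia.
  + by split=> // r' /=; case: eqP => // ->; lia.
  + by rewrite /= !eqxx rd.
- case/andP=> wa wb /andP[xK Kd] [ta tb] bs.
  have [ta' [s1 [e1 t1b [m1 c1 k1] v1]]] := IHa x d s wa (ltac:(lia)) ta bs.
  have Ev : forall r, r < x -> vars s r = vars s1 r by move=> r rx; rewrite k1 ?rx.
  have Em : forall r, mem s r = mem s1 r by rewrite m1.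
  have bs1 : bounded x s1.
    by case: bs => bm bv; split=> [u|r rx]; rewrite -?Em -?Ev // ?bm ?bv.
  have [tb' [s2 [e2 t2b [m2 c2 k2] v2]]] := IHb x d.+1 s1 wb (ltac:(lia))
    (tame_ext wb Em Ev tb) bs1.
  have v2d : vars s2 d = eval (mem s) (vars s) x a by rewrite k2 ?v1 //; lia.
  have v2d1 : vars s2 d.+1 = eval (mem s) (vars s) x b.
    by rewrite v2 -(eval_ext wb Em Ev).
  exists (ta' + (tb' + (bitlen (vars s2 d) + bitlen (vars s2 d.+1)))).
  exists (set_var s2 d (arith_fun o (vars s2 d) (vars s2 d.+1))); split.
  + by apply: ESeq e1 _; apply: ESeq e2 _; exact: EArith.
  + have ba : bitlen (vars s2 d) <= X ^ rank a.
      by rewrite v2d (bitlen_eval wa ta) //; case: bs.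
    have bb : bitlen (vars s2 d.+1) <= X ^ rank b.
      by rewrite v2d1 (bitlen_eval wb tb) //; case: bs.
    have := leq_add_mul3 (expn_rank_ge a) (expn_rank_ge b).
    have : 2 * (X ^ rank a + X ^ rank b) <= X * (X ^ rank a * X ^ rank b).
      rewrite leq_mul //; first lia.
      have := expn_rank_ge a; have := expn_rank_ge b; nia.
    rewrite expnS expnD; lia.
  + split=> [||r hr] /=; rewrite ?m2 ?c2 //.
    have -> : (r == d) = false by apply/negbTE; lia.
    by rewrite k2 ?k1 //; lia.
  + by rewrite /= eqxx v2d v2d1.
- move=> wa /andP[xK Kd] ta bs.
  have [ta' [s1 [e1 t1b [m1 c1 k1] v1]]] := IHa x d s wa (ltac:(lia)) ta bs.
  exists (ta' + (bitlen (vars s1 d) + bitlen (mem s1 (vars s1 d)))).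
  exists (set_var s1 d (mem s1 (vars s1 d))); split.
  + by apply: ESeq e1 _; exact: EFetch.
  + have ba : bitlen (vars s1 d) <= X ^ rank a.
      by rewrite v1 (bitlen_eval wa ta) //; case: bs.
    have bb : bitlen (mem s1 (vars s1 d)) <= X by rewrite m1; case: bs.
    have := expn_rank_ge a; rewrite expnS.
    have : 3 * X ^ rank a <= X * X ^ rank a by rewrite leq_mul2r; lia.
    lia.
  + split=> [||r hr] //=.
    have -> : (r == d) = false by apply/negbTE; lia.
    by rewrite k1 //; lia.
  + by rewrite /= eqxx v1 m1.
- case/andP=> wa wb /andP[xK Kd] [ta tb bX] bs.
  have [ta' [s1 [e1 t1b [m1 c1 k1] v1]]] := IHa x d s wa (ltac:(lia)) ta bs.
  have Ev : forall r, r < x -> vars s r = vars s1 r by move=> r rx; rewrite k1 ?rx.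
  have Em : forall r, mem s r = mem s1 r by rewrite m1.
  have bs1 : bounded x s1.
    by case: bs => bm bv; split=> [u|r rx]; rewrite -?Em -?Ev // ?bm ?bv.
  have [tb' [s2 [e2 t2b [m2 c2 k2] v2]]] := IHb x d.+1 s1 wb (ltac:(lia))
    (tame_ext wb Em Ev tb) bs1.
  have v2d : vars s2 d = eval (mem s) (vars s) x a by rewrite k2 ?v1 //; lia.
  have v2d1 : vars s2 d.+1 = eval (mem s) (vars s) x b.
    by rewrite v2 -(eval_ext wb Em Ev).
  set idx := iota (vars s2 d) (vars s2 d.+1).
  set ans := O [seq mem s2 i | i <- idx].
  exists (ta' + (tb' + (bitlen (vars s2 d) + bitlen (vars s2 d.+1) + bitlen ans
    + \sum_(i <- idx) (bitlen i + bitlen (mem s2 i))))).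
  exists (set_var s2 d ans); split.
  + by apply: ESeq e1 _; apply: ESeq e2 _; exact: EQuery.
  + have ba : bitlen (vars s2 d) <= X ^ rank a.
      by rewrite v2d (bitlen_eval wa ta) //; case: bs.
    have bb : bitlen (vars s2 d.+1) <= X ^ rank b.
      by rewrite v2d1 (bitlen_eval wb tb) //; case: bs.
    have bans : bitlen ans <= X by exact: O_bound.
    have : \sum_(i <- idx) (bitlen i + bitlen (mem s2 i)) <=
        X * (X ^ rank a + X ^ rank b + X).
      apply: leq_trans (_ : \sum_(i <- idx) (X ^ rank a + X ^ rank b + X) <= _).
        rewrite big_seq_cond [in X in _ <= X]big_seq_cond.
        apply: leq_sum => i; rewrite andbT mem_iota => /andP[_ lt_i].
        rewrite leq_add //; last by rewrite m2 -Em; case: bs.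
        apply: leq_trans (bitlen_mono (ltnW lt_i)) _.
        by apply: leq_trans (bitlenD _ _) _; exact: leq_add.
      rewrite big_const_seq count_predT size_iota iter_addn_0 mulnC leq_mul2r.
      by rewrite v2d1 bX orbT.
    rewrite !expnS expnD.
    by move=> ?; apply: ask_time => //; exact: expn_rank_ge.
  + split=> [||r hr] /=; rewrite ?m2 ?c2 //.
    have -> : (r == d) = false by apply/negbTE; lia.
    by rewrite k2 ?k1 //; lia.
  + by rewrite /= eqxx /ans /idx v2d v2d1 m2 m1.
case/and3P=> wn xK we /andP[_ Kd] [tn nX te] bs.
have [tn' [s1 [e1 t1b [m1 c1 k1] v1]]] := IHn x d.+1 s wn (ltac:(lia)) tn bs.
set N := eval (mem s) (vars s) x n in nX te v1 *.
set s2 := set_var s1 d 0; set s3 := set_var s2 x 0.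
pose F i := eval (mem s) (update (vars s) x i) x.+1 e.
have Fb i : i < N -> bitlen (F i) <= X ^ rank e.
  move=> lt_i; apply: (bitlen_eval we (te i lt_i)); first by case: bs.
  move=> r; rewrite ltnS leq_eqVlt /update /=; case: eqP => //= [_|_]; last by case: bs => _; apply.
  move=> _; apply: leq_trans (bitlen_le_self _) _; exact: leq_trans nX.
(* Register [d] accumulates the partial sum, [d.+1] holds the number of terms, [d.+2] the loop test
   and [d.+3] the current term. *)
pose Inv i s' := [/\ mem s' = mem s, coins s' = coins s,
  forall r, (r < x) || (K <= r < d) -> vars s' r = vars s r
  & vars s' d = \sum_(k < i) F k].
have [] := @loop_exec x d.+1 d.+2 (Seq (compile x.+1 d.+3 e) (Arith Add d d d.+3))
   Inv N (X ^ rank e + (N + (X ^ rank e).+1 + X ^ rank e)) X s3.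
- lia.
- lia.
- lia.
- by apply: bitlen_leq => //; lia.
- move=> i s' y u; case/orP=> /eqP -> [? ? hk hd]; split=> //=.
  + by move=> r hr; case: eqP => [|_]; [lia|exact: hk].
  + by case: eqP => [|_ //]; lia.
  + by move=> r hr; case: eqP => [|_]; [lia|exact: hk].
  + by case: eqP => [|_ //]; lia.
- move=> i s' lt_i [hm hc hk hd] hx hb.
  have Ev : forall r, r < x.+1 -> update (vars s) x i r = vars s' r.
    move=> r; rewrite ltnS leq_eqVlt /update /=; case: eqP => //= [->|_ rx].
      by rewrite hx.
    by rewrite hk ?rx.
  have Em : forall a, mem s a = mem s' a by rewrite hm.
  have [||t4 [s4 [e4 t4b [m4 c4 k4] v4]]] := IHe x.+1 d.+3 s' we (ltac:(lia)).
  + exact: tame_ext we Em Ev (te i lt_i).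
  + case: bs => bm bv; split=> [a|r]; first by rewrite hm.
    rewrite ltnS leq_eqVlt; case: eqP => //= [-> _|_ rx]; last by rewrite hk ?rx ?bv.
    rewrite hx; apply: bitlen_leq; lia.
  rewrite -(eval_ext we Em Ev) -/(F i) in v4.
  exists (t4 + (bitlen (vars s4 d) + bitlen (vars s4 d.+3))).
  exists (set_var s4 d (vars s4 d + vars s4 d.+3)).
  have v4d : vars s4 d = \sum_(k < i) F k by rewrite k4 ?hd //; lia.
  split=> /=.
  + by apply: ESeq e4 _; exact: EArith.
  + rewrite leq_add // leq_add ?v4 ?Fb // v4d.
    apply: leq_trans (bitlen_sum (b := X ^ rank e) _) _.
      by move=> k lt_k; apply: Fb; exact: ltn_trans lt_i.
    by rewrite leq_add2r ltnW.
  + by case: eqP => [|_]; [lia|rewrite k4 ?hx //; lia].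
  + by case: eqP => [|_]; [lia|rewrite k4 ?hb //; lia].
  + split=> /=; rewrite ?m4 ?c4 //.
      by move=> r hr; case: eqP => [|_]; [lia|rewrite k4 ?hk //; lia].
    by rewrite eqxx v4 v4d big_ord_recr.
- split=> //=.
  + by move=> r hr; case: eqP => [|_]; [lia|case: eqP => [|_]; [lia|apply: k1; lia]].
  + by case: eqP => [|_]; [lia|rewrite eqxx big_ord0].
- by rewrite /= eqxx.
- by rewrite /=; case: eqP => [|_]; [lia|case: eqP => [|_ //]; lia].
move=> t5 [s5 [e5 t5b _ _ [m5 c5 k5 v5]]].
exists (tn' + (bitlen 0 + (bitlen 0 + t5))), s5; split=> //.
- apply: ESeq e1 _; apply: ESeq; first exact: EConst.
  by apply: ESeq e5; exact: EConst.
- have := sum_time nX (expn_rank_ge e); move: t5b t1b.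
  have -> : bitlen 0 = 1 by [].
  rewrite !expnS expnD; have := loop_time (expn_rank_ge n) (expn_rank_ge e).
  lia.
Qed.

End Cost.
End Language.

(** * Programs filling arrays *)

(* [SLet] assigns the next free register; [SFill p n e] and [SCoin p n] write    *)
(* the [n] cells from the address in register [p], and in [e] the next free      *)
(* register is the index of the cell.                                            *)
Inductive stm :=
| SLet of expr
| SFill of nat & expr & expr
| SCoin of nat & expr.

(** [K] holds the length of the array, [K.+1] the loop test, [K.+2] the address of the cell and
    [K.+3] its value, which [e] has to leave there. *)
Definition fill_body K p x e : cmd :=
  Seq (compile x.+1 K.+2 (EOp Add (EVar p) (EVar x)))
    (Seq e (Put K.+2 K.+3)).

Definition fill_cmd K p x n e : cmd :=
  Seq (compile x K n) (Seq (Const x 0) (for_loop x K K.+1 (fill_body K p x e))).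

Definition compile_stm K x st : cmd :=
  match st with
  | SLet e => Seq (compile x K e) (Seq (Const x 0) (Arith Add x x K))
  | SFill p n e => fill_cmd K p x n (compile x.+1 K.+3 e)
  | SCoin p n => fill_cmd K p x n (Flip K.+3)
  end.

Fixpoint compile_prog K x l : cmd :=
  match l with
  | [::] => Skip
  | st :: l => Seq (compile_stm K x st)
      (compile_prog K (if st is SLet _ then x.+1 else x) l)
  end.

Definition rank_stm st : nat :=
  match st with
  | SLet e => (rank e).+2
  | SFill _ n e => rank n + rank e + 10
  | SCoin _ n => rank n + 10
  end.

Definition rank_prog l : nat := \sum_(st <- l) (rank_stm st).+1.

(** * Correctness and running time of array programs *)

Section Semantics.

Variables (O : seq nat -> nat) (X K B : nat) (M : nat -> nat).
Hypothesis X8 : 8 <= X.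
Hypothesis O_bound : forall l, bitlen (O l) <= X.
Hypothesis B_gt0 : 0 < B.

Definition agree top (m : nat -> nat) : Prop := forall a, a < top -> m a = M a.

Definition good (ps : seq nat) top (s : state) : Prop :=
  [/\ bounded X (size ps) s, forall r, r < size ps -> vars s r = nth 0 ps r
    & agree top (mem s)].

(* [ps] and [cs] are the registers and the coins used.  As every cell is written *)
(* at most once, in increasing order, the memory agrees at any time with the     *)
(* final one, [M], below some address [top].                                     *)
Inductive valid : seq stm -> seq nat -> nat -> seq bool -> seq nat -> nat -> Prop :=
| VNil ps top : valid [::] ps top [::] ps top
| VLet e l ps top cs ps' top' v :
    wf K (size ps) e -> size ps < K -> bitlen v <= X ->
    (forall m, agree top m -> tame O X m (nth 0 ps) (size ps) e) ->
    (forall m, agree top m -> eval O m (nth 0 ps) (size ps) e = v) ->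
    valid l (rcons ps v) top cs ps' top' ->
    valid (SLet e :: l) ps top cs ps' top'
| VFill p n e l ps top N cs ps' top' :
    wf K (size ps) n -> wf K (size ps).+1 e -> size ps < K -> p < size ps ->
    nth 0 ps p = top -> N < B -> bitlen N <= X ->
    (forall m, agree top m -> tame O X m (nth 0 ps) (size ps) n) ->
    (forall m, agree top m -> eval O m (nth 0 ps) (size ps) n = N) ->
    (forall t m, t < N -> agree (top + t) m ->
       tame O X m (update (nth 0 ps) (size ps) t) (size ps).+1 e) ->
    (forall t m, t < N -> agree (top + t) m ->
       eval O m (update (nth 0 ps) (size ps) t) (size ps).+1 e = M (top + t)) ->
    (forall t, t < N -> bitlen (M (top + t)) <= X) ->
    valid l ps (top + N) cs ps' top' ->
    valid (SFill p n e :: l) ps top cs ps' top'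
| VCoin p n l ps top N cs cs' ps' top' :
    wf K (size ps) n -> size ps < K -> p < size ps ->
    nth 0 ps p = top -> N < B -> bitlen N <= X ->
    (forall m, agree top m -> tame O X m (nth 0 ps) (size ps) n) ->
    (forall m, agree top m -> eval O m (nth 0 ps) (size ps) n = N) ->
    size cs = N -> (forall t, t < N -> M (top + t) = nth false cs t) ->
    valid l ps (top + N) cs' ps' top' ->
    valid (SCoin p n :: l) ps top (cs ++ cs') ps' top'.

Lemma good_eval ps top s x e : wf K x e -> x <= size ps -> good ps top s ->
  eval O (mem s) (vars s) x e = eval O (mem s) (nth 0 ps) x e.
Proof.
move=> we xs [_ Ev _]; apply: eval_ext we _ _ => // r rx; apply: Ev.
exact: leq_trans xs.
Qed.

Lemma good_compile ps top s d e : wf K (size ps) e -> size ps <= K <= d ->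
  (forall m, agree top m -> tame O X m (nth 0 ps) (size ps) e) -> good ps top s ->
  exists t s', [/\ exec O (compile (size ps) d e) s t s', t <= X ^ rank e,
    keeps K (size ps) d s s' & vars s' d = eval O (mem s) (nth 0 ps) (size ps) e].
Proof.
move=> we Kd te gs; have [bs Ev Em] := gs.
have Ev' r : r < size ps -> nth 0 ps r = vars s r by move=> rx; rewrite Ev.
have [t [s' [e' t' k' v']]] := compile_exec X8 O_bound we Kd
  (tame_ext we (fun=> erefl) Ev' (te _ Em)) bs.
by exists t, s'; split=> //; rewrite v' (good_eval we _ gs).
Qed.

Lemma let_exec ps top s e v : wf K (size ps) e -> size ps < K -> bitlen v <= X ->
  (forall m, agree top m -> tame O X m (nth 0 ps) (size ps) e) ->
  (forall m, agree top m -> eval O m (nth 0 ps) (size ps) e = v) -> good ps top s ->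
  exists t s', [/\ exec O (compile_stm K (size ps) (SLet e)) s t s',
    t <= X ^ (rank e).+2, good (rcons ps v) top s' & coins s' = coins s].
Proof.
move=> we xK vX te ev gs.
have xKK : size ps <= K <= K by rewrite ltnW /=.
have [t1 [s1 [e1 t1b [m1 c1 k1] v1]]] := good_compile we xKK te gs.
have [[bm bv] Ev Em] := gs.
set x := size ps in we xK te ev e1 k1 v1 bv Ev *.
set s2 := set_var s1 x 0; set s3 := set_var s2 x (vars s2 x + vars s2 K).
have Kx : (K == x) = false by apply/negbTE; lia.
have v3 : vars s3 x = v by rewrite /= !eqxx Kx add0n v1 ev.
exists (t1 + (bitlen 0 + (bitlen (vars s2 x) + bitlen (vars s2 K)))), s3; split=> //.
- by apply: ESeq e1 _; apply: ESeq; [exact: EConst|exact: EArith].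
- rewrite /= eqxx Kx v1 ev // !expnS.
  have -> : bitlen 0 = 1 by [].
  have := expn_rank_ge X8 e; set p := X ^ _ => Xp.
  have ? : 8 * p <= X * p by rewrite leq_mul2r X8 orbT.
  have ? : 8 * (X * p) <= X * (X * p) by rewrite leq_mul2r X8 orbT.
  lia.
- split; last by move=> a ?; rewrite /= m1 Em.
    split=> [a|r]; first by rewrite /= m1.
    rewrite size_rcons ltnS leq_eqVlt; case/predU1P => [->|rx]; first by rewrite -/x v3.
    have rnx : (r == x) = false by apply/negbTE; rewrite neq_ltn rx.
    by rewrite /= rnx k1 ?rx // bv.
  move=> r; rewrite size_rcons ltnS leq_eqVlt nth_rcons.
  case/predU1P => [->|rx]; first by rewrite ltnn eqxx -/x v3.
  have rnx : (r == x) = false by apply/negbTE; rewrite neq_ltn rx.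
  by rewrite /= rnx rx k1 ?rx // Ev.
Qed.

Lemma fill_time N p q t1 t3 : X <= p -> 0 < q -> t1 <= p ->
  t3 <= N.+1 * (X ^ 5 + q + X ^ 5 + X + 6 * X + 1) ->
  t1 + (1 + t3) <= N.+1 * (p * q * X ^ 9).
Proof.
move=> Xp q0 t1p t3b.
have XY : X <= X ^ 5 by rewrite -{1}(expn1 X) leq_pexp2l //; lia.
rewrite (_ : X ^ 9 = X ^ 4 * X ^ 5); last by rewrite -expnD.
have X4 : 12 <= X ^ 4 by rewrite (leq_trans (_ : 12 <= 8 ^ 4)) // leq_exp2r.
move: (X ^ 5) (X ^ 4) XY X4 t3b => Y Z XY Z12 t3b.
have le_pw : p <= p * q by rewrite leq_pmulr.
have le_qw : q <= p * q by rewrite leq_pmull; lia.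
have : p * q <= p * q * Y by rewrite leq_pmulr; lia.
have : Y <= p * q * Y by rewrite leq_pmull ?muln_gt0; lia.
rewrite (_ : p * q * (Z * Y) = p * q * Y * Z); last by ring.
move: (p * q) (p * q * Y) le_pw le_qw => w u ? ? ? ?.
have ? : u * 12 <= u * Z by rewrite leq_mul2l Z12 orbT.
have : N.+1 * (p + 1 + (Y + q + Y + X + 6 * X + 1)) <= N.+1 * (u * Z).
  by rewrite leq_mul2l; lia.
rewrite mulnDr; move: (N.+1 * _) t3b (N.+1 * (u * Z)) => ? ? ?.
have : p + 1 <= N.+1 * (p + 1) by rewrite leq_pmull.
lia.
Qed.

(** Common to computed and random arrays: [cs t] is the sequence of coins left after [t] cells,
    constant for an array given by an expression. The body sees the index of the cell as one more
    register, hence [rcons ps t]. *)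
Lemma fill_exec ps top s p n N e (Te : nat) (cs : nat -> seq bool) :
  wf K (size ps) n -> size ps < K -> p < size ps -> nth 0 ps p = top -> bitlen N <= X ->
  (forall m, agree top m -> tame O X m (nth 0 ps) (size ps) n) ->
  (forall m, agree top m -> eval O m (nth 0 ps) (size ps) n = N) ->
  (forall t, t < N -> bitlen (M (top + t)) <= X) ->
  (forall t s1, t < N -> good (rcons ps t) (top + t) s1 -> coins s1 = cs t ->
     exists t2 s2, [/\ exec O e s1 t2 s2, t2 <= X ^ Te,
        mem s2 = mem s1 /\ coins s2 = cs t.+1,
        forall r, (r <= size ps) || (K <= r < K.+3) -> vars s2 r = vars s1 r
        & vars s2 K.+3 = M (top + t)]) ->
  good ps top s -> coins s = cs 0 ->
  exists t s', [/\ exec O (fill_cmd K p (size ps) n e) s t s',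
    t <= N.+1 * X ^ (rank n + Te + 9), good ps (top + N) s' & coins s' = cs N].
Proof.
move=> wn xK px ptop NX tn en Mb body gs cs0.
have xKK : size ps <= K <= K by rewrite ltnW /=.
have [t1 [s1 [e1 t1b [m1 c1 k1] v1]]] := good_compile wn xKK tn gs.
have [[bm bv] Ev Em] := gs.
set x := size ps in wn xK px tn en body e1 k1 v1 bv Ev *.
have {}v1 : vars s1 K = N by rewrite v1 en.
set s2 := set_var s1 x 0.
pose Inv i s' := [/\ forall a, bitlen (mem s' a) <= X,
  forall r, r < x -> vars s' r = nth 0 ps r, agree (top + i) (mem s')
  & coins s' = cs i].
have Xp j : X <= X ^ j.+1 by rewrite -{1}(expn1 X) leq_pexp2l //; lia.
have [] := @loop_exec O x K K.+1 (fill_body K p x e) Inv N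
  (X ^ 5 + X ^ Te + X ^ 5 + X) X s2; try lia.
- move=> i s' y a hy [h1 h2 h3 h4]; split=> //= r rx.
  by case: eqP => [ry|_]; [lia|exact: h2].
- move=> i s3 lt_iN [h1 h2 h3 h4] hx hN.
  have g3 : good (rcons ps i) (top + i) s3.
    split=> //.
      split=> // r; rewrite size_rcons ltnS leq_eqVlt => /orP[/eqP ->|rx].
        by rewrite -/x hx (leq_trans _ NX) // bitlen_mono // ltnW.
      by rewrite h2 // -Ev // bv.
    move=> r; rewrite size_rcons ltnS leq_eqVlt nth_rcons -/x => /orP[/eqP ->|rx].
      by rewrite ltnn eqxx.
    by rewrite rx h2.
  pose ea := EOp Add (EVar p) (EVar x).
  have wa : wf K x.+1 ea by rewrite /= ltnS (ltnW px) ltnS leqnn.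
  have [t4 [s4 [e4 t4b [m4 c4 k4] v4]]] : exists t s',
     [/\ exec O (compile x.+1 K.+2 ea) s3 t s', t <= X ^ rank ea, keeps K x.+1 K.+2 s3 s'
       & vars s' K.+2 = eval O (mem s3) (vars s3) x.+1 ea].
    apply: compile_exec => //; first by lia.
    by case: g3; rewrite size_rcons.
  have va : vars s4 K.+2 = top + i by rewrite v4 /= hx h2 // ptop.
  have g4 : good (rcons ps i) (top + i) s4.
    case: g3 => -[b1 b2] b3 b4; split; last by rewrite m4.
      split=> [a|r rx]; first by rewrite m4.
      by rewrite k4 ?b2 // -[x.+1](size_rcons ps i) rx.
    by move=> r rx; rewrite k4 ?b3 // -[x.+1](size_rcons ps i) rx.
  have [t5 [s5 [e5 t5b [m5 c5] k5 v5]]] := body i s4 lt_iN g4 (etrans c4 h4).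
  have v52 : vars s5 K.+2 = top + i by rewrite k5 ?va //; lia.
  set s6 := set_mem s5 (vars s5 K.+2) (vars s5 K.+3).
  exists (t4 + (t5 + (bitlen (vars s5 K.+2) + bitlen (vars s5 K.+3)))), s6.
  split.
  + by apply: ESeq e4 _; apply: ESeq e5 _; exact: EPut.
  + have : bitlen (vars s5 K.+2) <= X ^ 5.
      rewrite v52 -va v4; apply: (bitlen_eval X8 O_bound wa) => // r.
      by case: g3; rewrite size_rcons => -[_ h] _ _; exact: h.
    have : bitlen (vars s5 K.+3) <= X by rewrite v5 Mb.
    rewrite /= in t4b; lia.
  + by rewrite /= k5 ?leqnn // k4 ?ltnS ?leqnn.
  + rewrite /= k5 ?k4 ?hN //; lia.
  + split=> /=.
    * by move=> a; case: eqP => _; rewrite ?v5 ?Mb // m5 m4.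
    * by move=> r rx; rewrite k5 ?k4 ?h2 //; lia.
    * move=> a; rewrite v52 addnS ltnS leq_eqVlt.
      case/predU1P => [->|lt_a] /=; first by rewrite eqxx v5.
      by rewrite (ltn_eqF lt_a) m5 m4 h3.
    * by rewrite c5.
- split=> /=; rewrite ?m1 ?c1 ?addn0 //.
  by move=> r rx; case: eqP => [|_]; [lia|rewrite k1 ?rx ?Ev].
- by rewrite /= eqxx.
- by rewrite /=; case: eqP => [|_ //]; lia.
move=> t3 [s3 [e3 t3b _ _ [h1 h2 h3 h4]]].
exists (t1 + (bitlen 0 + t3)), s3; split=> //.
- by apply: ESeq e1 _; apply: ESeq e3; exact: EConst.
- have -> : bitlen 0 = 1 by [].
  rewrite !expnD; apply: fill_time t1b _ => //; first exact: expn_rank_ge.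
  by rewrite expn_gt0; lia.
by split=> //; split=> // r rx; rewrite h2 // -Ev // bv.
Qed.

(** Adding a statement raises the power of [X] but keeps the bound linear in [B]. With [B] equal to
    2^l times a polynomial, this keeps the base of the exponential at 2. *)
Lemma prog_time g h t1 t2 : t1 <= B * X ^ g -> t2 <= B * X ^ h.+1 ->
  t1 + t2 <= B * X ^ (g.+1 + h).+1.
Proof.
move=> le1 le2; apply: leq_trans (leq_add le1 le2) _; rewrite -mulnDr leq_mul2l.
have ? : X ^ g <= X ^ (g + h).+1 by rewrite leq_pexp2l; lia.
have ? : X ^ h.+1 <= X ^ (g + h).+1 by rewrite leq_pexp2l; lia.
have ? : 8 * X ^ (g + h).+1 <= X * X ^ (g + h).+1 by rewrite leq_mul2r X8 orbT.
by rewrite addSn [X ^ (_.+2)]expnS; apply/orP; right; lia.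
Qed.

Lemma prog_exec l ps top cs ps' top' rest s : valid l ps top cs ps' top' ->
  good ps top s -> coins s = cs ++ rest ->
  exists t s', [/\ exec O (compile_prog K (size ps) l) s t s',
    t <= B * X ^ (rank_prog l).+1, good ps' top' s' & coins s' = rest].
Proof.
move=> vl; elim: vl rest s => {l ps top cs ps' top'}.
- move=> ps top rest s gs cs; exists 1, s; split=> //; first exact: ESkip.
  by rewrite muln_gt0 B_gt0 expn_gt0; lia.
- move=> e l ps top cs ps' top' v we xK vX te ev _ IH rest s gs cs0.
  have [t1 [s1 [e1 t1b g1 c1]]] := let_exec we xK vX te ev gs.
  have [t2 [s2 [e2 t2b g2 c2]]] := IH rest s1 g1 (etrans c1 cs0).
  exists (t1 + t2), s2; split=> //.
    by apply: ESeq e1 _; move: e2; rewrite size_rcons.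
  rewrite /rank_prog big_cons; apply: prog_time t2b.
  by rewrite (leq_trans t1b) // leq_pmull.
- move=> p n e l ps top N cs ps' top' wn we xK px ptop NB NX tn en te ev Mb _ IH rest s gs cs0.
  have [|t1 [s1 [e1 t1b g1 c1]]] := @fill_exec ps top s p n N (compile (size ps).+1 K.+3 e) (rank e)
    (fun=> cs ++ rest) wn xK px ptop NX tn en Mb _ gs cs0; last first.
  + have [t2 [s2 [e2 t2b g2 c2]]] := IH rest s1 g1 c1.
    exists (t1 + t2), s2; split=> //; first exact: ESeq e1 e2.
    rewrite /rank_prog big_cons; apply: prog_time t2b.
    by apply: leq_trans t1b _; rewrite leq_mul // leq_pexp2l //=; lia.
  + move=> t s1 lt_t [bs1 ev1 em1] c1.
    have Ev r : r < (size ps).+1 -> update (nth 0 ps) (size ps) t r = vars s1 r.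
      move=> rx; rewrite ev1 ?size_rcons // nth_rcons /update /=.
      move: rx; rewrite ltnS leq_eqVlt => /predU1P[->|rx]; first by rewrite eqxx ltnn.
      by rewrite rx ltn_eqF.
    rewrite size_rcons in bs1.
    have [|t2 [s2 [e2 t2b [m2 c2 k2] v2]]] := @compile_exec O X X8 O_bound K (size ps).+1 K.+3 e s1 we _
      (tame_ext we (fun=> erefl) Ev (te t _ lt_t em1)) bs1; first lia.
    exists t2, s2; split=> //; first by rewrite m2 c2.
    by rewrite v2 -(ev t _ lt_t em1); symmetry; exact: eval_ext we _ Ev.
- move=> p n l ps top N cs cs' ps' top' wn xK px ptop NB NX tn en szcs Mc _ IH rest s gs cs0.
  have Mb t : t < N -> bitlen (M (top + t)) <= X.
    by move=> /Mc ->; apply: leq_trans (_ : 1 <= X); [case: nth|lia].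
  have flip_exec t s1 : t < N -> good (rcons ps t) (top + t) s1 ->
      coins s1 = drop t (cs ++ cs' ++ rest) ->
      exists t2 s2, [/\ exec O (Flip K.+3) s1 t2 s2, t2 <= X ^ 0,
        mem s2 = mem s1 /\ coins s2 = drop t.+1 (cs ++ cs' ++ rest),
        forall r, (r <= size ps) || (K <= r < K.+3) -> vars s2 r = vars s1 r
        & vars s2 K.+3 = M (top + t)].
    move=> lt_t _ c1.
    have c1E : coins s1 = nth false cs t :: drop t.+1 (cs ++ cs' ++ rest).
      by rewrite c1 (drop_nth false) ?nth_cat ?szcs ?lt_t // !size_cat; lia.
    exists 1, (set_var (State (vars s1) (mem s1) (drop t.+1 (cs ++ cs' ++ rest))) K.+3
      (nth false cs t)); split=> //=; first exact: EFlip.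
      by move=> r hr; case: eqP => // rK; lia.
    by rewrite eqxx Mc.
  have c0 : coins s = drop 0 (cs ++ cs' ++ rest) by rewrite drop0 cs0 catA.
  have [t1 [s1 [e1 t1b g1 c1]]] := @fill_exec ps top s p n N (Flip K.+3) 0
    (fun t => drop t (cs ++ cs' ++ rest)) wn xK px ptop NX tn en Mb flip_exec gs c0.
  move: c1; rewrite drop_size_cat // => c1.
  have [t2 [s2 [e2 t2b g2 c2]]] := IH rest s1 g1 c1.
  exists (t1 + t2), s2; split=> //; first exact: ESeq e1 e2.
  rewrite /rank_prog big_cons; apply: prog_time t2b.
  by apply: leq_trans t1b _; rewrite leq_mul // leq_pexp2l //=; lia.
Qed.

End Semantics.

(** * A sieve for determinants in characteristic 2 *)

Definition bit L l : nat := (L %/ 2 ^ l) %% 2.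

Lemma bit_inj l L L' : L < 2 ^ l -> L' < 2 ^ l ->
  (forall i, i < l -> bit L i = bit L' i) -> L = L'.
Proof.
elim: l L L' => [|l IHl] L L' lt_L lt_L' eqb; first by case: L L' lt_L lt_L' {eqb} => [|?] [].
rewrite (divn_eq L 2) (divn_eq L' 2); congr (_ * 2 + _).
  apply: IHl => [||i lt_i]; rewrite ?ltn_divLR -?expnSr //.
  by have := eqb i.+1 lt_i; rewrite /bit expnS !divnMA.
by have := eqb 0 isT; rewrite /bit expn0 !divn1.
Qed.

Section Char2.

Variable R : comNzRingType.
Hypothesis R2 : (1 + 1 = 0 :> R)%R.
Local Open Scope ring_scope.

Lemma char2_oppr (x : R) : - x = x.
Proof. by apply/eqP; rewrite eq_sym -addr_eq0 -{1}(mul1r x) -{2}(mul1r x) -mulrDl R2 mul0r. Qed.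

Lemma sum_bits l (F : {ffun 'I_l -> bool} -> R) :
  \sum_(L < 2 ^ l) F [ffun i : 'I_l => bit L i == 1%N] = \sum_f F f.
Proof.
pose h (L : 'I_(2 ^ l)) := [ffun i : 'I_l => bit L i == 1%N].
have h_inj : injective h.
  move=> L L' /ffunP eqh; apply/val_inj/(bit_inj (ltn_ord L) (ltn_ord L')) => i lt_i.
  have := eqh (Ordinal lt_i); rewrite !ffunE /= /bit !modn2.
  by do 2!case: odd.
have /= h_bij := inj_card_bij h_inj.
rewrite [RHS](reindex h) //; apply: onW_bij; apply: h_bij.
by rewrite card_ffun card_bool !card_ord.
Qed.

(** Expanding the product over the rows, a map [g] from rows to columns occurs once for every set of
    columns containing its image. This number is a power of 2, odd exactly when [g] is a bijection,
    and the signs of the Leibniz formula disappear since -1 = 1. *)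
Lemma sum_masks_det l (Y : 'M[R]_l) :
  \sum_(L < 2 ^ l) \prod_(i < l) \sum_(k < l) (bit L k)%:R * Y i k = \det Y.
Proof.
transitivity (\sum_(f : {ffun 'I_l -> bool}) \prod_(i < l) \sum_(k < l) (f k)%:R * Y i k).
  rewrite -sum_bits; apply: eq_bigr => L _; apply: eq_bigr => i _.
  by apply: eq_bigr => k _; rewrite ffunE /bit modn2; case: odd.
under eq_bigr do rewrite bigA_distr_bigA /=.
rewrite exchange_big /=.
have parity (g : {ffun 'I_l -> 'I_l}) :
    \sum_(f : {ffun 'I_l -> bool}) \prod_i ((f (g i))%:R : R) = (injectiveb g)%:R.
  (* The sets containing the image are counted column by column: a column of the image must be
     taken, any other column has two choices, that is 0 in [R]. *)
  transitivity (\prod_k \sum_(b : bool) ((b || (k \notin codom g))%:R : R)).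
    rewrite bigA_distr_bigA; apply: eq_bigr => f _ /=.
    transitivity ([forall i, f (g i)]%:R : R).
      have [fg|] := boolP [forall i, f (g i)].
        by rewrite big1 // => i _; rewrite (forallP fg).
      by case/forallPn => i /negbTE fgi; rewrite (bigD1 i) //= fgi mul0r.
    have [fg|] := boolP [forall i, f (g i)].
      rewrite big1 // => k _; case: (boolP (k \in _)); rewrite ?orbT //.
      by case/codomP=> i ->; rewrite (forallP fg).
    by case/forallPn => i /negbTE fgi; rewrite (bigD1 (g i)) //= fgi codom_f mul0r.
  transitivity (\prod_k ((k \in codom g)%:R : R)).
    by apply: eq_bigr => k _; rewrite big_bool /=; case: (k \in _); rewrite ?addr0 ?R2.
  have [/injectiveP inj_g|] := boolP (injectiveb g).
    rewrite big1 // => k _; have [h _ hK] := injF_bij inj_g.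
    by rewrite -(hK k) codom_f.
  move=> ninj; have [k /negbTE nk] : exists k, k \notin codom g.
    apply/existsP; apply: contraR ninj; rewrite negb_exists => /forallP surj.
    have surj' k : k \in codom g by rewrite -[_ \in _]negbK.
    apply/injectiveP; apply: (can_inj (g := fun k => iinv (surj' k))).
    by apply: canF_sym => k; rewrite f_iinv.
  by rewrite (bigD1 k) //= nk mul0r.
transitivity (\sum_(g : {ffun 'I_l -> 'I_l} | injectiveb g) \prod_i Y i (g i)).
  rewrite [RHS]big_mkcond; apply: eq_bigr => g _ /=.
  under eq_bigr do rewrite big_split /=.
  by rewrite -mulr_suml parity; case: injectiveb; rewrite (mul1r, mul0r).
rewrite (reindex (fun s : 'S_l => pval s)) /=; last first.
  have inj_dflt : injectiveb [ffun i : 'I_l => i] by apply/injectiveP=> i j; rewrite !ffunE.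
  exists (insubd (Perm inj_dflt)) => [s _|g inj_g]; first exact: valKd.
  exact: insubdK.
apply: eq_big => [s|s _]; first by rewrite (valP s).
rewrite -[LHS]mul1r; congr (_ * _); last by apply: eq_bigr => i _; rewrite -pvalE.
by case: (odd_perm s); rewrite ?expr0 ?expr1 ?char2_oppr.
Qed.

End Char2.

(* An arc [(i, j, c)] stands for the district of the voters in positions [i], *)
(* ..., [j - 1] of the path, together with the copy [c < cc] of its winner    *)
(* [win i j] that it uses; only one copy of [p] is available.                  *)
(** * Weighted paths *)

Lemma iota_index n : iota 0 n = index_iota 0 n.
Proof. by rewrite /index_iota subn0. Qed.

Section Paths.

Variables (S cc p : nat) (win : nat -> nat -> nat).

Definition arc_index (u : nat * nat * nat) : nat := (u.1.1 * S + u.1.2) * S + u.2.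

Definition copy_index (u : nat * nat * nat) : nat := win u.1.1 u.1.2 * S + u.2.

(* The paths from 0 to [j] with [a] arcs, [r] of which are not won by [p]; the *)
(* last arc comes first.                                                       *)
Fixpoint paths (a r j : nat) : seq (seq (nat * nat * nat)) :=
  match a with
  | 0 => if (r == 0) && (j == 0) then [:: [::]] else [::]
  | a.+1 => flatten [seq
      if win i j == p then [seq (i, j, 0) :: w | w <- paths a r i]
      else if r is r.+1 then
        [seq (i, j, c) :: w | c <- iota 0 cc, w <- paths a r i]
      else [::] | i <- iota 0 j]
  end.

Definition rival (u : nat * nat * nat) : bool := win u.1.1 u.1.2 != p.

Definition copies (w : seq (nat * nat * nat)) : seq nat :=
  [seq copy_index u | u <- w & rival u].

Definition meets : rel (nat * nat * nat) := fun u v => u.1.1 == v.1.2.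

Lemma meets_path i j c w : path meets (i, j, c) w = path meets (i, 0, 0) w.
Proof. by case: w. Qed.

(** The sentinels close the path: [(j, 0, 0)] in front forces the first arc listed to end at [j],
    and [(0, 0, 0)] at the back forces the last one to start at 0. *)
Lemma pathsP a r j w : reflect
  [/\ path meets (j, 0, 0) (rcons w (0, 0, 0)),
      all (fun u => u.1.1 < u.1.2) w, size w = a, count rival w = r
    & all (fun u => if rival u then u.2 < cc else u.2 == 0) w]
  (w \in paths a r j).
Proof.
elim: a r j w => [|a IHa] r j w /=.
  case: ifP => [/andP[/eqP -> /eqP ->]|jr0]; rewrite ?inE.
    by apply: (iffP eqP) => [->|[_ _ /size0nil ->]].
  constructor; case=> + _ /size0nil Ew; rewrite Ew /= => /andP[/eqP /= j0 _] r0 _.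
  by rewrite -r0 j0 in jr0.
have mem_cons_map u (s : seq (seq (nat * nat * nat))) v w' :
    (v :: w' \in [seq u :: w | w <- s]) = (v == u) && (w' \in s).
  apply/mapP/andP => [[w1 w1s [-> ->]]|[/eqP -> w's]]; first by rewrite eqxx.
  by exists w'.
apply: (iffP flatten_mapP) => [[i]|].
  rewrite mem_iota add0n => /= lt_ij.
  case: ifP => wij.
    case/mapP => w' /IHa[pw lw sw cw kw] ->.
    by rewrite /= meets_path /meets /rival /= wij /= pw lt_ij lw sw cw kw eqxx.
  case: r => // r /allpairsP[[c w'] [/= c_lt /IHa[pw lw sw cw kw] ->]].
  rewrite mem_iota /= in c_lt.
  by rewrite /= meets_path /meets /rival /= wij /= pw lt_ij lw sw cw kw eqxx c_lt.
case: w => [|[[i j'] c] w] [] //=; rewrite meets_path => /andP[/eqP /= <- pw] /andP[lt_ij lw] [sw] cw.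
case/andP=> kc kw; exists i; first by rewrite mem_iota.
rewrite /rival /= in cw kc.
case: (win i j == p) cw kc => /= cw kc.
  by rewrite mem_cons_map (eqP kc) eqxx; apply/IHa.
case: r cw => // r [cw]; apply/allpairsP; exists (c, w); split=> //=.
  by rewrite mem_iota.
exact/IHa.
Qed.

Lemma uniq_flatten_map (T1 T2 : eqType) (F : T1 -> seq T2) (h : T2 -> T1) s :
  uniq s -> (forall x, uniq (F x)) -> (forall x y, y \in F x -> h y = x) ->
  uniq (flatten [seq F x | x <- s]).
Proof.
move=> + uF hF; elim: s => //= x s IHs /andP[xs us].
rewrite cat_uniq uF IHs // andbT; apply/hasPn => y /flatten_mapP[x' x's yx'].
by apply/negP => /hF; rewrite (hF _ _ yx') => Ex; rewrite Ex in x's; rewrite x's in xs.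
Qed.

Lemma paths_uniq a r j : uniq (paths a r j).
Proof.
elim: a r j => [|a IHa] r j /=; first by case: ifP.
apply: (@uniq_flatten_map _ _ _ (fun w => (head (0, 0, 0) w).1.1)); first exact: iota_uniq.
  move=> i; case: ifP => _; first by rewrite map_inj_uniq // => ? ? [].
  case: r => // r; apply: allpairs_uniq; rewrite ?iota_uniq //.
  by move=> [? ?] [? ?] _ _ /= [-> ->].
move=> i w; case: ifP => _; first by case/mapP => ? _ ->.
by case: r => // r /allpairsP[? [_ _ ->]].
Qed.

Lemma size_copies a r j w : w \in paths a r j -> size (copies w) = r.
Proof. by case/pathsP=> _ _ _ <- _; rewrite size_map size_filter. Qed.

Section Weights.

Variables (R : comNzSemiRingType) (l : nat) (xs : nat -> R) (ys : nat -> nat -> R).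
Local Open Scope ring_scope.

(** The factor of row [t] in the sieve, for the set of columns coded by the bits of [L]. *)
Definition mask_sum L t : R := \sum_(k < l) (bit L k)%:R * ys t k.

Definition arc_sum L i j : R :=
  \sum_(c < cc) xs (arc_index (i, j, val c)) * mask_sum L (copy_index (i, j, val c)).

Fixpoint path_sum L (a r j : nat) : R :=
  match a with
  | 0 => ((r == 0) && (j == 0))%:R
  | a.+1 => \sum_(i < j)
      if win i j == p then xs (arc_index (val i, j, 0%N)) * path_sum L a r i
      else if r is r.+1 then arc_sum L i j * path_sum L a r i
      else 0
  end.

Lemma path_sumE L a r j : path_sum L a r j =
  \sum_(w <- paths a r j) (\prod_(u <- w) xs (arc_index u)) *
    \prod_(t <- copies w) mask_sum L t.
Proof.
elim: a r j => [|a IHa] r j /=.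
  by case: ifP => _; rewrite ?big_seq1 ?big_nil ?mul1r.
rewrite big_flatten big_map iota_index big_mkord.
apply: eq_bigr => i _; rewrite /copies /rival.
case: ifP => wij.
  rewrite big_map IHa big_distrr; apply: eq_bigr => w _ /=.
  by rewrite big_cons wij mulrA.
case: r => [|r]; first by rewrite big_nil.
rewrite big_allpairs_dep iota_index big_mkord /arc_sum mulr_suml.
apply: eq_bigr => c _; rewrite IHa big_distrr; apply: eq_bigr => w _ /=.
by rewrite big_cons wij /= big_cons mulrACA.
Qed.

End Weights.

Section Transfer.

Variables (R R' : comNzSemiRingType) (f : {rmorphism R -> R'}) (l : nat).
Variables (xs : nat -> R) (ys : nat -> nat -> R).

(** Semirings are essential here: the morphisms to be used are the evaluations of N[X] and its
    reduction to F_2[X], which relate the integers computed to the polynomials analysed. *)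
Lemma path_sum_morph L a r j : f (path_sum l xs ys L a r j) =
  path_sum l (fun u => f (xs u)) (fun t k => f (ys t k)) L a r j.
Proof.
elim: a r j => [|a IHa] r j /=; first by rewrite rmorph_nat.
rewrite rmorph_sum; apply: eq_bigr => i _; case: ifP => _.
  by rewrite rmorphM IHa.
case: r => [|r]; first by rewrite rmorph0.
rewrite rmorphM IHa rmorph_sum; congr (_ * _)%R; apply: eq_bigr => c _.
rewrite rmorphM rmorph_sum; congr (_ * _)%R; apply: eq_bigr => k _.
by rewrite rmorphM rmorph_nat.
Qed.

End Transfer.

(** A path counted here has exactly [l] rival arcs, so its copies index the rows of a square matrix
    and summing over the masks gives the determinant. *)
Lemma path_sum_det (R : comNzRingType) (l : nat) (xs : nat -> R) (ys : nat -> nat -> R) a j :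
  (1 + 1 = 0 :> R)%R ->
  (\sum_(L < 2 ^ l) path_sum l xs ys L a l j =
   \sum_(w <- paths a l j) (\prod_(u <- w) xs (arc_index u)) *
     \det (\matrix_(i < l, k < l) ys (nth 0 (copies w) i) k))%R.
Proof.
move=> R2; under eq_bigr do rewrite path_sumE.
rewrite exchange_big /= big_seq [in RHS]big_seq; apply: eq_bigr => w /size_copies sw.
rewrite -mulr_sumr -(sum_masks_det R2); congr (_ * _)%R; apply: eq_bigr => L _.
rewrite -{1}sw (big_nth 0) big_mkord sw; apply: eq_bigr => i _.
by apply: eq_bigr => k _; rewrite mxE.
Qed.

End Paths.

Lemma vandermonde_neq0 (R : idomainType) l (v : seq R) : size v = l ->
  ((\det (\matrix_(i < l, k < l) (v`_i ^+ k)) != 0) = uniq v)%R.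
Proof.
move=> sv; pose a := (\row_(i < l) v`_i)%R.
have -> : (\matrix_(i < l, k < l) (v`_i ^+ k) = (Vandermonde l a)^T)%R.
  by apply/matrixP => i k; rewrite !mxE.
rewrite det_tr det_Vandermonde; apply/idP/idP.
  move=> /prodf_neq0 nz; apply/(uniqP 0%R) => i j; rewrite !inE sv => lt_i lt_j.
  wlog lt_ij : i j lt_i lt_j / i < j.
    move=> H Eij; have [/H|/H|//] := ltngtP i j; first exact.
    by move=> h; symmetry; apply: h.
  move=> Eij; have /prodf_neq0/(_ (Ordinal lt_j)) := nz (Ordinal lt_i) isT.
  by rewrite !mxE /= Eij subrr eqxx => /(_ lt_ij).
move=> uv; apply/prodf_neq0 => i _; apply/prodf_neq0 => j lt_ij.
by rewrite !mxE subr_eq0 nth_uniq ?sv // gtn_eqF.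
Qed.

(** * The Schwartz-Zippel lemma for multilinear polynomials *)

Definition count_tuples n (P : pred (seq bool)) : nat :=
  #|[set r : n.-tuple bool | P r]|.

Lemma count_tuples_ext n (P Q : pred (seq bool)) :
  (forall r, size r = n -> P r = Q r) -> count_tuples n P = count_tuples n Q.
Proof. by move=> PQ; apply: eq_card => r; rewrite !inE PQ ?size_tuple. Qed.

Lemma count_tuples_cat m n (P : pred (seq bool)) :
  count_tuples (m + n) P = \sum_(r : m.-tuple bool) count_tuples n (fun r' => P (r ++ r')).
Proof.
pose h (u : m.-tuple bool * n.-tuple bool) := cat_tuple u.1 u.2.
have h_inj : injective h.
  move=> [u u'] [v v'] /(congr1 val) /= /eqP.
  rewrite eqseq_cat ?size_tuple // => /andP[/eqP eu /eqP ev].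
  by congr (_, _); apply: val_inj.
have h_bij : bijective h.
  by apply: inj_card_bij h_inj _; rewrite card_prod !card_tuple expnD.
rewrite /count_tuples -sum1_card (reindex h) /=; last exact: onW_bij.
under eq_bigl do rewrite inE.
rewrite -(pair_big_dep xpredT (fun (u : m.-tuple bool) (v : n.-tuple bool) => P (u ++ v))
  (fun _ _ => 1)) /=.
by apply: eq_bigr => u _; rewrite -sum1_card; apply: eq_bigl => v; rewrite inE.
Qed.

Lemma count_tuples_take m n (P : pred (seq bool)) :
  count_tuples (m + n) (fun r => P (take m r)) = count_tuples m P * 2 ^ n.
Proof.
rewrite count_tuples_cat.
transitivity (\sum_(r : m.-tuple bool | P r) 2 ^ n).
  rewrite [RHS]big_mkcond; apply: eq_bigr => r _; rewrite /count_tuples.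
  rewrite (_ : [set _ | _] = if P r then setT else set0).
    by case: ifP; rewrite ?cards0 // cardsT card_tuple card_bool.
  by apply/setP => r'; rewrite inE take_size_cat ?size_tuple //; case: ifP; rewrite ?inE.
by rewrite sum_nat_const /count_tuples cardsE.
Qed.

Section SchwartzZippel.

Variable R : idomainType.
Local Open Scope ring_scope.

(* The multilinear polynomial with coefficient [c b] at the monomial with *)
(* exponents [b].                                                          *)
Fixpoint multilinear (c : seq bool -> R) (xs : seq R) : R :=
  match xs with
  | [::] => c [::]
  | x :: xs => multilinear (fun b => c (false :: b) + x * c (true :: b)) xs
  end.

Lemma multilinear_ext c c' xs : c =1 c' -> multilinear c xs = multilinear c' xs.
Proof. by elim: xs c c' => [|x xs IHxs] c c' E /=; rewrite ?E //; apply: IHxs => b; rewrite !E. Qed.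

Lemma multilinear_monomials (T : Type) (s : seq T) (a : T -> R) (pat : T -> seq bool) xs :
  (forall w, size (pat w) = size xs) ->
  multilinear (fun b => \sum_(w <- s) a w * (b == pat w)%:R) xs =
  \sum_(w <- s) a w * \prod_(i < size xs) (if nth false (pat w) i then xs`_i else 1).
Proof.
elim: xs a pat => [|x xs IHxs] a pat spat /=.
  by apply: eq_bigr => w _; rewrite big_ord0 (size0nil (spat w)).
pose a' w := a w * (if nth false (pat w) 0 then x else 1).
rewrite (@multilinear_ext _ (fun b => \sum_(w <- s) a' w * (b == behead (pat w))%:R)).
  rewrite IHxs => [|w]; last by rewrite size_behead spat.
  apply: eq_bigr => w _; rewrite big_ord_recl /= mulrA; congr (_ * _).
  by apply: eq_bigr => i _; rewrite nth_behead.
move=> b; rewrite big_distrr -big_split; apply: eq_bigr => w _ /=.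
have := spat w; rewrite /a'; case: (pat w) => //= h t _.
rewrite !eqseq_cons; case: h => /=; rewrite ?mulr0 ?addr0 ?add0r ?mulr1 //.
by rewrite mulrCA mulrA.
Qed.

Variables (d : nat) (sample : seq bool -> R).
Hypothesis sample_inj : forall r r', size r = d -> size r' = d ->
  sample r = sample r' -> r = r'.

Fixpoint samples (m : nat) (r : seq bool) : seq R :=
  if m is m.+1 then sample (take d r) :: samples m (drop d r) else [::].

(** Substitute the first variable and follow the coefficient at the tail of [b]. It is an affine
    function of that variable, not identically zero, so at most one of the 2^d samples kills it; for
    the others the induction continues with the same tail. *)
Lemma schwartz_zippel m (c : seq bool -> R) b : size b = m -> c b != 0 ->
  ((2 ^ d - 1) ^ m <= count_tuples (m * d) (fun r => multilinear c (samples m r) != 0%R))%N.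
Proof.
elim: m c b => [|m IHm] c b.
  move=> /size0nil -> c0; rewrite expn0 /count_tuples.
  rewrite (_ : [set _ | _] = setT) ?cardsT ?card_tuple //.
  by apply/setP => r; rewrite !inE.
case: b => //= h b [sb] cb.
rewrite mulSn count_tuples_cat.
pose bad (r : d.-tuple bool) := c (false :: b) + sample r * c (true :: b) == 0.
have bad1 : (#|[set r | bad r]| <= 1)%N.
  apply/card_le1P => r; rewrite inE => /eqP br r'.
  rewrite !inE; apply/idP/eqP => [/eqP br'|-> //]; last by rewrite /bad br.
  have := br; rewrite -br' => /addrI.
  have [c1|c1] := eqVneq (c (true :: b)) 0.
    move: cb; case: h; rewrite ?c1 ?eqxx // => /negP[].
    by rewrite -br c1 mulr0 addr0.
  by move/(mulIf c1) => E; apply/val_inj/sample_inj; rewrite ?size_tuple.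
have good r : ~~ bad r -> ((2 ^ d - 1) ^ m <= count_tuples (m * d)
    (fun r' => multilinear c (samples m.+1 (val r ++ r')) != 0%R))%N.
  move=> nb; pose c' b' := c (false :: b') + sample r * c (true :: b').
  apply: leq_trans (IHm c' b sb nb) _; rewrite leq_eqVlt; apply/orP; left; apply/eqP.
  by apply: count_tuples_ext => r' _; rewrite /= take_size_cat ?drop_size_cat ?size_tuple.
rewrite (bigID bad) /=; apply: leq_trans (leq_addl _ _).
apply: leq_trans (_ : \sum_(r : d.-tuple bool | ~~ bad r) (2 ^ d - 1) ^ m <= _)%N; last first.
  by apply: leq_sum.
rewrite sum_nat_const expnS leq_mul2r; apply/orP; right.
have := cardC (fun r : d.-tuple bool => bad r); rewrite card_tuple card_bool.
rewrite cardsE in bad1; rewrite leq_subLR => <-; rewrite leq_add2r.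
exact: bad1.
Qed.

End SchwartzZippel.

(** Bernoulli's inequality (1 - 1/N)^m >= 1 - m/N, cleared of denominators; truncated subtraction
    makes it trivial for [m >= N]. *)
Lemma bernoulli N m : 0 < N -> N ^ m * (N - m) <= (N - 1) ^ m * N.
Proof.
move=> N0; elim: m => [|m IHm]; first by rewrite !expn0 subn0.
have [le_Nm|lt_mN] := leqP N m.+1; first by rewrite (eqP le_Nm) muln0.
have step : N ^ m.+1 * (N - m.+1) <= N ^ m * (N - m) * (N - 1).
  rewrite expnS (mulnC N) -!mulnA leq_mul2l; apply/orP; right; nia.
apply: leq_trans step _; by rewrite expnSr [X in _ <= X]mulnAC leq_mul2r IHm orbT.
Qed.

(** * Fingerprints *)

Section Bounds.

Variables (S cc p : nat) (win : nat -> nat -> nat).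

(** Arcs are listed backwards and have positive length, so their right ends strictly decrease. The
    artificial head, ending at [u.1.1.+1], also bounds the first right end by [u.1.1]. *)
Lemma path_decreasing u w : path meets u w -> all (fun v => v.1.1 < v.1.2) w ->
  path (fun u v => v.1.2 < u.1.2) (u.1.1.+1, u.1.1.+1, 0) w.
Proof.
elim: w u => //= v w IHw u /andP[/eqP uv pw] /andP[lt_v lw].
rewrite -uv ltnSn; have := IHw v pw lw.
case: w {IHw pw lw} => //= v' w /andP[v'v ->]; rewrite andbT.
exact: leq_trans v'v lt_v.
Qed.

Lemma paths_sorted a r j w : w \in paths cc p win a r j ->
  sorted (fun u v => v.1.2 < u.1.2) w.
Proof.
case/pathsP => pw lw _ _ _; rewrite -cats1 cat_path in pw; case/andP: pw => pw _.
exact: path_sorted (path_decreasing pw lw).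
Qed.

Lemma gt_end_trans : transitive (fun u v : nat * nat * nat => v.1.2 < u.1.2).
Proof. by move=> u v w vu uw; exact: ltn_trans vu. Qed.

Lemma paths_bound a r j w u : w \in paths cc p win a r j -> u \in w ->
  u.1.1 < u.1.2 <= j /\ u.2 < maxn cc 1.
Proof.
case/pathsP => pw lw _ _ kw uw.
rewrite -cats1 cat_path in pw; case/andP: pw => /path_decreasing-/(_ lw) pw _.
rewrite (allP lw _ uw) /=; split.
  rewrite -ltnS; have := order_path_min gt_end_trans pw.
  by move/allP/(_ _ uw).
by move/allP: kw => /(_ _ uw); case: rival => [|/eqP ->]; lia.
Qed.

Hypothesis cS : cc < S.

Lemma arc_index_lt u j : u.1.1 < u.1.2 <= j -> j < S -> u.2 < maxn cc 1 ->
  arc_index S u < S * S * S.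
Proof.
case: u => [[i j'] c] /= /andP[ij jS] lt_j lt_c; rewrite /arc_index /=.
have ? : i * S + j' < S * S by nia.
nia.
Qed.

Lemma arc_index_inj u v : u.1.2 < S -> u.2 < S -> v.1.2 < S -> v.2 < S ->
  arc_index S u = arc_index S v -> u = v.
Proof.
case: u v => [[i j] c] [[i' j'] c'] /= jS cS' j'S c'S; rewrite /arc_index /= => E.
have Ec : c = c'.
  by have := congr1 (modn^~ S) E; rewrite /= !modnMDl !modn_small.
have Eij : i * S + j = i' * S + j'.
  by move: E; rewrite Ec => /addIn/eqP; rewrite eqn_pmul2r ?(leq_ltn_trans _ cS) // => /eqP.
have Ej : j = j' by have := congr1 (modn^~ S) Eij; rewrite /= !modnMDl !modn_small.
move: Eij; rewrite Ej Ec => /addIn/eqP; rewrite eqn_pmul2r ?(leq_ltn_trans _ cS) //.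
by move=> /eqP ->.
Qed.

(** A path is sorted by its right ends, hence determined by its set of arcs. So distinct paths have
    distinct squarefree monomials and cannot cancel in the fingerprint. *)
Lemma arc_index_paths_inj a r j w w' : j < S ->
  w \in paths cc p win a r j -> w' \in paths cc p win a r j ->
  map (arc_index S) w =i map (arc_index S) w' -> w = w'.
Proof.
move=> jS wP w'P E; have arc_lt v u : v \in paths cc p win a r j -> u \in v -> u.1.2 < S /\ u.2 < S.
  by move=> vP /(paths_bound vP) [/andP[_ ?] ?]; split; lia.
apply: (irr_sorted_eq gt_end_trans (fun u => ltnn _)); rewrite ?(paths_sorted wP) ?(paths_sorted w'P) //.
have sub v v' : v \in paths cc p win a r j -> v' \in paths cc p win a r j ->
    map (arc_index S) v =i map (arc_index S) v' -> {subset v <= v'}.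
  move=> vP v'P Ev u uv; have : arc_index S u \in map (arc_index S) v' by rewrite -Ev map_f.
  case/mapP => u' u'v' Eu; have [? ?] := arc_lt _ _ vP uv; have [? ?] := arc_lt _ _ v'P u'v'.
  by rewrite (arc_index_inj _ _ _ _ Eu).
by move=> u; apply/idP/idP; apply: sub => // ?; rewrite E.
Qed.

End Bounds.

Lemma path_sum_ext S cc p win (R : comNzSemiRingType) l (xs xs' : nat -> R) ys ys' L a r j :
  xs =1 xs' -> ys =2 ys' ->
  path_sum S cc p win l xs ys L a r j = path_sum S cc p win l xs' ys' L a r j.
Proof.
move=> Ex Ey; elim: a r j => //= a IHa r j; apply: eq_bigr => i _.
rewrite Ex IHa; case: ifP => // _; case: r => // r; rewrite IHa; congr (_ * _)%R.
apply: eq_bigr => c _; rewrite Ex; congr (_ * _)%R.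
by apply: eq_bigr => k _; rewrite Ey.
Qed.

Section Fingerprint.

Variables (S cc p : nat) (win : nat -> nat -> nat) (a l n d : nat).
Hypotheses (cS : cc < S) (nS : n < S).

Definition sample (R : comNzSemiRingType) (z : R) (r : seq bool) : R :=
  (\sum_(i < d) (nth false r i)%:R * z ^+ i)%R.

Definition coin_word (cs : seq bool) u := take d (drop (u * d) cs).

Definition fingerprint (R : comNzSemiRingType) (z : R) (cs : seq bool) : R :=
  (\sum_(L < 2 ^ l) path_sum S cc p win l (fun u => sample z (coin_word cs u))
     (fun t k => z ^+ (t * k)) L a l n)%R.

Definition solvable : bool := has (fun w => uniq (copies S p win w)) (paths cc p win a l n).

Local Open Scope ring_scope.

Lemma sample_morph (R R' : comNzSemiRingType) (f : {rmorphism R -> R'}) z r :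
  f (sample z r) = sample (f z) r.
Proof.
by rewrite rmorph_sum; apply: eq_bigr => i _; rewrite rmorphM rmorph_nat rmorphXn.
Qed.

Lemma fingerprint_morph (R R' : comNzSemiRingType) (f : {rmorphism R -> R'}) z cs :
  f (fingerprint z cs) = fingerprint (f z) cs.
Proof.
rewrite rmorph_sum; apply: eq_bigr => L _; rewrite path_sum_morph.
apply: path_sum_ext => [u|t k]; first exact: sample_morph.
by rewrite rmorphXn.
Qed.

Notation F2X := {poly 'F_2}.

Lemma F2X_char2 : 1 + 1 = 0 :> F2X.
Proof. by rewrite -polyCD; have -> : 1 + 1 = 0 :> 'F_2 by apply/val_inj. Qed.

Definition path_det w : F2X := \det (\matrix_(i < l, k < l) 'X^(nth 0%N (copies S p win w) i * k)).

Lemma path_det_neq0 w : w \in paths cc p win a l n ->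
  (path_det w != 0) = uniq (copies S p win w).
Proof.
move/size_copies => /(_ S) sw.
pose v := [seq 'X^t : F2X | t <- copies S p win w].
have sv : size v = l by rewrite size_map.
rewrite /path_det (_ : \matrix_(i, k) _ = \matrix_(i < l, k < l) (v`_i ^+ k)).
  rewrite vandermonde_neq0 // map_inj_uniq // => t t' /(congr1 (fun q : F2X => size q)).
  by rewrite !size_polyXn => -[].
by apply/matrixP => i k; rewrite !mxE (nth_map 0%N) ?sw ?ltn_ord // -exprM.
Qed.

Lemma fingerprint_det cs : fingerprint ('X : F2X) cs =
  \sum_(w <- paths cc p win a l n)
    (\prod_(u <- w) sample 'X (coin_word cs (arc_index S u))) * path_det w.
Proof. exact: path_sum_det F2X_char2. Qed.

Lemma fingerprint_sound cs : fingerprint ('X : F2X) cs != 0 -> solvable.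
Proof.
rewrite fingerprint_det; apply: contraR => /hasPn nu; apply/eqP.
rewrite big_seq big1 // => w wP.
by move: (nu w wP); rewrite -path_det_neq0 // negbK => /eqP ->; rewrite mulr0.
Qed.

Lemma sample_inj r r' : size r = d -> size r' = d ->
  sample ('X : F2X) r = sample 'X r' -> r = r'.
Proof.
move=> sr sr' E; apply: (@eq_from_nth _ false); rewrite ?sr' // sr => i lt_i.
have coef v : (sample ('X : F2X) v)`_i = (nth false v i)%:R.
  rewrite coef_sum (bigD1 (Ordinal lt_i)) //= big1 => [|k ne_ki].
    by rewrite -polyC_natr coefCM coefXn eqxx mulr1 addr0.
  rewrite -polyC_natr coefCM coefXn.
  by have -> : (i == k)%N = false; rewrite ?mulr0 // eq_sym; apply/negbTE.
by have := congr1 (fun q : F2X => q`_i) E; rewrite /= !coef; do 2!case: nth.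
Qed.

Lemma nth_samples m cs i : (i < m)%N ->
  (samples d (sample ('X : F2X)) m cs)`_i = sample 'X (coin_word cs i).
Proof.
elim: m i cs => // m IHm [|i] cs lt_i /=; first by rewrite /coin_word mul0n drop0.
by rewrite IHm // /coin_word drop_drop mulSn addnC.
Qed.

Lemma size_samples m cs : size (samples d (sample ('X : F2X)) m cs) = m.
Proof. by elim: m cs => //= m IHm cs; rewrite IHm. Qed.

Lemma fingerprint_complete : solvable -> (3 * S ^ 3 <= 2 ^ d)%N ->
  (2 * 2 ^ (S ^ 3 * d) <=
   3 * count_tuples (S ^ 3 * d) (fun cs => fingerprint ('X : F2X) cs != 0%R))%N.
Proof.
case/hasP => w0 w0P uw0 dS; set m := (S ^ 3)%N in dS *.
have mE : m = (S * S * S)%N by rewrite /m !expnS expn0 muln1 mulnA.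
(* The exponent vector of the monomial of [w], over all S^3 words; the coefficient at [pat w0] is
   the determinant of [w0] alone. *)
pose pat w := mkseq (fun u => u \in map (arc_index S) w) m.
pose c (b : seq bool) : F2X :=
  \sum_(w <- paths cc p win a l n) path_det w * (b == pat w)%:R.
have c0 : c (pat w0) != 0.
  rewrite /c (bigD1_seq w0) ?paths_uniq //= eqxx mulr1 big_seq_cond big1.
    by rewrite addr0 path_det_neq0.
  move=> w /andP[wP]; apply: contraNeq; rewrite mulf_eq0 negb_or => /andP[_].
  case: (eqVneq (pat w0) (pat w)) => [Epat _|_]; last by rewrite eqxx.
  apply/eqP; apply: (arc_index_paths_inj cS nS wP w0P) => u.
  have [lt_u|ge_u] := ltnP u m.
    by have := congr1 (fun b => nth false b u) Epat; rewrite !nth_mkseq.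
  have out v : v \in paths cc p win a l n -> u \notin map (arc_index S) v.
    move=> vP; apply/mapP => -[x xv Eu].
    have [xj xc] := paths_bound vP xv.
    by have := arc_index_lt cS xj nS xc; rewrite -Eu -mE ltnNge ge_u.
  by rewrite !(negbTE (out _ _)).
have := schwartz_zippel sample_inj (size_mkseq _ _ : size (pat w0) = m) c0.
rewrite (@count_tuples_ext _ _ (fun cs => fingerprint ('X : F2X) cs != 0)); last first.
  move=> cs _; rewrite fingerprint_det multilinear_monomials ?size_samples; last first.
    by move=> w; rewrite size_mkseq.
  rewrite big_seq [in RHS]big_seq; congr (_ != _); apply: eq_bigr => w wP.
  rewrite mulrC; congr (_ * _).
  transitivity (\prod_(i < m | val i \in map (arc_index S) w) sample ('X : F2X) (coin_word cs i)).
    rewrite [RHS]big_mkcond; apply: eq_bigr => i _; rewrite nth_mkseq // nth_samples //.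
  have uw : uniq (map (arc_index S) w).
    rewrite map_inj_in_uniq.
      exact: sorted_uniq gt_end_trans (fun u => ltnn _) _ (paths_sorted wP).
    move=> u v /(paths_bound wP)[/andP[_ un] uc] /(paths_bound wP)[/andP[_ vn] vc].
    have cS1 : (maxn cc 1 <= S)%N by lia.
    by apply: (arc_index_inj cS); rewrite ?(leq_ltn_trans un) ?(leq_ltn_trans vn)
      ?(leq_trans uc) ?(leq_trans vc).
  rewrite -(big_map (arc_index S) xpredT (fun u => sample ('X : F2X) (coin_word cs u))).
  rewrite -(big_mkord (fun i => i \in map (arc_index S) w)
    (fun u => sample ('X : F2X) (coin_word cs u))) -big_filter.
  apply: perm_big; apply: uniq_perm => //; first by rewrite filter_uniq ?iota_uniq.
  move=> u; rewrite mem_filter mem_index_iota; case: (boolP (u \in _)) => //= /mapP[x xw ->].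
  have [xj xc] := paths_bound wP xw.
  by rewrite mE (arc_index_lt cS xj nS xc).
move=> cnt; have N0 : (0 < 2 ^ d)%N by rewrite expn_gt0.
have -> : (2 ^ (m * d) = (2 ^ d) ^ m)%N by rewrite mulnC expnM.
move: (2 ^ d)%N N0 dS cnt (bernoulli m N0) => N N0 dS cnt bern.
rewrite -(leq_pmul2r N0); apply: leq_trans (_ : 3 * (N - 1) ^ m * N <= _)%N; last first.
  by rewrite leq_mul2r leq_mul2l cnt !orbT.
apply: leq_trans (_ : 3 * (N ^ m * (N - m)) <= _)%N; last by rewrite -mulnA leq_mul2l bern orbT.
rewrite -mulnA mulnCA [X in (_ <= X)%N]mulnCA leq_mul2l; apply/orP; right; lia.
Qed.

End Fingerprint.

(** * Kronecker substitution *)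

Lemma nat_poly_digit (q : {poly nat}) B i : (q.[1])%R < B ->
  ((q.[B])%R %/ B ^ i) %% B = (q`_i)%R.
Proof.
rewrite /horner; move: (polyseq q) i => s i lt_sB.
have {}lt_sB : horner_rec s 1%R < B by [].
have B0 : 0 < B by apply: leq_ltn_trans lt_sB.
have cons_eq a t z : horner_rec (a :: t) z = horner_rec t z * z + a by [].
elim: s i lt_sB => [|a s IHs] i.
  by rewrite nth_nil div0n mod0n.
rewrite cons_eq muln1 => lt_B; rewrite cons_eq.
have lt_a : a < B by apply: leq_ltn_trans lt_B; exact: leq_addl.
case: i => [|i]; first by rewrite expn0 divn1 modnMDl modn_small.
rewrite expnS divnMA divnMDl // (divn_small lt_a) addn0 IHs //.
by apply: leq_ltn_trans lt_B; exact: leq_addr.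
Qed.

Section Kronecker.

Variables (S cc p : nat) (win : nat -> nat -> nat) (a l n d : nat).

Local Notation fp := (fingerprint S cc p win a l n d).

(** The integers and the polynomials over F_2 are images of one polynomial over N. As [B] is even,
    the parity of a digit is that of the whole quotient, so digits need not be isolated; the bound
    [B ^ E] ensures that no nonzero digit is missed. *)
Lemma fingerprint_digits B E cs : ~~ odd B -> fp 1 cs < B -> fp B cs < B ^ E ->
  (\sum_(i < E) (fp B cs %/ B ^ i) %% 2 != 0) = (fp ('X : {poly 'F_2})%R cs != 0%R).
Proof.
move=> evB lt1 ltB; pose q : {poly nat} := fp 'X%R cs.
have qE (z : nat) : (q.[z])%R = fp z cs.
  rewrite -[in RHS](hornerX z).
  exact: (fingerprint_morph S cc p win a l n d (horner_eval z) 'X%R cs).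
have B1 : (q.[1])%R < B by rewrite qE.
have digit i : (fp B cs %/ B ^ i) %% 2 = odd (q`_i)%R :> nat.
  rewrite -(nat_poly_digit i B1) qE modn2; congr (nat_of_bool _).
  by rewrite [in LHS](divn_eq (_ %/ _) B) oddD oddM (negbTE evB) andbF.
have coef i : ((fp ('X : {poly 'F_2}) cs)`_i = ((q`_i)%R)%:R)%R.
  have := fingerprint_morph S cc p win a l n d
    (map_poly (GRing.natmul (1 : 'F_2)%R) : {rmorphism {poly nat} -> {poly 'F_2}}) 'X%R cs.
  by rewrite /= map_polyX => <-; rewrite coef_map.
have F2odd m : ((m%:R != 0 :> 'F_2) = odd m)%R.
  by rewrite -(dvdn_pcharf (pchar_Fp (isT : prime 2))) dvdn2 negbK.
apply/idP/idP.
  apply: contraNneq => f0; rewrite big1 // => i _; rewrite digit.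
  by have := F2odd (q`_i)%R; rewrite -coef f0 coef0 eqxx => <-.
apply: contraNneq => /eqP; rewrite sum_nat_eq0 => /forallP q0.
apply/eqP/polyP => i; rewrite coef0 coef; apply/eqP; rewrite -[_ == _]negbK F2odd.
have [lt_iE|le_Ei] := ltnP i E.
  by have := q0 (Ordinal lt_iE); rewrite /= digit eqb0.
have B0 : 0 < B by exact: leq_ltn_trans lt1.
have := digit i; rewrite divn_small ?mod0n; first by case: odd.
by rewrite (leq_trans ltB) // leq_pexp2l.
Qed.

Hypotheses (winS : forall i j, win i j < S).

Lemma sum_pow_le A j (F : 'I_j -> nat) : (forall i, F i <= A * (1 + A) ^ i) ->
  \sum_(i < j) F i <= (1 + A) ^ j.
Proof.
move=> le_F; apply: leq_trans (_ : \sum_(i < j) A * (1 + A) ^ i <= _).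
  exact: leq_sum.
elim: j {F le_F} => [|j IHj]; first by rewrite big_ord0 expn0.
by rewrite big_ord_recr expnS mulnDl mul1n leq_add.
Qed.

(** The value at [j] is at most [A] times the sum of the values at [i < j], where [A] bounds the
    weight of an arc; [(1 + A) ^ j] solves this recurrence for any number of arcs. *)
Lemma path_sum_le (xs : nat -> nat) ys x y L a' r j :
  cc <= S -> (forall u, xs u <= x) -> (forall t k, t < S * S -> k < l -> ys t k <= y) ->
  path_sum S cc p win l xs ys L a' r j <= (1 + (x + cc * (x * (l * y)))) ^ j.
Proof.
move=> cS le_x le_y; set A := x + _.
elim: a' r j => [|a' IHa] r j /=; first by rewrite natn; case: (_ && _); rewrite ?expn_gt0.
apply: sum_pow_le => i.
case: ifP => _; first by rewrite leq_mul ?IHa // (leq_trans (le_x _)) ?leq_addr.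
case: r => [//|r]; rewrite leq_mul ?IHa // (leq_trans _ (leq_addl _ _)) //.
apply: leq_trans (_ : \sum_(c < cc) x * (l * y) <= _); last by rewrite sum_nat_const card_ord.
apply: leq_sum => c _; apply: leq_mul => //.
apply: leq_trans (_ : \sum_(k < l) y <= _); last by rewrite sum_nat_const card_ord.
apply: leq_sum => k _; rewrite -[y]mul1n leq_mul //.
  by rewrite natn /bit modn2 leq_b1.
apply: le_y => //; rewrite /copy_index /=.
have := winS i j; have := ltn_ord c; nia.
Qed.

Lemma sample_le z r : 0 < z -> sample d z r <= d * z ^ d.
Proof.
move=> z0; rewrite /sample; apply: leq_trans (_ : \sum_(i < d) z ^ d <= _).
  apply: leq_sum => i _; rewrite natn -[z ^ d]mul1n leq_mul ?leq_b1 //.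
  by rewrite leq_pexp2l // ltnW.
by rewrite sum_nat_const card_ord.
Qed.

Hypotheses (cS : cc < S) (nS : n < S) (lS : l < S) (S6 : 5 < S) (dS : d = 4 * S).

Lemma path_sum_pow_le (b : nat) cs L a' r j :
  path_sum (R := nat) S cc p win l (fun u => sample (R := nat) d (2 ^ b)%N (coin_word d cs u))
     (fun t k => ((2 ^ b)%N ^+ (t * k))%R) L a' r j <= 2 ^ (j * (4 * S + b * (4 * S + S ^ 3))).
Proof.
set z := 2 ^ b; have z0 : 0 < z by rewrite expn_gt0.
apply: leq_trans (@path_sum_le _ _ (d * z ^ d) (z ^ (S ^ 3)) L a' r j (ltnW cS) _ _) _.
- by move=> u; exact: sample_le.
- move=> t k lt_t lt_k; rewrite natrXE leq_pexp2l // !expnS expn0 muln1 mulnA ltnW //.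
  by rewrite -[t * k]mulnC mulnC ltn_mul // (ltn_trans lt_k).
rewrite (mulnC j) expnM; case: j => [|j]; first by rewrite !expn0.
rewrite leq_exp2r //.
rewrite expnD (expnM 2 b) -/z expnD -dS.
have zd : 0 < z ^ d by rewrite expn_gt0 z0.
have zS : 0 < z ^ (S ^ 3) by rewrite expn_gt0 z0.
(* Words have [4 * S] coins so that [2 ^ d] absorbs the factors polynomial in [S]. *)
have S4 : S ^ 4 <= 2 ^ d.
  by rewrite dS mulnC expnM leq_exp2r // ltnW // ltn_expl.
have S34 : 6 * (S * S * S) <= S ^ 4 by rewrite !expnS expn0 muln1 !mulnA !leq_mul2r S6 !orbT.
have u0 : 0 < z ^ d * z ^ (S ^ 3) by rewrite muln_gt0 zd.
apply: leq_trans (_ : S ^ 4 * (z ^ d * z ^ (S ^ 3)) <= _); last by rewrite leq_mul2r S4 orbT.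
have le_u : z ^ d <= z ^ d * z ^ (S ^ 3) by rewrite leq_pmulr.
have -> : cc * (d * z ^ d * (l * z ^ (S ^ 3))) = cc * d * l * (z ^ d * z ^ (S ^ 3)) by ring.
move: u0 le_u; move: (z ^ d * z ^ (S ^ 3)) => u; move: (z ^ d) => v u0 le_u.
apply: leq_trans (_ : (1 + d + cc * d * l) * u <= _).
  by rewrite !mulnDl mul1n -addnA leq_add // leq_add2r leq_mul2l le_u orbT.
rewrite leq_mul2r; apply/orP; right; apply: leq_trans S34.
have ? : cc * d * l <= S * d * S by rewrite !leq_mul // ltnW.
have ? : 6 * S <= S * S by rewrite leq_mul2r S6 orbT.
have ? : 6 * (S * S) <= S * S * S by rewrite -mulnA leq_mul2r S6 orbT.
have ? : S * d * S = 4 * (S * S * S) by rewrite dS; ring.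
lia.
Qed.

(** Serves twice: [b = 0] bounds the sum of the coefficients, hence each digit, and the actual [b]
    bounds the number of digits. *)
Lemma fingerprint_le (b : nat) cs :
  fp (2 ^ b)%N cs <= 2 ^ (l + n * (4 * S + b * (4 * S + S ^ 3))).
Proof.
rewrite expnD -[X in X * _]card_ord -sum_nat_const; apply: leq_sum => L _.
exact: path_sum_pow_le.
Qed.

End Kronecker.

(** * Districts of a path *)

Section PathGraph.

Variable I : instance.
Let V : finType := 'I_(nvoters I).
Let n := nvoters I.
Variable f : 'I_(nvoters I) -> 'I_(nvoters I).
Hypothesis f_bij : bijective f.
Hypothesis f_adj : forall i j : 'I_(nvoters I),
  adj (f i) (f j) = (i.+1 == j :> nat) || (j.+1 == i :> nat).

Let f_inj : injective f := bij_inj f_bij.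

Definition segment i j : {set 'I_(nvoters I)} := [set f t | t : 'I_(nvoters I) & i <= t < j].

Lemma mem_segment i j t : (f t \in segment i j) = (i <= t < j).
Proof. by rewrite mem_imset // inE. Qed.

Lemma segment_neq0 i j : i < j <= n -> segment i j != set0.
Proof.
case/andP=> ij jn; apply/set0Pn; exists (f (Ordinal (leq_trans ij jn))).
by rewrite mem_segment /= leqnn.
Qed.

Lemma induced_sym (U : {set V}) : symmetric (induced U).
Proof. by move=> u v; rewrite /induced /= andbCA adj_sym. Qed.

Lemma connect_segment i j (s t : 'I_(nvoters I)) : i <= s -> s <= t -> t < j ->
  connect (induced (segment i j)) (f s) (f t).
Proof.
move=> le_is; move: t => [t lt_t] /=; elim: t lt_t => [|t IHt] lt_t le_st lt_j.
  have -> : s = Ordinal lt_t by apply/val_inj; rewrite /=; lia.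
  exact: connect0.
case: (ltngtP s t.+1) le_st => // [lt_st|Est] _; last first.
  have -> : s = Ordinal lt_t by apply/val_inj.
  exact: connect0.
apply: (connect_trans (IHt (ltnW lt_t) lt_st (ltnW lt_j))); apply: connect1.
by rewrite /induced /= !mem_segment f_adj /= eqxx; lia.
Qed.

Lemma segment_district i j : i < j <= n -> district (segment i j).
Proof.
move=> ijn; rewrite /district segment_neq0 //=.
apply/'forall_implyP => u uU; apply/'forall_implyP => v vU.
have [g fK gK] := f_bij; rewrite -(gK u) -(gK v) in uU vU *.
rewrite !mem_segment in uU vU.
wlog le_uv : u v uU vU / g u <= g v.
  move=> H; have [|/ltnW] := leqP (g u) (g v); first exact: H.
  rewrite (sym_connect_sym (induced_sym _)); exact: H.
by apply: connect_segment => //; lia.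
Qed.

Lemma district_segment (U : {set V}) : district U ->
  exists i j, i < j <= n /\ U = segment i j.
Proof.
case/andP=> /set0Pn[u0 u0U] /'forall_implyP connU.
have [g fK gK] := f_bij.
have U0 : f (g u0) \in U by rewrite gK.
case: (@arg_minnP _ (g u0) (fun t => f t \in U) val U0) => a aU a_min.
case: (@arg_maxnP _ (g u0) (fun t => f t \in U) val U0) => b bU b_max.
have le_ab : a <= b by exact: a_min.
exists a, b.+1; split; first by rewrite ltnS le_ab ltn_ord.
apply/setP => u; rewrite -(gK u) mem_segment ltnS.
apply/idP/andP => [uU|[le_a le_b]]; first by split; [exact: a_min|exact: b_max].
apply/negPn/negP => nU.
have /connectP[q q_path q_last] : connect (induced U) (f a) (f b).
  by have /'forall_implyP := connU _ aU; apply.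
have lt_ag : a < g u.
  rewrite ltn_neqAle le_a andbT; apply: contraNneq nU => /val_inj <-; exact: aU.
have lt_gb : g u < b.
  rewrite ltn_neqAle le_b andbT; apply: contraNneq nU => /val_inj ->; exact: bU.
(* A step inside [U] changes the position by one and cannot land on the missing vertex [u], so a
   walk starting before [u] stays before it and never reaches [b]. *)
have : g (f b) < g u.
  rewrite q_last; move: q_path {q_last}; have : g (f a) < g u by rewrite fK.
  elim: q (f a) => //= v q IHq v0 lt_v0 /andP[/and3P[_ vU adj_v]]; apply: IHq.
  move: adj_v; rewrite -(gK v0) -(gK v) f_adj; rewrite !fK.
  have : g v != g u :> nat by apply: contraNneq nU => /ord_inj <-; rewrite gK.
  move: lt_v0; lia.
by rewrite fK ltnNge ltnW.
Qed.

Local Notation seg u := (segment u.1.1 u.1.2).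

Lemma segment_cat i j k : i <= j -> j <= k -> segment i k = segment i j :|: segment j k.
Proof.
have [g fK gK] := f_bij.
by move=> ij jk; apply/setP => u; rewrite -(gK u) inE !mem_segment; lia.
Qed.

Lemma segment_disjoint i j k l : j <= k -> [disjoint segment i j & segment k l].
Proof.
have [g fK gK] := f_bij.
move=> jk; rewrite -setI_eq0; apply/eqP/setP => u.
by rewrite -(gK u) !inE !mem_segment; lia.
Qed.

(** Peel off the district of the last vertex: it is a segment inside the prefix, so it ends where
    the prefix does, and the other districts partition a shorter prefix. *)
Lemma tiling_of_partition j (P : {set {set V}}) : j <= n ->
  partition P (segment 0 j) -> [forall U in P, district U] ->
  exists w : seq (nat * nat * nat),
    [/\ path meets (j, 0, 0) (rcons w (0, 0, 0)),
        all (fun u => u.1.1 < u.1.2) w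
      & perm_eq [seq seg u | u <- w] (enum P)].
Proof.
have [g fK gK] := f_bij.
elim/ltn_ind: j P => -[|j] IHj P le_jn part_P /'forall_implyP distP.
  exists [::]; split=> //=.
  have -> : P = set0; last by rewrite enum_set0.
  apply/setP => U; rewrite inE; apply/negP => UP.
  have /set0Pn[u uU] : U != set0 by have /andP[] := distP _ UP.
  have : u \in segment 0 0.
    by case/and3P: part_P => /eqP <- _ _; apply/bigcupP; exists U.
  by rewrite -(gK u) mem_segment ltn0 andbF.
have [/eqP covP trivP P0] := and3P part_P.
pose z : V := Ordinal le_jn.
have : f z \in cover P by rewrite covP mem_segment /=.
case/bigcupP => U UP zU; have [a [b [ab EU]]] := district_segment (distP _ UP).
have Usub : U \subset segment 0 j.+1 by rewrite -covP; exact: bigcup_sup UP.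
have Eb : b = j.+1.
  have [jb jb1] : a <= j < b /\ b.-1 < n by move: zU; rewrite EU mem_segment /=; lia.
  have : f (Ordinal jb1) \in segment 0 j.+1.
    by apply: (subsetP Usub); rewrite EU mem_segment /=; lia.
  by rewrite mem_segment /=; lia.
subst b; have lt_aj : a < j.+1 by case/andP: ab.
have part' : partition (P :\ U) (segment 0 a).
  have covP' : cover (P :\ U) = segment 0 a.
    apply/setP => u; apply/bigcupP/idP => [[W]|us].
      rewrite in_setD1 => /andP[WU WP] uW.
      have : u \in segment 0 j.+1 by rewrite -covP; apply/bigcupP; exists W.
      rewrite (segment_cat (leq0n a) (ltnW lt_aj)) inE => /orP[//|uU].
      rewrite -EU in uU.
      by rewrite (disjointFl (trivIsetP trivP _ _ WP UP WU) uU) in uW.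
    have : u \in cover P.
      by rewrite covP (segment_cat (leq0n a) (ltnW lt_aj)) inE us.
    case/bigcupP => W WP uW; exists W => //; rewrite in_setD1 WP andbT.
    apply: contraTneq uW => ->; rewrite EU.
    by rewrite (disjointFr (segment_disjoint 0 j.+1 (leqnn a)) us).
  rewrite /partition covP' eqxx /=; apply/andP; split.
    by apply: trivIsetS trivP; exact: subsetDl.
  by rewrite in_setD1 (negbTE P0) andbF.
have [|w [pw lw Ew]] := IHj a lt_aj (P :\ U) (ltac:(lia)) part'.
  by apply/'forall_implyP => W; rewrite in_setD1 => /andP[_ /distP].
exists ((a, j.+1, 0) :: w); split=> /=.
- by rewrite meets_path pw /meets /= eqxx.
- by rewrite lt_aj.
rewrite -EU; apply: perm_trans (_ : perm_eq (U :: enum (P :\ U)) _).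
  by rewrite perm_cons.
apply: uniq_perm; rewrite /= ?enum_uniq ?mem_enum ?in_setD1 ?eqxx //.
by move=> W; rewrite inE !mem_enum in_setD1; case: eqP => // ->.
Qed.

Lemma partition_of_tiling j w : j <= n ->
  path meets (j, 0, 0) (rcons w (0, 0, 0)) -> all (fun u => u.1.1 < u.1.2) w ->
  let P := [set:: [seq seg u | u <- w]] in
  [/\ partition P (segment 0 j), [forall U in P, district U]
    & uniq [seq seg u | u <- w]].
Proof.
have [g fK gK] := f_bij.
elim: w j => [|[[a b] c] w IHw] j le_jn /=.
  rewrite andbT => /eqP /= -> _; split=> //.
    rewrite /partition; apply/and3P; split.
    - apply/eqP/setP => u; rewrite -(gK u) mem_segment andbF.
      by apply/bigcupP => -[W]; rewrite inE.
    - by apply/trivIsetP => W W'; rewrite inE.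
    - by rewrite inE.
  by apply/'forall_implyP => W; rewrite inE.
rewrite meets_path => /andP[/eqP /= <- pw] /andP[/= lt_aj lw].
have [|/and3P[/eqP covP trivP P0] dP uP] := IHw a _ pw lw; first by lia.
set P' := [set:: _] in covP trivP P0 dP.
have memP' W : (W \in [seq seg u | u <- w]) = (W \in P') by rewrite inE.
have nin : segment a j \notin P'.
  apply/negP => aP; have /subsetP sub : segment a j \subset cover P' by exact: bigcup_sup aP.
  have := sub (f (Ordinal (leq_trans lt_aj le_jn))).
  by rewrite covP !mem_segment /= leqnn ltnn => /(_ lt_aj).
have EP : [set:: segment a j :: [seq seg u | u <- w]] = segment a j |: P'.
  by apply/setP => W; rewrite !inE.
rewrite EP memP' nin uP; split=> //.
  apply/and3P; split.
  - by rewrite /cover bigcup_setU big_set1 -/(cover P') covP setUC -segment_cat // ltnW.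
  - apply/trivIsetP => A B; rewrite !in_setU1 => /predU1P[->|AP] /predU1P[->|BP] neq_AB.
    + by rewrite eqxx in neq_AB.
    + rewrite disjoint_sym; apply: disjointWl (segment_disjoint 0 j (leqnn a)).
      by rewrite -covP; exact: bigcup_sup BP.
    + apply: disjointWl (segment_disjoint 0 j (leqnn a)).
      by rewrite -covP; exact: bigcup_sup AP.
    + exact: (trivIsetP trivP).
  - by rewrite in_setU1 negb_or P0 andbT eq_sym segment_neq0 // lt_aj.
apply/'forall_implyP => W; rewrite in_setU1 => /predU1P[->|].
  by rewrite segment_district // lt_aj.
by have /'forall_implyP := dP; apply.
Qed.

End PathGraph.

(** * Distinct copies for the districts of each rival *)

Section Numbering.

Variables (S cc p : nat) (win : nat -> nat -> nat).

Local Notation colour u := (win u.1.1 u.1.2).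

(** A rival arc receives the number of arcs of the same winner after it in the list, so arcs with
    the same winner get distinct copies, all smaller than the number of these arcs. *)
Fixpoint number (w : seq (nat * nat * nat)) : seq (nat * nat * nat) :=
  if w is u :: w then
    (u.1, if rival p win u then count (fun v => colour v == colour u) w else 0) :: number w
  else [::].

Lemma number_fst w : [seq u.1 | u <- number w] = [seq u.1 | u <- w].
Proof. by elim: w => //= u w ->. Qed.

Lemma number_lt w v : v \in number w -> rival p win v ->
  v.2 < count (fun u => colour u == colour v) w.
Proof.
elim: w => //= u w IHw; rewrite inE => /predU1P[->|vw] rv /=.
  by rewrite /rival /= in rv *; rewrite rv eqxx add1n.
by apply: leq_trans (IHw vw rv) _; exact: leq_addl.
Qed.

Lemma number_copies_uniq w : (forall v, v \in number w -> v.2 < S) ->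
  uniq (copies S p win (number w)).
Proof.
elim: w => //= u w IHw ltS.
have {}IHw : uniq (copies S p win (number w)).
  by apply: IHw => v vw; apply: ltS; rewrite inE vw orbT.
rewrite /copies /=; case: ifP => ru //=; rewrite IHw andbT.
rewrite {1}/rival /= in ru.
apply/mapP => -[v]; rewrite mem_filter => /andP[rv vw]; rewrite /copy_index /=.
rewrite /rival ru => E.
have vS : v.2 < S by apply: ltS; rewrite inE vw orbT.
have uS : count (fun v => colour v == colour u) w < S.
  have := ltS (u.1, count (fun v => colour v == colour u) w).
  by rewrite inE {1}/rival ru eqxx; exact.
have E2 : count (fun v => colour v == colour u) w = v.2.
  by have := congr1 (modn^~ S) E; rewrite /= !modnMDl !modn_small.
have E1 : colour u = colour v.
  by move: E; rewrite E2 => /addIn/eqP; rewrite eqn_pmul2r ?(leq_ltn_trans _ vS) // => /eqP.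
have := number_lt vw rv; rewrite -E2.
by under eq_count => x do rewrite E1; rewrite ltnn.
Qed.

(** Pigeonhole: among arcs won by [q] the copy indices differ only in the copy, so distinct indices
    give distinct numbers below [cc]. *)
Lemma count_copies w q : q != p -> uniq (copies S p win w) ->
  all (fun u => if rival p win u then u.2 < cc else u.2 == 0) w ->
  count (fun u => colour u == q) w <= cc.
Proof.
move=> qp uw lt_cc; rewrite -size_filter.
pose s := [seq u <- w | colour u == q].
have us : uniq [seq u.2 | u <- s].
  have : subseq [seq copy_index S win u | u <- s] (copies S p win w).
    rewrite /copies; apply: map_subseq; rewrite subseq_filter filter_subseq andbT.
    by apply/allP => u; rewrite mem_filter => /andP[/eqP uq _]; rewrite /rival uq.
  move/subseq_uniq => /(_ uw).
  have -> : [seq copy_index S win u | u <- s] = map (addn (q * S)) [seq u.2 | u <- s].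
    rewrite -map_comp; apply/eq_in_map => u; rewrite mem_filter => /andP[/eqP uq _].
    by rewrite /= /copy_index uq.
  by rewrite map_inj_uniq //; exact: addnI.
rewrite -(size_map (fun u : nat * nat * nat => u.2) s) -[X in _ <= X](size_iota 0).
apply: uniq_leq_size => // c /mapP[u]; rewrite mem_filter => /andP[/eqP uq uw'] ->.
move/allP: lt_cc => /(_ _ uw'); rewrite /rival uq qp.
by rewrite mem_iota.
Qed.

End Numbering.

Lemma meets_path_fst x w : path meets x w =
  path (fun a b : nat * nat => a.1 == b.2) x.1 [seq u.1 | u <- w].
Proof. by rewrite path_map. Qed.

(** * Positive instances and arc paths with distinct copies *)

Section YesInstance.

Variable I : instance.
Variable f : 'I_(nvoters I) -> 'I_(nvoters I).
Hypothesis f_bij : bijective f.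
Hypothesis f_adj : forall i j : 'I_(nvoters I),
  adj (f i) (f j) = (i.+1 == j :> nat) || (j.+1 == i :> nat).
Variable eta : {set 'I_(nvoters I)} -> 'I_(ncands I).
Variables (S : nat) (win : nat -> nat -> nat).
Hypothesis winE : forall i j, i < j <= nvoters I -> win i j = eta (segment f i j).

Local Notation n := (nvoters I).
Local Notation p := (nat_of_ord (target I)).
Local Notation cc := (nwins I - 1).

Lemma card_eta (P : {set {set 'I_(nvoters I)}}) w q :
  perm_eq [seq segment f u.1.1 u.1.2 | u <- w] (enum P) ->
  all (fun u => u.1.1 < u.1.2 <= n) w ->
  #|[set U in P | eta U == q]| = count (fun u : nat * nat * nat => win u.1.1 u.1.2 == q) w.
Proof.
move=> wP lw; rewrite cardE.
transitivity (count (fun U => eta U == q) (enum P)).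
  rewrite -size_filter; apply: perm_size; apply: uniq_perm; first exact: enum_uniq.
    by apply: filter_uniq; exact: enum_uniq.
  by move=> U; rewrite mem_enum inE [in RHS]mem_filter mem_enum andbC.
have /seq.permP -> : perm_eq (enum P) [seq segment f u.1.1 u.1.2 | u <- w] by rewrite perm_sym.
rewrite count_map; apply: eq_in_count => u /(allP lw) uP /=.
by rewrite winE.
Qed.

Lemma segment_full : segment f 0 n = [set: 'I_(nvoters I)].
Proof.
have [g fK gK] := f_bij.
by apply/setP => u; rewrite -(gK u) mem_segment // inE ltn_ord.
Qed.

Lemma path_le_n w : path meets (n, 0, 0) w -> all (fun u => u.1.1 < u.1.2) w ->
  all (fun u => u.1.1 < u.1.2 <= n) w.
Proof.
move=> pw lw; have := order_path_min gt_end_trans (path_decreasing pw lw).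
move=> /allP mw; apply/allP => u uw; rewrite (allP lw _ uw) /=.
exact: mw.
Qed.

(** A partition gives a tiling, whose arcs are then numbered; conversely the arcs of a path give the
    districts. The number of rival arcs being prescribed, the target wins exactly the remaining
    ones. *)
Lemma yes_solvable : nwins I <= ndistr I -> nwins I <= S -> yes_instance eta <->
  solvable S cc p win (ndistr I) (ndistr I - nwins I) n.
Proof.
move=> wk wS; split.
  case=> P [/andP[partP distP] szP pP qP].
  have [|w [pw lw wP]] := tiling_of_partition f_bij f_adj (leqnn n) _ distP.
    by rewrite segment_full.
  have lw' : all (fun u => u.1.1 < u.1.2 <= n) w.
    by apply: path_le_n => //; move: pw; rewrite -cats1 cat_path => /andP[].
  have cntE q : count (fun u => win u.1.1 u.1.2 == q) w =
     if q < ncands I then #|[set U in P | nat_of_ord (eta U) == q]| else 0.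
    case: ifP => [lt_q|nlt_q].
      rewrite -[q]/(nat_of_ord (Ordinal lt_q)) -(card_eta _ wP lw').
      by apply: eq_card => U; rewrite !inE.
    rewrite -(count_pred0 w); apply: eq_in_count => u /(allP lw') uP.
    by rewrite winE //; apply: contraFF nlt_q => /eqP <-.
  have sw : size w = ndistr I by rewrite -szP cardE -(perm_size wP) size_map.
  have cp : count (fun u => win u.1.1 u.1.2 == p) w = nwins I.
    rewrite cntE ltn_ord -pP; apply: eq_card => U; rewrite !inE.
    by case: (eqVneq (eta U) (target I)) => [->|ne]; rewrite ?eqxx // val_eqE (negbTE ne).
  have cq q : q != p -> count (fun u => win u.1.1 u.1.2 == q) w <= cc.
    move=> qp; rewrite cntE; case: ifP => // lt_q.
    have /qP : Ordinal lt_q != target I by rewrite -val_eqE.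
    by apply: leq_trans; apply: eq_leq; apply: eq_card => U; rewrite !inE.
  have numP v : v \in number p win w ->
      if rival p win v then v.2 < cc else v.2 == 0.
    move=> vw; case: ifP => rv; first by rewrite (leq_trans (number_lt vw rv)) // cq.
    move: vw rv; elim: (w) => //= u w' IHw; rewrite inE => /predU1P[->|/IHw //].
    by rewrite /rival /= => ->.
  apply/hasP; exists (number p win w).
    apply/pathsP; split.
    - move: pw; rewrite !meets_path_fst !map_rcons; by rewrite number_fst.
    - move: lw; rewrite -!(all_map (fun u : nat * nat * nat => u.1) (fun a => a.1 < a.2)).
      by rewrite number_fst.
    - by rewrite -(size_map (fun u : nat * nat * nat => u.1)) number_fst size_map.
    - have -> : count (rival p win) (number p win w) = count (rival p win) w.
        by rewrite -[LHS](count_map (fun u : nat * nat * nat => u.1) (fun a => win a.1 a.2 != p)) number_fst count_map.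
      by have := count_predC (fun u => win u.1.1 u.1.2 == p) w; rewrite cp sw => <-; rewrite addKn.
    - by apply/allP => v /numP.
  apply: number_copies_uniq => v /numP; case: rival => [|/eqP ->]; have := nwins_gt0 I; lia.
case/hasP => w /pathsP[pw lw sw cw kw] uw.
have [partP distP uP] := partition_of_tiling f_bij f_adj (leqnn n) pw lw.
have lw' : all (fun u => u.1.1 < u.1.2 <= n) w.
  by apply: path_le_n => //; move: pw; rewrite -cats1 cat_path => /andP[].
rewrite segment_full in partP.
set P := [set:: _] in partP distP.
have wP : perm_eq [seq segment f u.1.1 u.1.2 | u <- w] (enum P).
  by apply: uniq_perm; rewrite ?enum_uniq // => U; rewrite mem_enum inE.
exists P; split.
- by rewrite partP.
- by rewrite cardE -(perm_size wP) size_map.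
- have -> : #|[set U in P | eta U == target I]| = count (fun u => win u.1.1 u.1.2 == p) w.
    rewrite -(card_eta _ wP lw'); apply: eq_card => U; rewrite !inE.
    by rewrite -val_eqE.
  have := count_predC (fun u => win u.1.1 u.1.2 == p) w; rewrite sw.
  have -> : count (predC (fun u => win u.1.1 u.1.2 == p)) w = count (rival p win) w by [].
  by rewrite cw -{2}(subnKC wk) => /addIn.
move=> q qp; have -> : #|[set U in P | eta U == q]| = count (fun u => win u.1.1 u.1.2 == q) w.
  rewrite -(card_eta _ wP lw'); apply: eq_card => U; rewrite !inE.
  by rewrite -val_eqE.
by apply: count_copies uw kw; rewrite val_eqE.
Qed.

(** Justifies the factor [flag] of the result: outside these bounds the instance is negative.
    Districts are nonempty and disjoint, so there are at most as many as voters. *)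
Lemma yes_bounds : yes_instance eta -> ndistr I <= n /\ nwins I <= ndistr I.
Proof.
case=> P [/andP[partP _] szP pP _]; split; last first.
  rewrite -szP -pP; apply: subset_leq_card; apply/subsetP => U; by rewrite inE => /andP[].
have /and3P[/eqP covP trivP P0] := partP.
rewrite -szP -[X in _ <= X]card_ord -cardsT -covP -(eqP trivP).
rewrite -sum1_card; apply: leq_sum => U UP; rewrite card_gt0.
by apply: contraNneq P0 => <-.
Qed.

End YesInstance.

(** * Traversing the path *)

Lemma sum_delta n (a : nat) (g : nat -> nat) :
  \sum_(s < n) (a == s :> nat) * g s = (a < n) * g a.
Proof.
have [lt_an|le_na] := ltnP a n.
  rewrite (bigD1 (Ordinal lt_an)) //= eqxx big1 => [|s ne]; first by rewrite addn0.
  by rewrite eq_sym (negbTE (ne : val s != a)).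
rewrite big1 // => s _; case: eqP => // E.
by have := ltn_ord s; rewrite -E ltnNge le_na.
Qed.

Section Traversal.

Variables (n : nat) (A : nat -> nat -> nat).

Definition degree v := \sum_(u < n) A v u.

Definition neighbour_sum v := \sum_(u < n) A v u * u.

(** A prefix scan, so that each cell of the array depends only on the preceding one; it keeps the
    largest vertex below [t] of degree at most 1. *)
Fixpoint endpoint t : nat :=
  if t is t.+1 then if degree t <= 1 then t else endpoint t else 0.

(* On a path the sum of the neighbours of a vertex, minus its predecessor, is *)
(* its successor.                                                              *)
Fixpoint traversal_pair t : nat * nat :=
  if t is t.+1 then
    let: (u, v) := traversal_pair t in (v, neighbour_sum v - u)
  else (endpoint n, neighbour_sum (endpoint n)).

Definition traversal t := (traversal_pair t).1.

Lemma traversal0 : traversal 0 = endpoint n. Proof. by []. Qed.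

Lemma traversal1 : traversal 1 = neighbour_sum (endpoint n). Proof. by []. Qed.

Lemma traversalSS t : traversal t.+2 = neighbour_sum (traversal t.+1) - traversal t.
Proof. by rewrite /traversal /=; case: traversal_pair. Qed.

End Traversal.

Section PathTraversal.

Variables (n : nat) (e : rel 'I_n) (A : nat -> nat -> nat).
Hypothesis AE : forall u v : 'I_n, A u v = e u v.

Definition labelling (f : 'I_n -> 'I_n) : Prop := bijective f /\
  forall i j : 'I_n, e (f i) (f j) = (i.+1 == j :> nat) || (j.+1 == i :> nat).

Definition label (f : 'I_n -> 'I_n) (t : nat) : nat :=
  if insub t is Some s then val (f s) else 0.

Lemma labelE f (t : 'I_n) : label f t = f t.
Proof. by rewrite /label valK. Qed.

Lemma sum_neighbours f (t : 'I_n) (g : nat -> nat) : labelling f ->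
  \sum_(u < n) A (f t) u * g u =
  (t.+1 < n) * g (label f t.+1) + (0 < t) * g (label f t.-1).
Proof.
case=> f_bij f_adj; rewrite (reindex f); last exact: onW_bij.
rewrite -(sum_delta n t.+1 (fun s => g (label f s))).
have -> : (0 < t) * g (label f t.-1) =
    \sum_(s < n) ((0 < t) && (t.-1 == s :> nat)) * g (label f s).
  case: ltnP => [t0|_]; last by rewrite big1.
  rewrite (sum_delta n t.-1 (fun s => g (label f s))).
  by rewrite (leq_ltn_trans (leq_pred t)).
rewrite -big_split; apply: eq_bigr => s _ /=.
rewrite AE f_adj -mulnDl labelE; congr (_ * _); lia.
Qed.

Lemma degree_label f (t : 'I_n) : labelling f ->
  degree n A (f t) = (t.+1 < n) + (0 < t).
Proof.
move=> f_lab; have := sum_neighbours t (fun=> 1) f_lab; rewrite !muln1 => <-.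
by apply: eq_bigr => u _; rewrite muln1.
Qed.

Lemma endpointP v t : v < t -> degree n A v <= 1 ->
  endpoint n A t < t /\ degree n A (endpoint n A t) <= 1.
Proof.
elim: t => //= t IHt lt_vt dv; case: ifP => [//|dt].
move: lt_vt; rewrite ltnS leq_eqVlt => /predU1P[Ev|lt_vt].
  by rewrite -Ev dv in dt.
by have [? ?] := IHt lt_vt dv; split=> //; exact: ltnW.
Qed.

Lemma traversal_labelling f : 0 < n -> labelling f ->
  exists2 h, labelling h & forall t : 'I_n, traversal n A t = h t.
Proof.
move=> n0 f_lab; pose z : 'I_n := Ordinal n0.
have [|lt_n deg1] := @endpointP (f z) n (ltn_ord _).
  by rewrite degree_label //= addn0 leq_b1.
have [h h_lab hz] : exists2 h, labelling h & endpoint n A n = h z.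
  have [[g fK gK] f_adj] := f_lab; pose s := g (Ordinal lt_n).
  have fs : endpoint n A n = f s by rewrite gK.
  rewrite fs degree_label // in deg1.
  case: (posnP s) => [s0|s_gt0]; first by exists f; rewrite // fs; congr (nat_of_ord (f _)); apply/val_inj.
  have sn : s.+1 = n.
    by apply/eqP; rewrite eqn_leq ltn_ord leqNgt; move: deg1; rewrite s_gt0; case: ltnP.
  (* The scan has found the last vertex of [f]; the reversed labelling starts there. *)
  exists (f \o @rev_ord n)%FUN; first split.
  - by apply: bij_comp; [case: f_lab|exists (@rev_ord n); exact: rev_ordK].
  - by move=> i j; rewrite /= f_adj /=; have := ltn_ord i; have := ltn_ord j; lia.
  rewrite fs /=; congr (nat_of_ord (f _)); apply/val_inj => /=; lia.
exists h => // t.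
have nsum (s : 'I_n) : neighbour_sum n A (h s) =
    (s.+1 < n) * label h s.+1 + (0 < s) * label h s.-1.
  exact: sum_neighbours s id h_lab.
suff [] : traversal n A t = label h t /\ (t.+1 < n -> traversal n A t.+1 = label h t.+1).
  by rewrite labelE.
have := ltn_ord t; elim: (val t) => [|s IHs] lt_s.
  rewrite traversal0 traversal1 hz nsum /= addn0; split=> [|->]; last by rewrite mul1n.
  by rewrite -[0]/(val z) labelE.
have [E1 E2] := IHs (ltnW lt_s); split; first exact: E2.
move=> lt_s2; rewrite traversalSS E1 E2 //.
by rewrite -[s.+1]/(val (Ordinal lt_s)) [label h (val _)]labelE nsum /= lt_s2 !mul1n addnK.
Qed.

End PathTraversal.

(** * The program *)

Declare Scope expr_scope.
Delimit Scope expr_scope with E.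
Bind Scope expr_scope with expr.
Lemma sub_divn m d : m - m %/ d * d = m %% d.
Proof. by rewrite {1}(divn_eq m d) addKn. Qed.

Lemma sub_le a b : 1 - (a - b) = (a <= b).
Proof. by case: leqP; lia. Qed.

Lemma sub_eq a b : 1 - ((a - b) + (b - a)) = (a == b).
Proof. by case: eqP; lia. Qed.

Lemma ltn_mulD i a j b : i < a -> j < b -> i * b + j < a * b.
Proof. by move=> ia jb; rewrite -ltn_divLR ?divnMDl ?divn_small ?addn0 //; lia. Qed.

Lemma window_lt i j n u : i <= u < i + (j - i) * (j <= n) -> u < n.
Proof. by case: (leqP j n); lia. Qed.

Lemma leq_exp35 m : 0 < m -> m * m * m <= m * m * m * m * m.
Proof. by move=> m0; rewrite -[X in _ <= X]mulnA leq_pmulr // muln_gt0 m0. Qed.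

Lemma ltn_array base u N top t : u < N -> base + N <= top -> base + u < top + t.
Proof. by lia. Qed.

Definition testE := (sub_divn, sub_eq, sub_le).

Section ProgramText.
Local Notation "a + b" := (EOp Add a b) : expr_scope.
Local Notation "a - b" := (EOp Sub a b) : expr_scope.
Local Notation "a * b" := (EOp Mul a b) : expr_scope.
Local Notation "a / b" := (EOp Div a b) : expr_scope.
Local Notation "# c" := (ECst c) (at level 2, format "# c") : expr_scope.
Local Notation "$ r" := (EVar r) (at level 2, format "$ r") : expr_scope.
Local Notation "! a" := (EMem a) (at level 2, right associativity, format "! a") : expr_scope.
Local Notation "a 'mod' b" := (a - a / b * b)%E (at level 40) : expr_scope.
Local Notation "a 'le' b" := (#1 - (a - b))%E (at level 55) : expr_scope.
Local Notation "a 'eq' b" := (#1 - ((a - b) + (b - a)))%E (at level 55) : expr_scope.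
Local Open Scope expr_scope.

(* Registers 0-4 hold n, |C|, p, k, k*; 5 tells whether k* <= k <= n, and 6, 7   *)
(* are k, k* if it does, else 0; 8 is l = k - k*, 9 the number k* - 1 of copies  *)
(* of a rival, 10 the strict bound S on n, |C|, k; 11 the number d of coins per  *)
(* weight, 12 is b, where 2 ^ b stands for the indeterminate, 13 the number of   *)
(* digits tested; 14-20 and 22 are the bases of the arrays, and 21 is 2 ^ l.     *)

Definition scan_expr := let t := $15 in
  let deg := ESum $0 !(#5 + (t - #1) * $0 + $16) in
  (#1 le t) * ((deg le #1) * (t - #1) + (#1 - (deg le #1)) * !($14 + (t - #1))).

Definition order_expr := let t := $16 in
  let nbs := ESum $0 (!(#5 + !($15 + (t - #1)) * $0 + $17) * $17) in
  (t eq #0) * !($14 + $0) + (#1 le t) * (nbs - (#2 le t) * !($15 + (t - #2))).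

(** A segment occupies consecutive cells of the traversal array, so the oracle can be queried on
    them in place. The factor testing the right end against n empties the query when the segment
    would leave the path. *)
Definition winner_expr := let t := $17 in
  EAsk ($15 + t / $10) ((t mod $10 - t / $10) * (t mod $10 le $0)).

Definition power_expr := let t := $18 in
  (t eq #0) + (#1 le t) * (#2 * !($17 + (t - #1))).

Definition word_expr := let t := $20 in
  ESum $11 (!($18 + (t * $11 + $21)) * !($17 + $12 * $21)).

(** The digits of [t] in base S are, from the top, the mask L, the end j, the number a of arcs and
    the number r of rival arcs. As j comes before a and r, the recurrence, which refers to some i <
    j, only reads cells written earlier. *)
Definition path_expr := let t := $22 in
  let r := t mod $10 in let a := t / $10 mod $10 in
  let j := t / ($10 * $10) mod $10 in let L := t / ($10 * $10 * $10) in
  let i := $23 in let c := $24 in let k := $25 in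
  let q := !($16 + (i * $10 + j)) in
  let cell a r := !($20 + (((L * $10 + i) * $10 + a) * $10 + r)) in
  let arc := ESum $9 (!($19 + ((i * $10 + j) * $10 + c)) *
    ESum $8 ((L / !($17 + k) mod #2) * !($17 + $12 * ((q * $10 + c) * k)))) in
  (a eq #0) * ((r eq #0) * (j eq #0)) + (#1 le a) *
    ESum j ((q eq $2) * (!($19 + (i * $10 + j) * $10) * cell (a - #1) r)
      + (#1 - (q eq $2)) * ((#1 le r) * (arc * cell (a - #1) (r - #1)))).

Definition total_expr := let t := $23 in
  (#1 le t) * (!($22 + (t - #1)) +
    !($20 + ((((t - #1) * $10 + $0) * $10 + $6) * $10 + $8))).

Definition result_expr :=
  $5 * ESum $13 (!($22 + $21) / !($17 + $12 * $23) mod #2).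

Definition program : seq stm :=
  [:: SLet !#0; SLet !#1; SLet !#2; SLet !#3; SLet !#4;
      SLet (($3 le $0) * ($4 le $3)); SLet ($3 * $5); SLet ($4 * $5);
      SLet ($6 - $7); SLet ($7 - #1);
      SLet ($0 + $1 + #4); SLet (#4 * $10); SLet ($10 * $10 * $10);
      SLet ($10 * $10 * $10 * $10 * $10);
      SLet (#5 + $0 * $0 + $0 * $1); SFill 14 ($0 + #1) scan_expr;
      SLet ($14 + ($0 + #1)); SFill 15 $0 order_expr;
      SLet ($15 + $0); SFill 16 ($10 * $10) winner_expr;
      SLet ($16 + $10 * $10); SFill 17 ($12 * $13 + #1) power_expr;
      SLet ($17 + ($12 * $13 + #1)); SCoin 18 ($12 * $11);
      SLet ($18 + $12 * $11); SFill 19 $12 word_expr;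
      SLet ($19 + $12); SLet !($17 + $8); SFill 20 ($21 * $12) path_expr;
      SLet ($20 + $21 * $12); SFill 22 ($21 + #1) total_expr;
      SLet result_expr].

End ProgramText.

(** All variables of the program lie below register 40, where scratch space starts. The verdict is
    computed in register 23 and copied to register 0, where the output is read. *)
Definition algorithm : cmd :=
  Seq (compile_prog 40 0 program) (Seq (Const 0 0) (Arith Add 0 0 23)).

Ltac simpl_eval := simpl; unfold update; simpl.

(** * The expressions of the program compute the intended arrays *)

Section Evaluation.

Variables (O : seq nat -> nat) (M : nat -> nat) (X : nat) (cs : seq bool).
Variables (n C p k w flag kk ks l cc S d b E Lc b0 b1 b2 b3 b4 b5 b6 b7 : nat).
Variables (win Adj : nat -> nat -> nat).

Hypotheses (flagE : flag = (k <= n) * (w <= k)).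
Hypotheses (kkE : kk = k * flag) (ksE : ks = w * flag) (lE : l = kk - ks) (ccE : cc = ks - 1).
Hypotheses (SE : S = n + C + 4) (dE : d = 4 * S) (bE : b = S * S * S).
Hypotheses (EE : E = S * S * S * S * S) (LcE : Lc = 2 ^ l).
Hypotheses (b0E : b0 = 5 + n * n + n * C) (b1E : b1 = b0 + (n + 1)) (b2E : b2 = b1 + n).
Hypotheses (b3E : b3 = b2 + S * S) (b4E : b4 = b3 + (b * E + 1)) (b5E : b5 = b4 + b * d).
Hypotheses (b6E : b6 = b5 + b) (b7E : b7 = b6 + Lc * b).
Hypotheses (n_gt0 : 0 < n) (C_gt0 : 0 < C).

Let word u : nat := sample (R := nat) d (2 ^ b)%N (coin_word d cs u).
Let sums L a r j : nat := path_sum (R := nat) S cc p win l word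
  (fun t i => ((2 ^ b)%N ^+ (t * i))%R) L a r j.

Hypothesis M_adj : forall u v, u < n -> v < n -> M (5 + u * n + v) = Adj u v.
Hypothesis M_scan : forall t, t < n + 1 -> M (b0 + t) = endpoint n Adj t.
Hypothesis M_order : forall t, t < n -> M (b1 + t) = traversal n Adj t.
Hypothesis M_win : forall t, t < S * S -> M (b2 + t) = win (t %/ S) (t %% S).
Hypothesis M_pow : forall t, t < b * E + 1 -> M (b3 + t) = 2 ^ t.
Hypothesis M_coins : forall t, t < b * d -> M (b4 + t) = nth false cs t.
Hypothesis M_words : forall u, u < b -> M (b5 + u) = word u.
Hypothesis M_sums : forall t, t < Lc * b -> M (b6 + t) =
  sums (t %/ (S * S * S)) (t %/ S %% S) (t %% S) (t %/ (S * S) %% S).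
Hypothesis M_total : forall t, t < Lc + 1 ->
  M (b7 + t) = \sum_(L < t) sums L kk l n.
Hypothesis win_lt : forall i j, win i j < S.
Hypothesis winE : forall i j,
  win i j = O [seq traversal n Adj t | t <- iota i ((j - i) * (j <= n))].

Let regs := [:: n; C; p; k; w; flag; kk; ks; l; cc; S; d; b; E; b0; b1; b2; b3; b4; b5; b6; Lc; b7].

Let S6 : 5 < S. Proof. lia. Qed.

Lemma eval_scan t m : t < n + 1 -> agree M (b0 + t) m ->
  eval O m (update (nth 0 (take 15 regs)) 15 t) 16 scan_expr = M (b0 + t).
Proof.
move=> lt_t mM; rewrite M_scan //; simpl_eval; rewrite !testE.
case: t lt_t mM => [|t] lt_t mM; first by rewrite mul0n.
have degE : \sum_(i < n) m (5 + (t.+1 - 1) * n + i) = degree n Adj t.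
  have lt_tn : t < n by rewrite addn1 in lt_t.
  apply: eq_bigr => i _; rewrite subn1 /= mM ?M_adj // b0E.
  by have := ltn_mulD lt_tn (ltn_ord i); lia.
rewrite degE subn1 /= ; case: leqP => _ /=; rewrite ?mul1n ?mul0n ?addn0 //.
rewrite mM; last by lia.
rewrite M_scan //; lia.
Qed.

Lemma eval_order t m : (forall t', t' < n -> traversal n Adj t' < n) ->
  t < n -> agree M (b1 + t) m ->
  eval O m (update (nth 0 (take 16 regs)) 16 t) 17 order_expr = M (b1 + t).
Proof.
move=> trav_lt lt_t mM; rewrite M_order //; simpl_eval; rewrite !testE.
have nbsE v : v < n -> \sum_(i < n) m (5 + v * n + i) * i = neighbour_sum n Adj v.
  move=> lt_v; apply: eq_bigr => i _; rewrite mM ?M_adj // b1E b0E.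
  by have := ltn_mulD lt_v (ltn_ord i); lia.
case: t lt_t mM => [|[|t]] lt_t mM.
- by rewrite /= mul1n mul0n addn0 mM ?M_scan ?traversal0 //; lia.
- rewrite subn1 /= mul0n !mul1n mul0n subn0 traversal1 addn0 mM ?addn0; last lia.
  have -> : M b1 = endpoint n Adj n by rewrite -[b1]addn0 M_order.
  by rewrite nbsE // -traversal0 trav_lt.
rewrite subn1 subn2 /= mul0n !mul1n traversalSS !mM; try lia.
by rewrite !M_order ?nbsE ?trav_lt //; lia.
Qed.

Lemma eval_winner t m : t < S * S -> agree M (b2 + t) m ->
  eval O m (update (nth 0 (take 17 regs)) 17 t) 18 winner_expr = M (b2 + t).
Proof.
move=> lt_t mM; rewrite M_win //; simpl_eval; rewrite !testE winE.
congr O; set i := t %/ S; set j := t %% S.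
have -> : iota (b1 + i) ((j - i) * (j <= n)) = map (addn b1) (iota i ((j - i) * (j <= n))).
  by rewrite -iotaDl.
rewrite -map_comp; apply/eq_in_map => u; rewrite mem_iota /= => uP.
have un : u < n by exact: window_lt uP.
by rewrite mM ?M_order //; lia.
Qed.

Lemma eval_power t m : t < b * E + 1 -> agree M (b3 + t) m ->
  eval O m (update (nth 0 (take 18 regs)) 18 t) 19 power_expr = M (b3 + t).
Proof.
move=> lt_t mM; rewrite M_pow //; simpl_eval; rewrite !testE.
case: t lt_t mM => [|t] lt_t mM; first by rewrite mul0n.
by rewrite add0n mul1n subn1 /= mM ?M_pow ?expnS //; lia.
Qed.

Let S0 : 0 < S. Proof. by rewrite (leq_trans _ S6). Qed.

Let lS : l < S.
Proof.
rewrite SE lE kkE (leq_ltn_trans (leq_subr _ _)) // flagE.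
by case: (leqP k n) => kn; rewrite ?mul0n ?muln0 ?mul1n; [case: (w <= k)|]; lia.
Qed.

Let kkS : kk < S.
Proof.
rewrite SE kkE flagE.
by case: (leqP k n) => kn; rewrite ?mul0n ?muln0 ?mul1n; [case: (w <= k)|]; lia.
Qed.

Let ccS : cc < S.
Proof.
rewrite SE ccE ksE flagE.
by case: (leqP k n) => kn; case: (leqP w k) => wk; rewrite ?muln0 ?muln1; lia.
Qed.

Let nS : n < S. Proof. by rewrite SE; lia. Qed.

Let ld : l <= d. Proof. by rewrite dE (leq_trans (ltnW lS)) // leq_pmull. Qed.

Lemma pow_index t i : t < S * S -> i < l -> b * (t * i) < b * E + 1.
Proof.
move=> lt_t lt_i; rewrite addn1 ltnS leq_mul2l EE; apply/orP; right.
apply: leq_trans (leq_exp35 S0); apply: leq_mul; first exact: ltnW.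
by rewrite ltnW // (ltn_trans lt_i).
Qed.

Lemma word_index i : i < d -> b * i < b * E + 1.
Proof.
move=> lt_i; rewrite addn1 ltnS leq_mul2l EE; apply/orP; right.
apply: leq_trans (leq_exp35 S0); apply: leq_trans (ltnW lt_i) _.
by rewrite dE leq_mul2r (leq_trans (_ : 4 <= S * 1)) ?leq_mul2l ?S0 ?orbT //; lia.
Qed.

Let le35 : b3 + (b * E + 1) <= b5. Proof. by rewrite b5E b4E leq_addr. Qed.
Let le36 : b3 + (b * E + 1) <= b6. Proof. by rewrite b6E (leq_trans le35) ?leq_addr. Qed.
Let le26 : b2 + S * S <= b6. Proof. by rewrite -b3E (leq_trans _ le36) ?leq_addr. Qed.
Let le37 : b3 + (b * E + 1) <= b7. Proof. by rewrite b7E (leq_trans le36) ?leq_addr. Qed.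

Lemma eval_word u m : u < b -> agree M (b5 + u) m ->
  eval O m (update (nth 0 (take 20 regs)) 20 u) 21 word_expr = M (b5 + u).
Proof.
move=> lt_u mM; rewrite M_words //; simpl_eval.
apply: eq_bigr => i _; have lt_i := ltn_ord i.
have lt_ud : u * d + i < b * d by exact: ltn_mulD.
have lt_bi := word_index lt_i.
rewrite !mM ?(ltn_array _ lt_ud) ?(ltn_array _ lt_bi) -?b5E //.
rewrite M_coins // M_pow // natn natrXE expnM; congr (nat_of_bool _ * _).
by rewrite nth_take // nth_drop.
Qed.

Lemma eval_path t m : t < Lc * b -> agree M (b6 + t) m ->
  eval O m (update (nth 0 (take 22 regs)) 22 t) 23 path_expr = M (b6 + t).
Proof.
move=> lt_t mM; rewrite M_sums //; simpl_eval; rewrite !testE.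
set L := t %/ (S * S * S); set a := (t %/ S) %% S; set r := t %% S.
set j := (t %/ (S * S)) %% S.
have aS : a < S by rewrite ltn_mod.
have rS : r < S by rewrite ltn_mod.
have jS : j < S by rewrite ltn_mod.
have tE : t = ((L * S + j) * S + a) * S + r.
  rewrite {1}(divn_eq t S); congr (_ * _ + _).
  rewrite {1}(divn_eq (t %/ S) S); congr (_ * _ + _).
  by rewrite -divnMA {1}(divn_eq (t %/ (S * S)) S) -divnMA.
case: (posnP a) => [a0|a_gt0].
  rewrite /sums a0 /= mul0n addn0 natn mul1n.
  by case: (r == 0); case: (j == 0).
have [a' aE] : exists a', a = a'.+1 by exists a.-1; rewrite prednK.
rewrite aE /= mul0n add0n mul1n subn1 /=.
have a'S : a' < S by rewrite ltnW // -aE.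
apply: eq_bigr => i _.
have iS : i < S by exact: ltn_trans jS.
have lt_ij : i * S + j < S * S by exact: ltn_mulD.
have lt_word c : c < S -> (i * S + j) * S + c < b by rewrite bE; exact: ltn_mulD.
have Mwin : m (b2 + (i * S + j)) = win i j.
  rewrite mM ?(ltn_array _ lt_ij) //.
  by rewrite M_win // divnMDl // divn_small // addn0 modnMDl modn_small.
have Mword c : c < S -> m (b5 + ((i * S + j) * S + c)) = word ((i * S + j) * S + c).
  by move=> cS; rewrite mM ?M_words ?(ltn_array _ (lt_word c cS)) -?b6E ?lt_word.
(* The cell read has the same mask and [i < j] as its next digit, hence a smaller address than
   [t]. *)
have Mcell r' : r' < S -> m (b6 + (((L * S + i) * S + a') * S + r')) = sums L a' r' i.
  move=> r'S; set u := (_ * S + r').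
  have lt_ut : u < t.
    rewrite {1}tE /u; apply: leq_trans (leq_addr _ _).
    rewrite -ltn_divLR // divnMDl // divn_small // addn0.
    apply: leq_trans (leq_addr _ _).
    rewrite -ltn_divLR // divnMDl // divn_small // addn0 ltn_add2l; exact: ltn_ord.
  have u1 : u %/ S = (L * S + i) * S + a' by rewrite divnMDl // divn_small // addn0.
  have u2 : u %/ (S * S) = L * S + i by rewrite divnMA u1 divnMDl // divn_small // addn0.
  rewrite mM ?ltn_add2l // M_sums; last exact: ltn_trans lt_t.
  rewrite (divnMA u (S * S)) u2 u1 divnMDl // divn_small // addn0.
  by rewrite !modnMDl !modn_small.
rewrite !testE Mwin.
case: eqP => [_|_]; rewrite ?mul1n ?mul0n ?addn0 ?add0n ?subn0.
  rewrite -[(i * S + j) * S]addn0 Mword ?S0 // Mcell //.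
case: r rS {tE} => [|r] rS; first by rewrite mul0n.
rewrite subn1 /= mul1n Mcell; last exact: ltnW.
congr (_ * _)%R; apply: eq_bigr => c _.
have cS : c < S by exact: ltn_trans (ltn_ord c) ccS.
rewrite Mword //; congr (_ * _)%R; apply: eq_bigr => i' _.
have i'l := ltn_ord i'.
rewrite !testE natn natrXE -expnM.
have lt_q : win i j * S + c < S * S by exact: ltn_mulD.
have lt_p := pow_index lt_q i'l.
have lt_i' : i' < b * E + 1.
  apply: leq_ltn_trans (word_index (leq_trans i'l ld)).
  by rewrite leq_pmull // bE !muln_gt0 S0.
by rewrite !mM ?M_pow ?(ltn_array _ lt_p) ?(ltn_array _ lt_i').
Qed.

Lemma eval_total t m : t < Lc + 1 -> agree M (b7 + t) m ->
  eval O m (update (nth 0 (take 23 regs)) 23 t) 24 total_expr = M (b7 + t).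
Proof.
move=> lt_t mM; rewrite M_total //; simpl_eval; rewrite !testE.
case: t lt_t mM => [|t] lt_t mM; first by rewrite mul0n big_ord0.
have lt_t' : t < Lc + 1 by exact: ltnW.
rewrite mul1n subn1 /= mM ?M_total ?ltn_add2l //.
rewrite big_ord_recr; congr (_ + _)%R.
set u := (((t * S + n) * S + kk) * S + l).
have u1 : u %/ S = (t * S + n) * S + kk by rewrite divnMDl // divn_small // addn0.
have u2 : u %/ (S * S) = t * S + n by rewrite divnMA u1 divnMDl // divn_small // addn0.
have u3 : u %/ (S * S * S) = t by rewrite divnMA u2 divnMDl // divn_small // addn0.
have lt_u : u < Lc * b by rewrite bE -ltn_divLR ?muln_gt0 ?S0 // u3 -(ltn_add2r 1) addn1.
rewrite mM ?(ltn_array _ lt_u) -?b7E //.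
by rewrite M_sums // u3 u2 u1 !modnMDl !modn_small.
Qed.

Lemma eval_result m : agree M (b7 + (Lc + 1)) m ->
  eval O m (nth 0 regs) 23 result_expr =
  flag * \sum_(i < E) ((\sum_(L < Lc) sums L kk l n) %/ (2 ^ b) ^ i) %% 2.
Proof.
move=> mM; simpl_eval; congr (_ * _); apply: eq_bigr => i _; rewrite !testE.
have lt_bi : b * i < b * E + 1 by rewrite addn1 ltnS leq_mul2l ltnW ?orbT.
by rewrite !mM ?M_total ?M_pow ?expnM ?(ltn_array _ lt_bi) ?addn1 //; lia.
Qed.

Hypotheses (X_ge : S ^ 9 <= X) (bits_k : bitlen k <= X) (bits_w : bitlen w <= X).
Hypotheses (p_lt : p < C) (O_lt : forall s, O s < C).
Hypotheses (M0 : M 0 = n) (M1 : M 1 = C) (M2 : M 2 = p) (M3 : M 3 = k) (M4 : M 4 = w).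
Hypothesis M_bits : forall a, a < b7 + (Lc + 1) -> bitlen (M a) <= X.
Hypothesis traversal_lt : forall t, t < n -> traversal n Adj t < n.
Hypothesis size_cs : size cs = b * d.

Let pow6 i : 6 * S ^ i <= S ^ i.+1. Proof. by rewrite expnS leq_mul2r S6 orbT. Qed.

Let b3S : b = S ^ 3. Proof. by rewrite bE !expnS expn0 muln1 mulnA. Qed.
Let E5S : E = S ^ 5. Proof. by rewrite EE !expnS expn0 muln1 !mulnA. Qed.
Let bE8 : b * E = S ^ 8. Proof. by rewrite b3S E5S -expnD. Qed.
Let bd4 : b * d = 4 * S ^ 4. Proof. by rewrite b3S dE mulnCA -expnSr. Qed.
Let SS2 : S * S = S ^ 2. Proof. by rewrite !expnS expn0 muln1. Qed.

Lemma layout_bounds : [/\ b0 <= S ^ 2, b1 <= S ^ 3, b2 <= S ^ 3, b3 <= S ^ 4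
  & [/\ b4 <= S ^ 9, b5 <= S ^ 9, b6 <= S ^ 9 & b * E + 1 <= S ^ 9]].
Proof.
have b0S : b0 <= S ^ 2.
  by rewrite b0E -SS2 SE !mulnDr !mulnDl; lia.
have [p0 p1 p2] := And3 (pow6 0) (pow6 1) (pow6 2).
have [p3 p4 p5] := And3 (pow6 3) (pow6 4) (pow6 5).
have [p6 p7 p8] := And3 (pow6 6) (pow6 7) (pow6 8).
have nS1 : n <= S ^ 1 by rewrite expn1 ltnW.
move: p0 p1 p2 p3 p4 p5 p6 p7 p8 nS1 b0S (b1E) (b2E) (b3E) (b4E) (b5E) (b6E).
rewrite SS2 bE8 bd4 b3S expn0; clear.
(* With the powers of [S] generalized, the factor 6 between consecutive ones leaves only linear
   inequalities. *)
move: (S ^ 1) (S ^ 2) (S ^ 3) (S ^ 4) (S ^ 5) (S ^ 6) (S ^ 7) (S ^ 8) (S ^ 9).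
move=> *; do !split; lia.
Qed.

Let X_gt0 : 0 < X. Proof. by apply: leq_trans X_ge; rewrite expn_gt0 S0. Qed.

Let SX i : i <= 9 -> S ^ i <= X.
Proof. by move=> le_i; apply: leq_trans X_ge; rewrite leq_pexp2l. Qed.

Let X8 : 8 <= X.
Proof. by apply: leq_trans (SX (isT : 2 <= 9)); rewrite -SS2 (leq_trans (_ : 8 <= 6 * 6)) // leq_mul. Qed.

Let small v : v <= X -> bitlen v <= X. Proof. exact: bitlen_leq. Qed.

Let S_le : S <= X. Proof. by have := SX (isT : 1 <= 9); rewrite expn1. Qed.

Let lt2 v : v < 2 ^ S ^ 8 -> bitlen v <= X.
Proof.
by move=> lt_v; apply: leq_trans (SX (isT : 8 <= 9)); rewrite leq_bitlen // expn_gt0 S0.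
Qed.

Let dX : d <= X.
Proof.
by rewrite dE (leq_trans _ (SX (isT : 2 <= 9))) // -SS2 leq_mul2r (leq_trans _ S6) ?orbT.
Qed.

Let ksS : ks < S.
Proof.
rewrite SE ksE flagE.
by case: (leqP k n) => kn; case: (leqP w k) => wk; rewrite ?muln0 ?muln1; lia.
Qed.

(** Addresses in the last arrays are exponential in [l], but only their bit length is charged, and
    that is polynomial. *)
Let Lc_bits : bitlen (Lc * b) <= X /\ bitlen b7 <= X.
Proof.
have lt_b7 : b7 < 2 ^ S ^ 8.
  have [_ _ _ _ [_ _ b6S _]] := layout_bounds.
  have S2 i : S ^ i <= 2 ^ (S * i) by case: i => [|i]; rewrite ?muln0 // expnM leq_exp2r // ltnW // ltn_expl.
  have le_S : S * 9 + 1 < S ^ 8.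
    apply: leq_trans (_ : S ^ 3 <= _); last by rewrite leq_pexp2l.
    have := pow6 1; have := pow6 2; rewrite expn1; move: S6 (S ^ 2) (S ^ 3); clear; lia.
  apply: leq_trans (_ : 2 ^ (S * 9 + 1) <= _); last by rewrite leq_pexp2l // ltnW.
  rewrite b7E addn1 expnS mul2n -addnn -addnS leq_add //.
    exact: leq_trans b6S (S2 9).
  apply: leq_ltn_trans (_ : 2 ^ (S * 4) < _); last by rewrite ltn_exp2l // ltn_mul2l S0.
  rewrite LcE b3S mulnS expnD leq_mul ?S2 // leq_exp2l //; exact: ltnW.
split; apply: lt2 => //; apply: leq_ltn_trans lt_b7.
by rewrite b7E leq_addl.
Qed.

(** A bound on the length of every array; only the path sums and their prefix totals have a length
    exponential in [l]. *)
Let B := Lc * X.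

Let Lc_gt0 : 0 < Lc. Proof. by rewrite LcE expn_gt0. Qed.

Let ltX v : v <= S ^ 8 + 1 -> v < X.
Proof.
move=> le_v; apply: leq_ltn_trans le_v (leq_trans _ X_ge).
apply: leq_trans (pow6 8); have : 0 < S ^ 8 by rewrite expn_gt0 S0.
move: (S ^ 8) => z; clear; lia.
Qed.

Let SX8 i : i <= 8 -> S ^ i <= S ^ 8 + 1.
Proof. by move=> le_i; rewrite addn1 leqW // leq_pexp2l. Qed.

Let btop := b7 + (Lc + 1).

Let le7 : b7 <= btop. Proof. exact: leq_addr. Qed.
Let le6 : b6 <= btop. Proof. by apply: leq_trans le7; rewrite b7E leq_addr. Qed.
Let le5 : b5 <= btop. Proof. by apply: leq_trans le6; rewrite b6E leq_addr. Qed.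
Let le4 : b4 <= btop. Proof. by apply: leq_trans le5; rewrite b5E leq_addr. Qed.
Let le3 : b3 <= btop. Proof. by apply: leq_trans le4; rewrite b4E leq_addr. Qed.
Let le2 : b2 <= btop. Proof. by apply: leq_trans le3; rewrite b3E leq_addr. Qed.
Let le1 : b1 <= btop. Proof. by apply: leq_trans le2; rewrite b2E leq_addr. Qed.

Let block_bits base top N t : top = base + N -> top <= btop -> t < N ->
  bitlen (M (base + t)) <= X.
Proof.
move=> -> le_top lt_t; apply: M_bits; apply: leq_trans le_top.
by rewrite ltn_add2l.
Qed.

Let nX : n <= X. Proof. exact: leq_trans (ltnW nS) S_le. Qed.

Ltac tame_tac := simpl; unfold update; simpl;
  repeat match goal with
  | |- _ /\ _ => split
  | |- and3 _ _ _ => split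
  | |- True => exact I
  | |- forall _ : nat, _ => intro
  | |- (is_true (_ < _) -> _) => intro
  end; try (by apply: (leq_trans _ X8)); try exact nX.

Ltac let_step v := apply: (VLet (v := v));
  [by [] | by [] | | by move=> m mM; tame_tac | move=> m mM; simpl; rewrite ?testE | ].

Ltac fill_step N := apply: (VFill (N := N));
  [by [] | by [] | by [] | by [] | by [] | | | by move=> m mM; tame_tac
  | move=> m mM; simpl; rewrite ?testE | move=> t m lt_t mM; tame_tac | | | ].

Lemma program_valid : valid O X 40 B M program [::] b0 cs
  (rcons regs (flag * \sum_(i < E) ((\sum_(L < Lc) sums L kk l n) %/ (2 ^ b) ^ i) %% 2))
  (b7 + (Lc + 1)).
Proof.
rewrite -[cs]cats0.
have [b0X b1X b2X b3X [b4X b5X b6X bEX]] := layout_bounds.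
have CX : C <= X by apply: leq_trans S_le; rewrite SE; lia.
have ltB v : v < X -> v < B by move=> /leq_trans; apply; rewrite leq_pmull.
have flag1 : flag <= 1 by rewrite flagE; case: (k <= n); case: (w <= k).
let_step n; [exact: small|by rewrite mM ?M0 // b0E|].
let_step C; [exact: small|by rewrite mM ?M1 // b0E|].
let_step p; [by apply: small; exact: leq_trans (ltnW p_lt) CX|by rewrite mM ?M2 // b0E|].
let_step k; [done|by rewrite mM ?M3 // b0E|].
let_step w; [done|by rewrite mM ?M4 // b0E|].
let_step flag; [by apply: small; exact: leq_trans X_gt0|by rewrite flagE|].
let_step kk; [by apply: small; exact: leq_trans (ltnW kkS) S_le|by rewrite kkE|].
let_step ks; [by apply: small; exact: leq_trans (ltnW ksS) S_le|by rewrite ksE|].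
let_step l; [by apply: small; exact: leq_trans (ltnW lS) S_le|by rewrite lE|].
let_step cc; [by apply: small; exact: leq_trans (ltnW ccS) S_le|by rewrite ccE|].
let_step S; [exact: small|by rewrite SE|].
let_step d; [exact: small|by rewrite dE|].
let_step b; [by apply: small; rewrite b3S SX|by rewrite bE|].
let_step E; [by apply: small; rewrite E5S SX|by rewrite EE|].
let_step b0; [by apply: small; apply: leq_trans b0X _; rewrite SX|by rewrite b0E|].
fill_step (n + 1).
- by apply/ltB/ltX; rewrite addn1 (leq_trans nS) // -{1}(expn1 S) SX8.
- apply: small; rewrite addn1; exact: leq_trans nS S_le.
- by [].
- exact: eval_scan.
- move=> t; exact: block_bits b1E le1.
rewrite -b1E.
let_step b1; [by apply: small; apply: leq_trans b1X _; rewrite SX|by rewrite b1E|].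
fill_step n.
- by apply: ltB; exact: leq_trans nS S_le.
- exact: small.
- by [].
- move=> t m; exact: eval_order.
- move=> t; exact: block_bits b2E le2.
rewrite -b2E.
let_step b2; [by apply: small; apply: leq_trans b2X _; rewrite SX|by rewrite b2E|].
fill_step (S * S).
- by apply/ltB/ltX; rewrite SS2 SX8.
- by apply: small; rewrite SS2 SX.
- by [].
- apply: leq_trans S_le; rewrite !testE.
  case: (t %% S <= n); rewrite ?muln0 // muln1 (leq_trans (leq_subr _ _)) // ltnW //.
  by rewrite ltn_mod.
- exact: eval_winner.
- move=> t; exact: block_bits b3E le3.
rewrite -b3E.
let_step b3; [by apply: small; apply: leq_trans b3X _; rewrite SX|by rewrite b3E|].
fill_step (b * E + 1).
- by apply/ltB/ltX; rewrite bE8.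
- by apply: small; exact: leq_trans bEX X_ge.
- by [].
- exact: eval_power.
- move=> t; exact: block_bits b4E le4.
rewrite -b4E.
let_step b4; [by apply: small; exact: leq_trans b4X X_ge|by rewrite b4E|].
apply: (VCoin (N := b * d)); [by []|by []|by []|by []| | |by move=> m mM; tame_tac|by []|exact: size_cs| | ].
- apply/ltB/ltX; rewrite bd4 (leq_trans _ (SX8 (isT : 5 <= 8))) //.
  by rewrite (leq_trans _ (pow6 4)) // leq_mul2r orbT.
- apply: small; rewrite bd4 (leq_trans _ (SX (isT : 5 <= 9))) //.
  by rewrite (leq_trans _ (pow6 4)) // leq_mul2r orbT.
- exact: M_coins.
rewrite -b5E.
let_step b5; [by apply: small; exact: leq_trans b5X X_ge|by rewrite b5E|].
fill_step b.
- by apply/ltB/ltX; rewrite b3S SX8.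
- by apply: small; rewrite b3S SX.
- by [].
- exact: dX.
- exact: eval_word.
- move=> t; exact: block_bits b6E le6.
rewrite -b6E.
let_step b6; [by apply: small; exact: leq_trans b6X X_ge|by rewrite b6E|].
let_step Lc.
- by apply: leq_trans Lc_bits.1; apply: bitlen_mono; rewrite leq_pmulr // b3S expn_gt0 S0.
- have lt_l : l < b * E + 1 by rewrite bE8 (leq_trans lS) // -{1}(expn1 S) SX8.
  rewrite mM; first by rewrite M_pow ?LcE.
  by rewrite -[X in _ < X]addn0 (ltn_array _ lt_l).
fill_step (Lc * b).
- by rewrite ltn_pmul2l // ltX // b3S SX8.
- exact: Lc_bits.1.
- by [].
- rewrite !testE; apply: leq_trans S_le; rewrite ltnW // ltn_mod //.
- exact: leq_trans (ltnW ccS) S_le.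
- exact: leq_trans (ltnW lS) S_le.
- exact: eval_path.
- move=> t; exact: block_bits b7E le7.
rewrite -b7E.
let_step b7; [exact: Lc_bits.2|by rewrite b7E|].
fill_step (Lc + 1).
- by rewrite /B; move: X8 Lc_gt0; clear; nia.
- apply: leq_trans Lc_bits.1; apply: bitlen_mono; rewrite addn1 -[X in X < _]muln1 ltn_pmul2l //.
  by rewrite b3S (leq_trans _ (pow6 2)) // (leq_trans (_ : 2 <= 6 * 1)) // leq_mul2l expn_gt0 S0.
- by [].
- exact: eval_total.
- move=> t; exact: block_bits (erefl btop) (leqnn _).
apply: (VLet (v := flag * \sum_(i < E) ((\sum_(L < Lc) sums L kk l n) %/ (2 ^ b) ^ i) %% 2)).
- by [].
- by [].
- apply: small; apply: leq_trans (_ : 1 * \sum_(i < E) 1 <= _).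
    by apply: leq_mul => //; apply: leq_sum => i _; rewrite modn2 leq_b1.
  by rewrite mul1n sum_nat_const card_ord muln1 E5S SX.
- by move=> m mM; tame_tac; rewrite E5S SX.
- exact: eval_result.
exact: VNil.
Qed.

End Evaluation.

(** * Correctness of the algorithm *)

Fixpoint layout (l : seq (nat * (nat -> nat))) (a : nat) : nat :=
  if l is (N, g) :: l then if a < N then g a else layout l (a - N) else 0.

Lemma layout_hit N g l t : t < N -> layout ((N, g) :: l) t = g t.
Proof. by move=> /= ->. Qed.

Lemma layout_skip N g l a : layout ((N, g) :: l) (N + a) = layout l a.
Proof. by rewrite /= ltnNge leq_addr addKn. Qed.

Lemma layout_bits X N g l : (forall t, t < N -> bitlen (g t) <= X) ->
  (forall a, bitlen (layout l a) <= X) ->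
  forall a, bitlen (layout ((N, g) :: l) a) <= X.
Proof. by move=> gX lX a /=; case: ifP => [/gX|]. Qed.

Lemma nth_allpairs (T1 T2 : Type) (f : T1 -> T2 -> nat) x1 x2 (s : seq T1) (t : seq T2) i j :
  i < size s -> j < size t ->
  nth 0 [seq f x y | x <- s, y <- t] (i * size t + j) = f (nth x1 s i) (nth x2 t j).
Proof.
move=> + lt_j; elim: s i => //= x s IHs [|i] lt_i; rewrite nth_cat size_map.
  by rewrite mul0n add0n lt_j (nth_map x2).
by rewrite mulSn -addnA ltnNge leq_addr addKn IHs.
Qed.

Lemma size_encode I : size (encode I) = 5 + nvoters I * nvoters I + nvoters I * ncands I.
Proof. by rewrite /encode !size_cat !size_allpairs !size_enum_ord addnA. Qed.

Lemma encode_adj I (u v : 'I_(nvoters I)) :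
  nth 0 (encode I) (5 + u * nvoters I + v) = adj u v.
Proof.
have lt_uv : u * nvoters I + v < nvoters I * nvoters I by apply: ltn_mulD.
rewrite /encode -addnA nth_cat [size [:: _; _; _; _; _]]/= ltnNge leq_addr /= addKn nth_cat size_allpairs !size_enum_ord lt_uv.
have := @nth_allpairs _ _ (fun u v : 'I_(nvoters I) => nat_of_bool (adj u v)) u v
  (enum 'I_(nvoters I)) (enum 'I_(nvoters I)) u v.
by rewrite !size_enum_ord => ->; rewrite ?nth_ord_enum.
Qed.

Lemma instance_size_gt I : 5 + nvoters I * nvoters I + nvoters I * ncands I <= instance_size I.
Proof.
rewrite -size_encode -sum1_size /instance_size; apply: leq_sum => x _.
exact: bitlen_gt0.
Qed.

Lemma encode_bits I a : bitlen (nth 0 (encode I) a) <= maxn 1 (instance_size I).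
Proof.
have [lt_a|le_a] := ltnP a (size (encode I)); last by rewrite nth_default // leq_max leqnn.
by rewrite /instance_size (big_nth 0) big_mkord (bigD1 (Ordinal lt_a)) //= leq_max leq_addr orbT.
Qed.

Lemma endpoint_le n A t : endpoint n A t <= t.
Proof. by elim: t => //= t IHt; case: ifP => _ //; exact: leqW. Qed.

Section Instance.

Variables (I : instance) (eta : {set 'I_(nvoters I)} -> 'I_(ncands I)).
Hypothesis I_path : is_path I.

Let n := nvoters I.
Let C := ncands I.
Let p : nat := target I.
Let k := ndistr I.
Let w := nwins I.
Let O := oracle eta.
Let flag : nat := (k <= n) * (w <= k).
Let kk := k * flag.
Let ks := w * flag.
Let l := kk - ks.
Let cc := ks - 1.
Let S := n + C + 4.
Let d := 4 * S.
Let b := S * S * S.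
Let E := S * S * S * S * S.
Let Lc := 2 ^ l.
Let b0 := 5 + n * n + n * C.
Let b1 := b0 + (n + 1).
Let b2 := b1 + n.
Let b3 := b2 + S * S.
Let b4 := b3 + (b * E + 1).
Let b5 := b4 + b * d.
Let b6 := b5 + b.
Let b7 := b6 + Lc * b.
Let X := instance_size I ^ 9.
Let Adj u v := nth 0 (encode I) (5 + u * n + v).
Definition winner i j := O [seq traversal n Adj t | t <- iota i ((j - i) * (j <= n))].

Definition coin_count := b * d.

Definition verdict (cs : seq bool) : nat :=
  flag * \sum_(i < E) (fingerprint (R := nat) S cc p winner kk l n d (2 ^ b)%N cs %/ (2 ^ b) ^ i) %% 2.

Let n_gt0 : 0 < n. Proof. by case: I_path. Qed.
Let C_gt0 : 0 < C. Proof. exact: leq_ltn_trans (ltn_ord (target I)). Qed.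

Let S_le : S <= instance_size I.
Proof.
apply: leq_trans (instance_size_gt I); rewrite -/n -/C /S.
have : n <= n * n by rewrite leq_pmull.
have : C <= n * C by rewrite leq_pmull.
lia.
Qed.

Let S6 : 6 <= S. Proof. by move: n_gt0 C_gt0; rewrite /S; clear; lia. Qed.
Let size_gt0 : 0 < instance_size I. Proof. by rewrite (leq_trans _ S_le) // (leq_trans _ S6). Qed.

Let O_lt s : O s < C. Proof. exact: ltn_ord. Qed.

Let labelling_ex : exists2 h, labelling (@adj I) h & forall t : 'I_n, traversal n Adj t = h t.
Proof.
case: I_path => _ [f f_bij f_adj].
by apply: traversal_labelling n_gt0 (conj f_bij f_adj) => u v; exact: encode_adj.
Qed.

Lemma winner_segment h : labelling (@adj I) h -> (forall t : 'I_n, traversal n Adj t = h t) ->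
  forall i j, i < j <= n -> winner i j = eta (segment h i j).
Proof.
move=> [h_bij _] hE i j /andP[lt_ij le_jn]; rewrite /winner /O /oracle le_jn muln1.
congr (nat_of_ord (eta _)); apply/setP => v; rewrite inE.
have [g hK gK] := h_bij; rewrite -(gK v) mem_segment //.
apply/mapP/idP => [[t]|tP].
  rewrite mem_iota subnKC ?(ltnW lt_ij) // => tP.
  have lt_tn : t < n by case/andP: tP => _ /leq_trans; apply.
  rewrite (hE (Ordinal lt_tn)) => /ord_inj/(congr1 g); rewrite !hK => ->.
  by [].
exists (val (g v)); last by rewrite hE.
by rewrite mem_iota subnKC // ltnW.
Qed.

Let flag_cases : flag = 0 \/ [/\ flag = 1, k <= n & w <= k].
Proof. by rewrite /flag; case: (leqP k n) => ?; case: (leqP w k) => ?; [right|left|left|left]. Qed.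

Let kk_le : kk <= n.
Proof. by rewrite /kk; case: flag_cases => [->|[-> ? ?]]; rewrite ?muln0 ?muln1. Qed.

Let ks_le : ks <= n.
Proof.
rewrite /ks; case: flag_cases => [->|[-> kn wk]]; rewrite ?muln0 ?muln1 //.
exact: leq_trans kn.
Qed.

Let nS : n < S. Proof. by rewrite /S; clear; lia. Qed.
Let S0 : 0 < S. Proof. exact: leq_ltn_trans nS. Qed.
Let lS : l < S. Proof. by apply: leq_ltn_trans nS; apply: leq_trans (leq_subr _ _) kk_le. Qed.
Let cS : cc < S. Proof. by apply: leq_ltn_trans nS; apply: leq_trans (leq_subr _ _) ks_le. Qed.
Let winS i j : winner i j < S.
Proof. by apply: ltn_trans (O_lt _) _; rewrite /S; move: n_gt0; clear; lia. Qed.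

Let b3S : b = S ^ 3. Proof. by rewrite !expnS expn0 muln1 mulnA. Qed.
Let E5S : E = S ^ 5. Proof. by rewrite !expnS expn0 muln1 !mulnA. Qed.
Let bE8 : b * E = S ^ 8. Proof. by rewrite b3S E5S -expnD. Qed.

(** The bit lengths of the path sums and of their total stay below [S ^ 8 = b * E], so [E] digits in
    base [2 ^ b] suffice. *)
Let weight_le j : j < S -> S + j * (4 * S + b * (4 * S + S ^ 3)) < S ^ 8.
Proof.
move=> jS; have p6 i : 6 * S ^ i <= S ^ i.+1 by rewrite expnS leq_mul2r S6 orbT.
set q := 4 * S + b * _; have [p1 p2 p3] := And3 (p6 1) (p6 2) (p6 3).
have [p4 p5 p6'] := And3 (p6 4) (p6 5) (p6 6); have p7 := p6 7.
have qE : q = 4 * S ^ 1 + 4 * S ^ 4 + S ^ 6.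
  by rewrite /q b3S mulnDr expn1 mulnCA -expnSr -expnD addnA.
have q2 : 2 * q <= S ^ 7.
  by move: p1 p2 p3 p4 p5 p6' (p6 0); rewrite qE expn0; clear; lia.
apply: leq_trans (_ : S * S ^ 1 + S * q <= _).
  rewrite expn1 -addSn leq_add ?leq_mul2r ?(ltnW jS) ?orbT //.
  by rewrite -[X in X < _]muln1 ltn_pmul2l // (leq_trans _ S6).
rewrite -expnS [X in _ <= X]expnS.
have : S * (2 * q) <= S * S ^ 7 by rewrite leq_mul2l q2 orbT.
have : S ^ 2 <= S * q.
  rewrite expnS expn1 leq_mul2l qE expn1; apply/orP; right; clear; lia.
rewrite mulnCA; clear; lia.
Qed.

Lemma verdictE cs : (verdict cs != 0) =
  (flag == 1) && (fingerprint S cc p winner kk l n d ('X : {poly 'F_2})%R cs != 0%R).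
Proof.
rewrite -(@fingerprint_digits _ _ _ _ _ _ _ _ (2 ^ b)%N E).
- rewrite /verdict; case: flag_cases => [->|[-> _ _]]; first by rewrite mul0n.
  by rewrite mul1n.
- by rewrite b3S oddX orbF -lt0n expn_gt0 S0.
(* Exponent 0 evaluates at 1: the sum of the coefficients has at most [l + n * (4 * S)] bits, fewer
   than [b], so there are no carries. *)
- have := fingerprint_le p kk winS cS nS lS S6 (erefl d) 0 cs.
  move=> /leq_ltn_trans; apply; rewrite mul0n addn0 ltn_exp2l // /b.
  by move: lS nS S6; clear; nia.
apply: leq_ltn_trans (fingerprint_le p kk winS cS nS lS S6 (erefl d) b cs) _.
rewrite -expnM bE8 ltn_exp2l //; apply: leq_ltn_trans (weight_le nS).
by rewrite leq_add2r ltnW.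
Qed.

Section Execution.

Variable cs : seq bool.
Hypothesis size_cs : size cs = b * d.

Let word u : nat := sample (R := nat) d (2 ^ b)%N (coin_word d cs u).
Let sums L a r j : nat := path_sum (R := nat) S cc p winner l word
  (fun t i => ((2 ^ b)%N ^+ (t * i))%R) L a r j.

Definition final_memory : nat -> nat := layout
  [:: (b0, nth 0 (encode I)); (n + 1, endpoint n Adj); (n, traversal n Adj);
      (S * S, fun t => winner (t %/ S) (t %% S)); (b * E + 1, expn 2);
      (b * d, fun t => nat_of_bool (nth false cs t)); (b, word);
      (Lc * b, fun t => sums (t %/ (S * S * S)) (t %/ S %% S) (t %% S) (t %/ (S * S) %% S));
      (Lc + 1, fun t => \sum_(L < t) sums L kk l n)].

Let S9X : S ^ 9 <= X. Proof. by rewrite leq_exp2r. Qed.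

Let ltX v : v <= S ^ 8 -> v < X.
Proof.
move=> le_v; apply: leq_ltn_trans le_v (leq_trans _ S9X).
by rewrite ltn_exp2l // (leq_trans _ S6).
Qed.

Let X8 : 8 <= X.
Proof.
apply/ltX; apply: leq_trans (_ : S ^ 2 <= _); last by rewrite leq_pexp2l.
by rewrite (leq_trans (_ : 7 <= 6 ^ 2)) // leq_exp2r.
Qed.

Let size_leX : instance_size I <= X.
Proof. by rewrite -[X in X <= _]expn1 leq_pexp2l. Qed.

Let input_bits a : bitlen (nth 0 (encode I) a) <= X.
Proof. by apply: leq_trans (encode_bits I a) _; rewrite geq_max size_leX (leq_trans _ X8). Qed.

Let lt2 v : v < 2 ^ S ^ 8 -> bitlen v <= X.
Proof.
move=> lt_v; apply: leq_trans (ltnW (ltX (leqnn _))); by rewrite leq_bitlen // expn_gt0 S0.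
Qed.

Let small v : v <= S -> bitlen v <= X.
Proof.
move=> le_v; apply: bitlen_leq; first exact: leq_trans X8.
apply: leq_trans le_v (ltnW (ltX _)); by rewrite -{1}(expn1 S) leq_pexp2l.
Qed.

Let traversal_lt t : t < n -> traversal n Adj t < n.
Proof. by have [h _ hE] := labelling_ex => lt_t; rewrite (hE (Ordinal lt_t)). Qed.

Let sums_le L a r j : sums L a r j <= 2 ^ (j * (4 * S + b * (4 * S + S ^ 3))).
Proof. exact: (path_sum_pow_le p winS cS nS lS S6 (erefl d) b cs L a r j). Qed.

Lemma final_memory_bits a : bitlen (final_memory a) <= X.
Proof.
move: a; apply: layout_bits => [t _|]; first exact: input_bits.
apply: layout_bits => [t|].
  rewrite addn1 ltnS => le_t; apply: small; apply: leq_trans (endpoint_le _ _ _) _.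
  by rewrite (leq_trans le_t) // ltnW.
apply: layout_bits => [t /traversal_lt lt_t|].
  by apply: small; exact: ltnW (ltn_trans lt_t nS).
apply: layout_bits => [t _|]; first by apply: small; exact: ltnW.
apply: layout_bits => [t|].
  rewrite addn1 ltnS bE8 => le_t; rewrite leq_bitlen ?(leq_trans _ X8) //.
  by rewrite ltn_exp2l // ltX.
apply: layout_bits => [t _|]; first by apply: small; apply: leq_trans (leq_b1 _) S0.
apply: layout_bits => [t _|].
  apply: lt2; apply: leq_ltn_trans (sample_le _ _ _) _; first by rewrite expn_gt0.
  apply: leq_trans (_ : 2 ^ (d + b * d) <= _).
    by rewrite expnD expnM ltn_pmul2r; [exact: ltn_expl|rewrite !expn_gt0].
  rewrite leq_pexp2l //; apply: leq_trans (ltnW (weight_le (leq_trans _ S6 : 1 < S))) => //.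
  by rewrite mul1n mulnDr; apply: leq_trans (leq_addl _ _); rewrite leq_add2l leq_addr.
apply: layout_bits => [t _|].
  apply: lt2; apply: leq_ltn_trans (sums_le _ _ _ _) _.
  rewrite ltn_exp2l //; apply: leq_ltn_trans (leq_addl S _) (weight_le _).
  by rewrite ltn_mod.
apply: layout_bits => [t|a]; last by rewrite (leq_trans _ X8).
rewrite addn1 ltnS => le_t; apply: lt2.
apply: leq_ltn_trans (_ : Lc * 2 ^ (n * (4 * S + b * (4 * S + S ^ 3))) < _).
  apply: leq_trans (_ : t * 2 ^ (n * (4 * S + b * (4 * S + S ^ 3))) <= _); last first.
    by rewrite leq_mul2r le_t orbT.
  rewrite -[X in X * _]card_ord -sum_nat_const; apply: leq_sum => L _; exact: sums_le.
rewrite -expnD ltn_exp2l //; apply: leq_ltn_trans (weight_le nS).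
by rewrite leq_add2r ltnW.
Qed.

Ltac locate_block := rewrite /final_memory /b7 /b6 /b5 /b4 /b3 /b2 /b1;
  move: (b0) (n + 1) (b * E + 1) => ? ? ? lt_t;
  rewrite -?addnA ?layout_skip layout_hit.

Lemma final_memory_valid : valid O X 40 (Lc * X) final_memory program [::] b0 cs
  [:: n; C; p; k; w; flag; kk; ks; l; cc; S; d; b; E; b0; b1; b2; b3; b4; b5; b6; Lc; b7;
      verdict cs] (b7 + (Lc + 1)).
Proof.
have inputE t : t < b0 -> final_memory t = nth 0 (encode I) t by exact: layout_hit.
apply: (@program_valid _ _ _ _ _ _ _ _ _ _ _ _ _ _ _ _ _ _ _ _ _ _ _ _ _ _ _ winner Adj) => //.
- move=> u v lt_u lt_v; rewrite inputE // /b0 -addnA.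
  by have := ltn_mulD lt_u lt_v; clear; lia.
- by move=> t; locate_block.
- by move=> t; locate_block.
- by move=> t; locate_block.
- by move=> t; locate_block.
- by move=> t; locate_block.
- by move=> t; locate_block.
- by move=> t; locate_block.
- by move=> t; locate_block.
- by have := input_bits 3.
- by have := input_bits 4.
- exact: ltn_ord.
- move=> a _; exact: final_memory_bits.
Qed.

Lemma algorithm_exec rest :
  exists t s, [/\ exec O algorithm (init (encode I) (cs ++ rest)) t s,
    t <= 2 ^ l * X ^ (rank_prog program + 3)
    & vars s 0 = verdict cs].
Proof.
have O_bound v : bitlen (O v) <= X.
  by apply: small; rewrite ltnW // (ltn_trans (O_lt v)) // /S; move: n_gt0; clear; lia.
have B_gt0 : 0 < Lc * X by rewrite muln_gt0 expn_gt0 (leq_trans _ X8).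
have g0 : good X final_memory [::] b0 (init (encode I) (cs ++ rest)).
  by split=> // a lt_a; rewrite /final_memory layout_hit.
have [t [s [e_s tb [[_ vb] Ev _] _]]] :=
  prog_exec X8 O_bound B_gt0 final_memory_valid g0 erefl.
have v23 : vars s 23 = verdict cs by rewrite Ev.
set s1 := set_var s 0 0; set s2 := set_var s1 0 (vars s1 0 + vars s1 23).
exists (t + (bitlen 0 + (bitlen (vars s1 0) + bitlen (vars s1 23)))), s2; split.
- by apply: ESeq e_s _; apply: ESeq; [exact: EConst|exact: EArith].
- have : bitlen (vars s1 23) <= X by exact: (vb 23).
  rewrite -[bitlen 0]/1; move: tb.
  rewrite -mulnA -expnS addn3 [X ^ _.+3]expnS (mulnCA (2 ^ l)).
  have : X <= 2 ^ l * X ^ (rank_prog program).+2.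
    apply: leq_trans (_ : 1 * X ^ 1 <= _); first by rewrite mul1n expn1.
    by rewrite leq_mul ?expn_gt0 // leq_pexp2l // (leq_trans _ X8).
  rewrite -/Lc; move: (Lc * _) X8 => u X8' Xu tu vX.
  have : 8 * u <= X * u by rewrite leq_mul2r X8' orbT.
  move: vX tu Xu X8'; clear; lia.
by rewrite /s2 /= v23.
Qed.

End Execution.

(** A run is stuck once the coins are exhausted, so the tuple of coins, whose length is the time
    bound, has to cover all the flips. *)
Lemma coin_count_le : coin_count <= 2 ^ l * X ^ (rank_prog program + 3).
Proof.
apply: leq_trans (_ : 1 * X ^ 1 <= _); last first.
  by rewrite leq_mul ?expn_gt0 // leq_pexp2l ?addn3 // expn_gt0 size_gt0.
rewrite mul1n expn1.
rewrite /coin_count b3S mulnCA -expnSr; apply: leq_trans (_ : S ^ 9 <= _); last by rewrite leq_exp2r.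
apply: leq_trans (_ : S ^ 5 <= _); last by rewrite leq_pexp2l.
by rewrite expnS leq_mul2r (leq_trans _ S6) ?orbT.
Qed.

Lemma solvable_yes : flag = 1 -> yes_instance eta <-> solvable S cc p winner kk l n.
Proof.
move=> flag1; have [h [h_bij h_adj] hE] := labelling_ex.
have winE := winner_segment (conj h_bij h_adj) hE.
have [//|[_ kn wk]] : flag = 0 \/ [/\ flag = 1, k <= n & w <= k] := flag_cases.
  by rewrite flag1.
rewrite /cc /l /kk /ks flag1 !muln1.
apply: (yes_solvable h_bij h_adj winE wk).
exact: leq_trans wk (leq_trans kn (ltnW nS)).
Qed.

Lemma verdict_sound cs : verdict cs != 0 -> yes_instance eta.
Proof.
rewrite verdictE => /andP[/eqP flag1 /fingerprint_sound]; exact: (solvable_yes flag1).2.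
Qed.

Lemma verdict_complete : yes_instance eta ->
  2 * 2 ^ coin_count <= 3 * count_tuples coin_count (fun cs => verdict cs != 0).
Proof.
move=> yes; have [kn wk] := yes_bounds yes.
have flag1 : flag = 1 by rewrite /flag kn wk.
have S3d : 3 * S ^ 3 <= 2 ^ d.
  apply: leq_trans (_ : S ^ 4 <= _).
    by rewrite expnS leq_mul2r (leq_trans _ S6) ?orbT.
  by rewrite /d mulnC expnM leq_exp2r // ltnW // ltn_expl.
have := fingerprint_complete cS nS ((solvable_yes flag1).1 yes) S3d.
rewrite -b3S -/coin_count; congr (_ <= 3 * _); apply: count_tuples_ext => cs _.
by rewrite verdictE flag1.
Qed.

(** When the flag is 0 the program works with zero districts and zero wins, hence with a single
    mask, so the bound holds also if the subtraction in the exponent is truncated. *)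
Lemma budget_le : 2 ^ l * X ^ (rank_prog program + 3) <=
  2 ^ (k - w) * instance_size I ^ (9 * (rank_prog program + 3)).
Proof.
rewrite -expnM leq_mul // leq_pexp2l // /l /kk /ks.
by case: flag_cases => [->|[-> _ _]]; rewrite ?muln0 ?muln1.
Qed.

End Instance.

Theorem theorem7 :
  exists (A : cmd) (c : nat),
  forall (I : instance) (eta : {set 'I_(nvoters I)} -> 'I_(ncands I)),
    is_path I -> tie_breaking eta ->
    let T := 2 ^ (ndistr I - nwins I) * instance_size I ^ c in
    [/\ forall r : T.-tuple bool,
          halts_within (oracle eta) A (encode I) T r,
        yes_instance eta ->
          (2%:R / 3%:R <= prob_yes (oracle eta) A (encode I) T)%R
      & ~ yes_instance eta ->
          forall r : T.-tuple bool, outputs (oracle eta) A (encode I) r false].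
Proof.
exists algorithm, (9 * (rank_prog program + 3)) => I eta I_path _ T.
have T_ge := budget_le I : _ <= T.
have coins_le : coin_count I <= T.
  exact: leq_trans (coin_count_le I_path) T_ge.
have run (r : seq bool) : size r = T -> exists t s,
    [/\ exec (oracle eta) algorithm (init (encode I) r) t s, t <= T
      & vars s 0 = verdict eta (take (coin_count I) r)].
  move=> sr; have sc : size (take (coin_count I) r) = coin_count I by rewrite size_takel ?sr.
  have [t [s [e tb v]]] := algorithm_exec eta I_path sc (drop (coin_count I) r).
  by rewrite cat_take_drop in e; exists t, s; split=> //; exact: leq_trans tb T_ge.
split.
- by move=> r; have [t [s [e tb _]]] := run r (size_tuple r); exists t, s.
- move=> yes; rewrite /prob_yes.
  (* The verdict depends only on the first [coin_count I] coins; the others multiply the count by a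
     power of 2, which cancels in the probability. *)
  have -> : #|[set r : T.-tuple bool | `[< outputs (oracle eta) algorithm (encode I) r true >]]| =
      count_tuples (coin_count I) (fun cs => verdict eta cs != 0) * 2 ^ (T - coin_count I).
    rewrite -count_tuples_take subnKC //; apply: eq_card => r; rewrite !inE.
    have [t [s [e _ v]]] := run r (size_tuple r); apply/asboolP/idP.
      by case=> t' [s' [e' v']]; have [_ Es] := exec_det e' e; rewrite -v -Es v'.
    by move=> nz; exists t, s; rewrite v nz.
  have key := verdict_complete I_path yes.
  have pow_gt0 j : (0 < (2 ^ j)%:R :> rat)%R by rewrite Num.Theory.ltr0n expn_gt0.
  rewrite Num.Theory.ler_pdivlMr ?pow_gt0 // mulrAC Num.Theory.ler_pdivrMr //.
  rewrite -!natrM Num.Theory.ler_nat -{1}(subnKC coins_le).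
  rewrite expnD mulnA [X in _ <= X]mulnAC leq_mul2r (mulnC (count_tuples _ _)) key.
  exact: orbT.
move=> no r; have [t [s [e _ v]]] := run r (size_tuple r); exists t, s; split=> //.
by apply/negbTE/negP; rewrite v => /(verdict_sound I_path).
Qed.
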